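(* Let $\mathbf k$ be a field of characteristic zero, and $\mathbf k\subset\mathbf K$ a field extension. If $P$ is a modular operad in complexes of $\mathbf k$-vector spaces with homology of finite type, then $P$ is formal if and only if $P\otimes_{\mathbf k}\mathbf K$ is a formal modular operad in complexes of $\mathbf K$-vector spaces.
   Context: Modular operads (Getzler–Kapranov) in complexes (differential of degree $-1$, Koszul signs): families $P((g,l))$, $g,l\ge0$, $2g-2+l>0$, of complexes with right $\Sigma_l$-actions, compositions $\circ_i:P((g,l))\otimes P((h,m))\to P((g+h,l+m-2))$, $1\le i\le l$, and contractions $\xi_{ij}:P((g,l))\to P((g+1,l-2))$, $i\neq j$, satisfying the usual axioms of associativity, commutativity, equivariance and compatibility (no units). $HP$ is the modular operad of componentwise homology with zero differential. A weak equivalence is a morphism of modular operads that is a homology isomorphism for every $(g,l)$. $P$ is formal if it is joined to $HP$ by a finite zigzag of weak equivalences. $P$ has homology of finite type if each $HP((g,l))$ is a finite dimensional $\mathbf k$-vector space. *)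

(* Defs.v *)
From HB Require Import structures.
From mathcomp Require Import all_boot all_order all_fingroup all_algebra.
From mathcomp Require Import boolp.
From mathcomp Require Import freeg.

Set Implicit Arguments.
Unset Strict Implicit.
Unset Printing Implicit Defensive.

Import GRing.Theory.
Local Open Scope ring_scope.

Section Submodules.
Variables (R : fieldType) (V : lmodType R).

Record submod := Submod {
  sm_mem :> V -> Prop;
  sm_0 : sm_mem 0;
  sm_lin : forall a x y, sm_mem x -> sm_mem y -> sm_mem (a *: x + y) }.

Lemma sm_D (S : submod) x y : S x -> S y -> S (x + y).
Proof. by move=> Sx Sy; rewrite -[x]scale1r; apply: sm_lin. Qed.

Lemma sm_Z (S : submod) a x : S x -> S (a *: x).
Proof. by move=> Sx; rewrite -[_ *: _]addr0; apply: sm_lin => //; apply: sm_0. Qed.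

Lemma sm_N (S : submod) x : S x -> S (- x).
Proof. by move=> Sx; rewrite -scaleN1r; apply: sm_Z. Qed.

Lemma sm_B (S : submod) x y : S x -> S y -> S (x - y).
Proof. by move=> Sx Sy; apply: sm_D => //; apply: sm_N. Qed.

Definition sm_full : submod := @Submod (fun=> True) I (fun _ _ _ _ _ => I).

Inductive span (E : V -> Prop) : V -> Prop :=
| span_0 : span E 0
| span_step a x y : E x -> span E y -> span E (a *: x + y).

Lemma span_lin (E : V -> Prop) a x y :
  span E x -> span E y -> span E (a *: x + y).
Proof.
move=> Ex Ey; elim: Ex => [|b u v Eu _ IH]; first by rewrite scaler0 add0r.
by rewrite scalerDr scalerA -addrA; apply: span_step.
Qed.

Definition sm_span E : submod := Submod (span_0 E) (@span_lin E).

End Submodules.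

Section Subquotient.
Variables (R : fieldType) (V : lmodType R) (Z B : submod V).

Definition sq_rep (x : V) : V := choose (fun y => `[< Z y /\ B (x - y) >]) x.

(* The module Z / (Z `&` B); a class is stored as its canonical element. *)
Record subquot := Subquot {
  sq_val : V;
  sq_valP : `[< Z sq_val >] && (sq_rep sq_val == sq_val) }.

HB.instance Definition _ := [isSub for sq_val].
HB.instance Definition _ := [Choice of subquot by <:].

Lemma sq_repP x : Z x -> Z (sq_rep x) /\ B (x - sq_rep x).
Proof.
move=> Zx; apply/asboolP.
apply: (@chooseP _ (fun y => `[< Z y /\ B (x - y) >])); apply/asboolP.
by split=> //; rewrite subrr; apply: sm_0.
Qed.

Lemma sq_rep_eq x y : Z x -> Z y -> B (x - y) -> sq_rep x = sq_rep y.
Proof.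
move=> Zx Zy Bxy; rewrite /sq_rep.
rewrite (@eq_choose _ _ (fun z => `[< Z z /\ B (y - z) >])); last first.
  move=> z; apply/asbool_equiv_eq; split=> -[Zz Bz]; split=> //.
    have -> : y - z = (x - z) - (x - y) by rewrite opprB [RHS]addrC addrA subrK.
    exact: sm_B.
  have -> : x - z = (x - y) + (y - z) by rewrite addrA subrK.
  exact: sm_D.
apply: choose_id; apply/asboolP; split=> //; last by rewrite subrr; apply: sm_0.
by rewrite -opprB; apply: sm_N.
Qed.

Lemma sq_pi_subproof x (Zx : Z x) :
  `[< Z (sq_rep x) >] && (sq_rep (sq_rep x) == sq_rep x).
Proof.
have [Zr Br] := sq_repP Zx; apply/andP; split; first exact/asboolP.
by rewrite (@sq_rep_eq (sq_rep x) x) // -opprB; apply: sm_N.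
Qed.

(* The class of x; the junk value off Z is the class of 0. *)
Definition sq_pi (x : V) : subquot :=
  if pselect (Z x) is left Zx then Subquot (sq_pi_subproof Zx)
  else Subquot (sq_pi_subproof (sm_0 Z)).

Lemma sq_val_mem (u : subquot) : Z (sq_val u).
Proof. by case: u => x /= /andP[/asboolP]. Qed.

Lemma sq_val_pi x : Z x -> sq_val (sq_pi x) = sq_rep x.
Proof. by rewrite /sq_pi; case: pselect. Qed.

Lemma sq_piK (u : subquot) : sq_pi (sq_val u) = u.
Proof.
apply: val_inj => /=; rewrite sq_val_pi; last exact: sq_val_mem.
by case: u => x /= /andP[_ /eqP].
Qed.

Lemma sq_pi_eq x y : Z x -> Z y -> (sq_pi x = sq_pi y) <-> B (x - y).
Proof.
move=> Zx Zy; split=> [/(congr1 sq_val)|Bxy].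
  rewrite !sq_val_pi // => exy.
  have [_ Bx] := sq_repP Zx; have [_ By] := sq_repP Zy.
  have -> : x - y = (x - sq_rep x) - (y - sq_rep y).
    by rewrite exy opprB addrA subrK.
  exact: sm_B.
by apply: val_inj => /=; rewrite !sq_val_pi //; apply: sq_rep_eq.
Qed.

Lemma sq_pi_val x : Z x -> B (sq_val (sq_pi x) - x).
Proof.
move=> Zx; rewrite sq_val_pi //; have [_ Br] := sq_repP Zx.
by rewrite -opprB; apply: sm_N.
Qed.

Lemma sq_ind (S : subquot -> Prop) : (forall x, Z x -> S (sq_pi x)) -> forall u, S u.
Proof. by move=> H u; rewrite -(sq_piK u); apply: H; apply: sq_val_mem. Qed.

Definition sq_add u v := sq_pi (sq_val u + sq_val v).
Definition sq_opp u := sq_pi (- sq_val u).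
Definition sq_scale a u := sq_pi (a *: sq_val u).

Lemma sq_addE x y : Z x -> Z y -> sq_add (sq_pi x) (sq_pi y) = sq_pi (x + y).
Proof.
move=> Zx Zy; apply/sq_pi_eq; try by apply: sm_D => //; apply: sq_val_mem.
by rewrite opprD addrACA; apply: sm_D; apply: sq_pi_val.
Qed.

Lemma sq_oppE x : Z x -> sq_opp (sq_pi x) = sq_pi (- x).
Proof.
move=> Zx; apply/sq_pi_eq; try by apply: sm_N => //; apply: sq_val_mem.
by rewrite -opprD; apply: sm_N; apply: sq_pi_val.
Qed.

Lemma sq_scaleE a x : Z x -> sq_scale a (sq_pi x) = sq_pi (a *: x).
Proof.
move=> Zx; apply/sq_pi_eq; try by apply: sm_Z => //; apply: sq_val_mem.
by rewrite -scalerBr; apply: sm_Z; apply: sq_pi_val.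
Qed.

Let ZD := @sm_D _ _ Z.
Let ZZ := @sm_Z _ _ Z.
Let ZN := @sm_N _ _ Z.
Let Z0 := sm_0 Z.

Fact sq_addA : associative sq_add.
Proof.
elim/sq_ind=> x Zx; elim/sq_ind=> y Zy; elim/sq_ind=> z Zz.
by rewrite !sq_addE ?addrA //; apply: ZD.
Qed.

Fact sq_addC : commutative sq_add.
Proof. by elim/sq_ind=> x Zx; elim/sq_ind=> y Zy; rewrite !sq_addE // addrC. Qed.

Fact sq_add0 : left_id (sq_pi 0) sq_add.
Proof. by elim/sq_ind=> x Zx; rewrite sq_addE // add0r. Qed.

Fact sq_addN : left_inverse (sq_pi 0) sq_opp sq_add.
Proof.
by elim/sq_ind=> x Zx; rewrite sq_oppE // sq_addE ?addNr //; apply: ZN.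
Qed.

HB.instance Definition _ :=
  GRing.isZmodule.Build subquot sq_addA sq_addC sq_add0 sq_addN.

Fact sq_scaleA a b u : sq_scale a (sq_scale b u) = sq_scale (a * b) u.
Proof.
by elim/sq_ind: u => x Zx; rewrite !sq_scaleE ?scalerA //; apply: ZZ.
Qed.

Fact sq_scale1 : left_id 1 sq_scale.
Proof. by elim/sq_ind=> x Zx; rewrite sq_scaleE // scale1r. Qed.

Fact sq_scaleDr : right_distributive sq_scale +%R.
Proof.
move=> a; elim/sq_ind=> x Zx; elim/sq_ind=> y Zy; rewrite -![_ + _]/(sq_add _ _).
by rewrite sq_addE // !sq_scaleE ?sq_addE ?scalerDr //; [apply: ZZ | apply: ZZ | apply: ZD].
Qed.

Fact sq_scaleDl u : {morph sq_scale^~ u : a b / a + b}.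
Proof.
elim/sq_ind: u => x Zx a b /=; rewrite -![_ + _ in RHS]/(sq_add _ _).
by rewrite !sq_scaleE // sq_addE ?scalerDl //; apply: ZZ.
Qed.

HB.instance Definition _ := GRing.Zmodule_isLmodule.Build R subquot
  sq_scaleA sq_scale1 sq_scaleDr sq_scaleDl.

Lemma sq_pi_lin a x y : Z x -> Z y -> sq_pi (a *: x + y) = a *: sq_pi x + sq_pi y.
Proof.
move=> Zx Zy; rewrite -[a *: sq_pi x]/(sq_scale _ _) sq_scaleE //.
by rewrite -[RHS]/(sq_add _ _) sq_addE //; apply: ZZ.
Qed.

Lemma sq_pi0 : sq_pi 0 = 0. Proof. by []. Qed.

Lemma sq_pi_eq0 x : Z x -> B x -> sq_pi x = 0.
Proof. by move=> Zx Bx; rewrite -sq_pi0; apply/sq_pi_eq; rewrite ?subr0. Qed.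

End Subquotient.

Definition finite_dimensional (k : fieldType) (V : lmodType k) :=
  exists s : seq V, forall v, exists c : nat -> k, v = \sum_(i < size s) c i *: s`_i.

Section ExtensionOfScalars.
Variables (k K : fieldType) (emb : {rmorphism k -> K}) (V : lmodType k).

Inductive ext_rel : {freeg V / K} -> Prop :=
| ExtRel a v w : ext_rel (<< a *: v + w >> - (emb a *: << v >> + << w >>)).

(* The tensor product of V and K over k, as a K-vector space: the free K-vector
   space on the set V modulo the subspace generated by the k-linearity relations;
   [ext_inj v] is v (x) 1. *)
Definition ext_scalars : lmodType K := subquot (sm_full _) (sm_span ext_rel).

Definition ext_inj (v : V) : ext_scalars := sq_pi (sm_full _) (sm_span ext_rel) << v >>.

Lemma ext_inj_lin a v w :
  ext_inj (a *: v + w) = emb a *: ext_inj v + ext_inj w.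
Proof.
rewrite -sq_pi_lin //; apply/sq_pi_eq => //.
rewrite -[_ - _]scale1r -[_ *: _]addr0; apply: span_step; last exact: span_0.
exact: ExtRel.
Qed.

Lemma fgscaleU (c d : K) (v : V) : c *: << d *g v >> = << c * d *g v >>.
Proof. by apply/eqP/freeg_eqP => x; rewrite coeffZ !coeffU mulrA. Qed.

Lemma ext_ind (S : ext_scalars -> Prop) :
    S 0 -> (forall c v u, S u -> S (c *: ext_inj v + u)) -> forall u, S u.
Proof.
move=> S0 SD; elim/sq_ind=> x _; rewrite -(freeg_sumE x).
elim: (dom x) => [|v s IHs]; first by rewrite big_nil.
rewrite big_cons -[coeff v x]mulr1 -fgscaleU sq_pi_lin //; exact: SD.
Qed.

Section Lift.
Variables (W : lmodType K) (phi : V -> W).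
Hypothesis phi_lin : forall a v w, phi (a *: v + w) = emb a *: phi v + phi w.

Lemma fglift_lin c x y : fglift phi (c *: x + y) = c *: fglift phi x + fglift phi y.
Proof.
have D : zmod_morphism (fglift phi) by exact: lift_is_additive.
have DD (u v : {freeg V / K}) : fglift phi (u + v) = fglift phi u + fglift phi v.
  have N w : fglift phi (- w) = - fglift phi w.
    by rewrite -[- w]add0r D -{1}(subrr w) D subrr add0r.
  by rewrite -{1}[v]opprK D N opprK.
have L0 : fglift phi 0 = 0 by rewrite -(subrr 0) D subrr.
rewrite DD; congr (_ + _); rewrite -[x]freeg_sumE.
elim: (dom x) => [|v s IHs]; first by rewrite !big_nil scaler0 L0 scaler0.
by rewrite !big_cons scalerDr !DD IHs scalerDr fgscaleU !liftU scalerA.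
Qed.

Lemma fglift_rel x : sm_span ext_rel x -> fglift phi x = 0.
Proof.
elim=> [|a _ z [b v w] _ IH].
  have /eqP := fglift_lin 1 0 0; rewrite !scale1r addr0 -subr_eq0.
  by rewrite opprD addrA subrr add0r oppr_eq0 => /eqP.
rewrite fglift_lin IH addr0 lift_is_additive fglift_lin !liftU !scale1r phi_lin.
by rewrite subrr scaler0.
Qed.

Definition ext_lift_fun (u : ext_scalars) : W := fglift phi (sq_val u).

Lemma ext_lift_pi x : ext_lift_fun (sq_pi _ _ x) = fglift phi x.
Proof.
have /fglift_rel : sm_span ext_rel (sq_val (sq_pi (sm_full _) (sm_span ext_rel) x) - x).
  exact: sq_pi_val.
rewrite -scaleN1r addrC fglift_lin scaleN1r addrC => /eqP.
by rewrite subr_eq0 => /eqP.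
Qed.

Fact ext_lift_is_linear : linear ext_lift_fun.
Proof.
move=> a; elim/sq_ind=> x _; elim/sq_ind=> y _.
by rewrite -sq_pi_lin // !ext_lift_pi fglift_lin.
Qed.

HB.instance Definition _ :=
  GRing.isLinear.Build K ext_scalars W _ ext_lift_fun ext_lift_is_linear.

Definition ext_lift : {linear ext_scalars -> W} := ext_lift_fun.

Lemma ext_lift_inj v : ext_lift (ext_inj v) = phi v.
Proof. by rewrite [LHS]ext_lift_pi liftU scale1r. Qed.

End Lift.

End ExtensionOfScalars.

(* A complex is the direct sum of its components, [cx_pr p] being the projection
   onto the component of degree p. *)
Record complex (k : fieldType) := Complex {
  cx_car :> lmodType k;
  cx_pr : int -> {linear cx_car -> cx_car};
  cx_d : {linear cx_car -> cx_car};
  cx_prK : forall p q x, cx_pr p (cx_pr q x) = if p == q then cx_pr q x else 0;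
  cx_sum : forall x, exists2 s : seq int, uniq s & x = \sum_(p <- s) cx_pr p x;
  cx_prd : forall p x, cx_pr (p - 1) (cx_d x) = cx_d (cx_pr p x);
  cx_dd : forall x, cx_d (cx_d x) = 0 }.

Definition homog (k : fieldType) (C : complex k) (p : int) (x : C) :=
  cx_pr C p x = x.

Record chain_map (k : fieldType) (C D : complex k) := ChainMap {
  cm_map :> {linear C -> D};
  cm_pr : forall p x, cm_map (cx_pr C p x) = cx_pr D p (cm_map x);
  cm_d : forall x, cm_map (cx_d C x) = cx_d D (cm_map x) }.

(* A morphism of complexes from the tensor product of C and D to E. *)
Record bichain_map (k : fieldType) (C D E : complex k) := BichainMap {
  bm_map :> C -> D -> E;
  bm_linl : forall y, linear (bm_map ^~ y);
  bm_linr : forall x, linear (bm_map x);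
  bm_homog : forall p q x y,
    homog p x -> homog q y -> homog (p + q) (bm_map x y);
  bm_leibniz : forall p x y, homog p x ->
    cx_d E (bm_map x y)
      = bm_map (cx_d C x) y + (-1 : k) ^ p *: bm_map x (cx_d D y) }.

Section ComplexTheory.
Variable k : fieldType.
Implicit Types C D E : complex k.

Lemma homog_pr C p (x : C) : homog p (cx_pr C p x).
Proof. by rewrite /homog cx_prK eqxx. Qed.

Lemma homog_lin C p a (x y : C) : homog p x -> homog p y -> homog p (a *: x + y).
Proof. by rewrite /homog linearP => -> ->. Qed.

Lemma homog_d C p (x : C) : homog p x -> homog (p - 1) (cx_d C x).
Proof. by rewrite /homog cx_prd => ->. Qed.

Lemma bm_lDZ C D E (f : bichain_map C D E) a x x' y :
  f (a *: x + x') y = a *: f x y + f x' y.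
Proof. exact: (bm_linl f y). Qed.

Lemma bm_rDZ C D E (f : bichain_map C D E) a x y y' :
  f x (a *: y + y') = a *: f x y + f x y'.
Proof. exact: (bm_linr f x). Qed.

Lemma bm_lD C D E (f : bichain_map C D E) x x' y : f (x + x') y = f x y + f x' y.
Proof. by rewrite -[x]scale1r bm_lDZ !scale1r. Qed.

Lemma bm_l0 C D E (f : bichain_map C D E) y : f 0 y = 0.
Proof. by have := bm_lDZ f (-1) 0 0 y; rewrite scaler0 addr0 scaleN1r addNr. Qed.

Lemma bm_r0 C D E (f : bichain_map C D E) x : f x 0 = 0.
Proof. by have := bm_rDZ f (-1) x 0 0; rewrite scaler0 addr0 scaleN1r addNr. Qed.

Lemma homog_ind C (S : C -> Prop) : S 0 -> (forall x y, S x -> S y -> S (x + y)) ->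
  (forall p x, homog p x -> S x) -> forall x, S x.
Proof.
move=> S0 SD Sh x; have [s _ ->] := cx_sum x.
by elim/big_rec: _ => // p y _ Sy; apply: SD => //; apply: Sh (homog_pr p x).
Qed.

End ComplexTheory.

Section Homology.
Variable k : fieldType.
Implicit Types C D E : complex k.

Section Object.
Variable C : complex k.

Fact cycle_lin a (x y : C) : cx_d C x = 0 -> cx_d C y = 0 -> cx_d C (a *: x + y) = 0.
Proof. by rewrite linearP => -> ->; rewrite scaler0 addr0. Qed.

Fact boundary_0 : exists y, 0 = cx_d C y.
Proof. by exists 0; rewrite linear0. Qed.

Fact boundary_lin a (x y : C) : (exists z, x = cx_d C z) -> (exists z, y = cx_d C z) ->
  exists z, a *: x + y = cx_d C z.
Proof. by move=> [z ->] [z' ->]; exists (a *: z + z'); rewrite linearP. Qed.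

Definition cycles : submod C := Submod (linear0 (cx_d C)) cycle_lin.
Definition boundaries : submod C := Submod boundary_0 boundary_lin.

Definition hom_car : lmodType k := subquot cycles boundaries.
Definition hom_pi : C -> hom_car := @sq_pi _ _ cycles boundaries.

Lemma hom_pi_eq0 x : hom_pi (cx_d C x) = 0.
Proof. by apply: sq_pi_eq0; [apply: cx_dd | exists x]. Qed.

Lemma cycles_pr p x : cycles x -> cycles (cx_pr C p x).
Proof. by rewrite /= -[p](addrK 1) => dx; rewrite -cx_prd addrK; rewrite dx linear0. Qed.

End Object.

Lemma hom_ind C (S : hom_car C -> Prop) :
  (forall x, cycles C x -> S (hom_pi x)) -> forall u, S u.
Proof. exact: sq_ind. Qed.

Lemma hom_pi_lin C a (x y : C) : cycles C x -> cycles C y ->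
  hom_pi (a *: x + y) = a *: hom_pi x + hom_pi y.
Proof. exact: sq_pi_lin. Qed.

Lemma hom_pi_eq C (x y : C) : cycles C x -> cycles C y ->
  boundaries C (x - y) -> hom_pi x = hom_pi y.
Proof. by move=> Zx Zy Bxy; apply/sq_pi_eq. Qed.

Section Map.
Variables (C D : complex k) (f : {linear C -> D}).
Hypothesis fZ : forall x, cycles C x -> cycles D (f x).
Hypothesis fB : forall x, boundaries C x -> boundaries D (f x).

Definition hom_fun (u : hom_car C) : hom_car D := hom_pi (f (sq_val u)).

Lemma hom_fun_pi x : cycles C x -> hom_fun (hom_pi x) = hom_pi (f x).
Proof.
move=> Zx; apply: hom_pi_eq; try by apply: fZ => //; apply: sq_val_mem.
by rewrite -linearB; apply: fB; apply: sq_pi_val.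
Qed.

Fact hom_fun_is_linear : linear hom_fun.
Proof.
move=> a; elim/hom_ind=> x Zx; elim/hom_ind=> y Zy.
rewrite -hom_pi_lin // !hom_fun_pi ?linearP ?hom_pi_lin //; try exact: fZ.
exact: (sm_lin (s := cycles C)).
Qed.

HB.instance Definition _ :=
  GRing.isLinear.Build k (hom_car C) (hom_car D) _ hom_fun hom_fun_is_linear.

Definition hom_linear : {linear hom_car C -> hom_car D} := hom_fun.

End Map.

Section Complex.
Variable C : complex k.

Fact boundaries_pr p x : boundaries C x -> boundaries C (cx_pr C p x).
Proof. by move=> [y ->]; exists (cx_pr C (p + 1) y); rewrite -cx_prd addrK. Qed.

Definition hom_pr p : {linear hom_car C -> hom_car C} :=
  hom_linear (@cycles_pr C p) (@boundaries_pr p).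

Lemma hom_pr_pi p x : cycles C x -> hom_pr p (hom_pi x) = hom_pi (cx_pr C p x).
Proof. exact: (hom_fun_pi (@cycles_pr C p) (@boundaries_pr p)). Qed.

Fact hom_prK p q u : hom_pr p (hom_pr q u) = if p == q then hom_pr q u else 0.
Proof.
elim/hom_ind: u => x Zx; rewrite !hom_pr_pi ?cx_prK //; last exact: cycles_pr.
by case: eqP.
Qed.

Fact hom_sum u : exists2 s : seq int, uniq s & u = \sum_(p <- s) hom_pr p u.
Proof.
elim/hom_ind: u => x Zx; have [s Us def_x] := cx_sum x; exists s => //.
rewrite {1}def_x; elim: s {Us def_x} => [|p s IHs]; first by rewrite !big_nil.
rewrite !big_cons -[cx_pr C p x]scale1r hom_pi_lin ?scale1r; first last.
- apply: (big_ind (cycles C)) => [|y z|q _]; first exact: sm_0.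
    exact: (@sm_D _ _ (cycles C)).
  exact: cycles_pr.
- exact: cycles_pr.
by rewrite IHs hom_pr_pi.
Qed.

Definition hom_d : {linear hom_car C -> hom_car C} := \0.

Fact hom_prd p u : hom_pr (p - 1) (hom_d u) = hom_d (hom_pr p u).
Proof. exact: linear0. Qed.

Definition homology : complex k :=
  @Complex k (hom_car C) hom_pr hom_d hom_prK hom_sum hom_prd (fun=> erefl).

Lemma homology_ind (S : homology -> Prop) :
  (forall x, cycles C x -> S (hom_pi x)) -> forall u, S u.
Proof. exact: sq_ind. Qed.

(* A homogeneous class is represented by a homogeneous cycle. *)
Lemma homology_homog_ind p (S : homology -> Prop) :
  (forall x, cycles C x -> homog p x -> S (hom_pi x)) ->
  forall u, homog p u -> S u.
Proof.
move=> HS; elim/homology_ind=> x Zx <-; rewrite [cx_pr _ _ _]hom_pr_pi //.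
by apply: HS; [apply: cycles_pr | apply: homog_pr].
Qed.

End Complex.

Section ChainMap.
Variables (C D : complex k) (f : chain_map C D).

Fact cm_cycles x : cycles C x -> cycles D (f x).
Proof. by rewrite /= -cm_d => ->; rewrite linear0. Qed.

Fact cm_boundaries x : boundaries C x -> boundaries D (f x).
Proof. by move=> [y ->]; exists (f y); rewrite cm_d. Qed.

Definition homology_linear : {linear homology C -> homology D} :=
  hom_linear cm_cycles cm_boundaries.

Lemma homology_linear_pi x :
  cycles C x -> homology_linear (hom_pi x) = hom_pi (f x).
Proof. exact: (hom_fun_pi cm_cycles cm_boundaries). Qed.

Fact homology_map_pr p u :
  homology_linear (cx_pr (homology C) p u)
    = cx_pr (homology D) p (homology_linear u).
Proof.
elim/homology_ind: u => x Zx.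
rewrite homology_linear_pi // [cx_pr _ _ _ in LHS]hom_pr_pi //.
rewrite homology_linear_pi; last exact: cycles_pr.
by rewrite [RHS]hom_pr_pi ?cm_pr //; apply: cm_cycles.
Qed.

Fact homology_map_d u :
  homology_linear (cx_d (homology C) u)
    = cx_d (homology D) (homology_linear u).
Proof. exact: linear0. Qed.

Definition homology_map : chain_map (homology C) (homology D) :=
  ChainMap homology_map_pr homology_map_d.

Lemma homology_map_pi x :
  cycles C x -> homology_map (hom_pi x) = hom_pi (f x).
Proof. exact: homology_linear_pi. Qed.

End ChainMap.

Section BichainMap.
Variables (C D E : complex k) (f : bichain_map C D E).

Lemma bm_d_cycle x y : cycles D y -> cx_d E (f x y) = f (cx_d C x) y.
Proof.
move=> /= dy; elim/homog_ind: x => [|x x'|p x Hx].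
- by rewrite linear0 !bm_l0 linear0.
- by move=> IHx IHx'; rewrite linearD !bm_lD linearD IHx IHx'.
- by rewrite (bm_leibniz _ _ Hx) dy bm_r0 scaler0 addr0.
Qed.

Fact bm_cycles x y : cycles C x -> cycles D y -> cycles E (f x y).
Proof. by move=> /= dx dy; rewrite bm_d_cycle // dx bm_l0. Qed.

Fact bm_boundaries_l x y : boundaries C x -> cycles D y -> boundaries E (f x y).
Proof. by move=> [z ->] dy; exists (f z y); rewrite bm_d_cycle. Qed.

Fact bm_boundaries_r x y : cycles C x -> boundaries D y -> boundaries E (f x y).
Proof.
move=> dx [z ->]; have [s _ ->] := cx_sum x; elim: s => [|p s IHs].
  by rewrite big_nil bm_l0; apply: sm_0.
rewrite big_cons -[cx_pr C p x]scale1r bm_lDZ scale1r; apply: sm_D IHs.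
exists ((-1 : k) ^ p *: f (cx_pr C p x) z).
rewrite linearZ /= (bm_leibniz _ _ (homog_pr p x)) cycles_pr // bm_l0 add0r.
by rewrite scalerA -expfzMl mulrN1 opprK exp1rz scale1r.
Qed.

Definition homology_bifun (u : homology C) (v : homology D) : homology E :=
  hom_pi (f (sq_val u) (sq_val v)).

Lemma homology_bifun_pi x y : cycles C x -> cycles D y ->
  homology_bifun (hom_pi x) (hom_pi y) = hom_pi (f x y).
Proof.
move=> Zx Zy; have Zx' := sq_val_mem (hom_pi x); have Zy' := sq_val_mem (hom_pi y).
apply: (@etrans _ _ (hom_pi (f x (sq_val (hom_pi y))))); apply: hom_pi_eq;
  try exact: bm_cycles.
  rewrite addrC -scaleN1r -bm_lDZ scaleN1r addrC.
  by apply: bm_boundaries_l => //; apply: sq_pi_val.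
rewrite addrC -scaleN1r -bm_rDZ scaleN1r addrC.
by apply: bm_boundaries_r => //; apply: sq_pi_val.
Qed.

Fact homology_bifun_linl v : linear (homology_bifun ^~ v).
Proof.
move=> a; elim/homology_ind=> x Zx; elim/homology_ind=> y Zy; elim/homology_ind: v => z Zz.
rewrite -[a *: _ + _]hom_pi_lin // !homology_bifun_pi ?bm_lDZ //; last exact: (@sm_lin _ _ (cycles C)).
by rewrite hom_pi_lin //; apply: bm_cycles.
Qed.

Fact homology_bifun_linr u : linear (homology_bifun u).
Proof.
move=> a; elim/homology_ind=> x Zx; elim/homology_ind=> y Zy; elim/homology_ind: u => z Zz.
rewrite -[a *: _ + _]hom_pi_lin // !homology_bifun_pi ?bm_rDZ //; last exact: (@sm_lin _ _ (cycles D)).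
by rewrite hom_pi_lin //; apply: bm_cycles.
Qed.

Fact homology_bifun_homog p q u v :
  homog p u -> homog q v -> homog (p + q) (homology_bifun u v).
Proof.
elim/homology_homog_ind=> x Zx Hx; elim/homology_homog_ind=> y Zy Hy.
rewrite homology_bifun_pi // /homog [LHS]hom_pr_pi; last exact: bm_cycles.
by rewrite (bm_homog f Hx Hy).
Qed.

Fact homology_bifun_leibniz p u v : homog p u ->
  cx_d (homology E) (homology_bifun u v)
    = homology_bifun (cx_d (homology C) u) v
      + (-1 : k) ^ p *: homology_bifun u (cx_d (homology D) v).
Proof.
move=> _; have -> : homology_bifun (cx_d (homology C) u) v = 0.
  have := homology_bifun_linl v (-1) 0 0.
  by rewrite /= scaler0 addr0 scaleN1r addNr.
have -> : homology_bifun u (cx_d (homology D) v) = 0.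
  have := homology_bifun_linr u (-1) 0 0.
  by rewrite /= scaler0 addr0 scaleN1r addNr.
by rewrite scaler0 addr0.
Qed.

Definition homology_bimap : bichain_map (homology C) (homology D) (homology E) :=
  BichainMap homology_bifun_linl homology_bifun_linr homology_bifun_homog
    homology_bifun_leibniz.

Lemma homology_bimap_pi x y : cycles C x -> cycles D y ->
  homology_bimap (hom_pi x) (hom_pi y) = hom_pi (f x y).
Proof. exact: homology_bifun_pi. Qed.

End BichainMap.

End Homology.

Section ExtComplex.
Variables (k K : fieldType) (emb : {rmorphism k -> K}).
Implicit Types C D E : complex k.

Notation "V ^K" := (ext_scalars emb V) (at level 2, format "V ^K").

Fact ext_linear_subproof (V W : lmodType k) (f : {linear V -> W}) a v w :
  ext_inj emb (f (a *: v + w))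
    = emb a *: ext_inj emb (f v) + ext_inj emb (f w).
Proof. by rewrite linearP ext_inj_lin. Qed.

Definition ext_linear (V W : lmodType k) (f : {linear V -> W}) :
  {linear V^K -> W^K} := ext_lift (ext_linear_subproof f).

Lemma ext_linear_inj (V W : lmodType k) (f : {linear V -> W}) v :
  ext_linear f (ext_inj emb v) = ext_inj emb (f v).
Proof. exact: ext_lift_inj. Qed.

Lemma ext_inj0 (V : lmodType k) : ext_inj emb (0 : V) = 0.
Proof.
have := ext_inj_lin emb (-1) (0 : V) 0.
by rewrite scaler0 addr0 rmorphN1 scaleN1r addNr.
Qed.

Lemma ext_injD (V : lmodType k) (v w : V) :
  ext_inj emb (v + w) = ext_inj emb v + ext_inj emb w.
Proof. by rewrite -[v]scale1r ext_inj_lin rmorph1 !scale1r. Qed.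

Lemma ext_injZ (V : lmodType k) a (v : V) :
  ext_inj emb (a *: v) = emb a *: ext_inj emb v.
Proof. by rewrite -[_ *: v]addr0 ext_inj_lin ext_inj0 addr0. Qed.

Section Complex.
Variable C : complex k.

Definition ext_pr p : {linear C^K -> C^K} := ext_linear (cx_pr C p).
Definition ext_d : {linear C^K -> C^K} := ext_linear (cx_d C).

Fact ext_prK p q u : ext_pr p (ext_pr q u) = if p == q then ext_pr q u else 0.
Proof.
elim/ext_ind: u => [|c v u IHu]; first by rewrite !linear0; case: eqP.
rewrite !linearP /= IHu !ext_linear_inj cx_prK.
by case: eqP => // _; rewrite ext_inj0 scaler0 addr0.
Qed.

Fact ext_prd p u : ext_pr (p - 1) (ext_d u) = ext_d (ext_pr p u).
Proof.
elim/ext_ind: u => [|c v u IHu]; first by rewrite !linear0.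
by rewrite !linearP /= IHu !ext_linear_inj cx_prd.
Qed.

Fact ext_dd u : ext_d (ext_d u) = 0.
Proof.
elim/ext_ind: u => [|c v u IHu]; first by rewrite !linear0.
by rewrite !linearP /= IHu !ext_linear_inj cx_dd ext_inj0 scaler0 addr0.
Qed.

Fact ext_sum u : exists2 s : seq int, uniq s & u = \sum_(p <- s) ext_pr p u.
Proof.
have sumW s v (t : seq int) : uniq s -> uniq t -> {subset s <= t} ->
    v = \sum_(p <- s) ext_pr p v -> v = \sum_(p <- t) ext_pr p v.
  move=> Us Ut sst def_v; rewrite (bigID (mem s)) /= [X in _ + X]big1 => [|p sp].
    rewrite addr0 -big_filter {1}def_v; apply: perm_big.
    apply: uniq_perm; rewrite ?filter_uniq // => p.
    by rewrite mem_filter /= andb_idr //; apply: sst.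
  rewrite (congr1 (ext_pr p) def_v) linear_sum big1_seq // => q /andP[_ sq] /=.
  by rewrite ext_prK; case: eqP sp => // ->; rewrite sq.
elim/ext_ind: u => [|c v u [s Us def_u]].
  by exists [::]; rewrite ?big_nil.
have [t Ut def_v] := cx_sum v; exists (undup (s ++ t)); first exact: undup_uniq.
have sub r : {subset r <= s ++ t} -> {subset r <= undup (s ++ t)}.
  by move=> h p rp; rewrite mem_undup h.
under eq_bigr do rewrite linearP.
rewrite big_split; congr (_ + _).
  rewrite -(scaler_sumr c); congr (c *: _).
  apply: (sumW t); rewrite ?undup_uniq //.
    by apply: sub => p tp; rewrite mem_cat tp orbT.
  rewrite {1}def_v; elim: t {Ut def_v sub} => [|p t IHt].
    by rewrite !big_nil ext_inj0.
  by rewrite !big_cons ext_injD IHt ext_linear_inj.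
apply: (sumW s); rewrite ?undup_uniq //.
by apply: sub => p tp; rewrite mem_cat tp.
Qed.

Definition ext_complex : complex K :=
  Complex ext_prK ext_sum ext_prd ext_dd.

Lemma ext_complex_pr_inj p v :
  cx_pr ext_complex p (ext_inj emb v) = ext_inj emb (cx_pr C p v).
Proof. exact: ext_linear_inj. Qed.

Lemma ext_complex_d_inj v :
  cx_d ext_complex (ext_inj emb v) = ext_inj emb (cx_d C v).
Proof. exact: ext_linear_inj. Qed.

Lemma ext_complex_ind (S : ext_complex -> Prop) :
  S 0 -> (forall c v u, S u -> S (c *: ext_inj emb v + u)) -> forall u, S u.
Proof. exact: ext_ind. Qed.

Lemma ext_homog_ind p (S : ext_complex -> Prop) :
    S 0 ->
    (forall c v u, homog p v -> S u -> S (c *: ext_inj emb v + u)) ->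
  forall u, homog p u -> S u.
Proof.
move=> S0 SD u <-; elim/ext_complex_ind: u => [|c v u IHu].
  by rewrite linear0.
rewrite linearP ext_complex_pr_inj; apply: SD => //.
exact: homog_pr.
Qed.

Lemma homog_ext_inj p v : homog p v -> homog p (ext_inj emb v : ext_complex).
Proof. by rewrite /homog ext_complex_pr_inj => ->. Qed.

End Complex.

Section ChainMap.
Variables (C D : complex k) (f : chain_map C D).

Fact ext_map_pr p u : ext_linear f (cx_pr (ext_complex C) p u)
  = cx_pr (ext_complex D) p (ext_linear f u).
Proof.
elim/ext_complex_ind: u => [|c v u IHu]; first by rewrite !linear0.
by rewrite !linearP /= IHu !ext_linear_inj cm_pr.
Qed.

Fact ext_map_d u : ext_linear f (cx_d (ext_complex C) u)
  = cx_d (ext_complex D) (ext_linear f u).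
Proof.
elim/ext_complex_ind: u => [|c v u IHu]; first by rewrite !linear0.
by rewrite !linearP /= IHu !ext_linear_inj cm_d.
Qed.

Definition ext_map : chain_map (ext_complex C) (ext_complex D) :=
  @ChainMap _ (ext_complex C) (ext_complex D) (ext_linear f) ext_map_pr ext_map_d.

Lemma ext_map_inj v : ext_map (ext_inj emb v) = ext_inj emb (f v).
Proof. exact: ext_linear_inj. Qed.

End ChainMap.

Section BichainMap.
Variables (C D E : complex k) (f : bichain_map C D E).

Fact ext_bi_linr x a y y' : ext_inj emb (f x (a *: y + y'))
  = emb a *: ext_inj emb (f x y) + ext_inj emb (f x y').
Proof. by rewrite bm_rDZ ext_inj_lin. Qed.

Let ext_bir (x : C) : {linear D^K -> E^K} := ext_lift (ext_bi_linr x).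

Fact ext_bi_linl v a x x' : ext_bir (a *: x + x') v
  = emb a *: ext_bir x v + ext_bir x' v.
Proof.
elim/ext_ind: v => [|c y v IHv].
  by rewrite !(linear0 (ext_bir _)) scaler0 addr0.
rewrite !(linearP (ext_bir _)) IHv !(ext_lift_inj (ext_bi_linr _)) bm_lDZ ext_inj_lin.
by rewrite !scalerDr !scalerA [emb a * c]mulrC addrACA.
Qed.

(* (x (x) a) o (y (x) b) = (x o y) (x) ab *)
Definition ext_bifun (u : ext_complex C) (v : ext_complex D) : ext_complex E :=
  ext_lift (ext_bi_linl v) u.

Lemma ext_bifun_inj x y :
  ext_bifun (ext_inj emb x) (ext_inj emb y) = ext_inj emb (f x y).
Proof.
by rewrite /ext_bifun (ext_lift_inj (ext_bi_linl _)) (ext_lift_inj (ext_bi_linr _)).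
Qed.

Fact ext_bifun_linl v : linear (ext_bifun ^~ v).
Proof. by move=> a u u'; rewrite /= /ext_bifun linearP. Qed.

Lemma ext_bifun0l v : ext_bifun 0 v = 0.
Proof. exact: linear0. Qed.

Fact ext_bifun_linr u : linear (ext_bifun u).
Proof.
move=> a v v'; elim/ext_complex_ind: u => [|c x u IHu].
  by rewrite !ext_bifun0l scaler0 addr0.
have lin w : ext_bifun (c *: ext_inj emb x + u) w = c *: ext_bir x w + ext_bifun u w.
  by rewrite -(ext_lift_inj (ext_bi_linl w) x); apply: ext_bifun_linl.
by rewrite !lin IHu linearP !scalerDr !scalerA [a * c]mulrC addrACA.
Qed.

Fact ext_bifun_homog p q u v :
  homog p u -> homog q v -> homog (p + q) (ext_bifun u v).
Proof.
have r0 w : ext_bifun w 0 = 0.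
  have := ext_bifun_linr w (-1) 0 0.
  by rewrite scaler0 addr0 scaleN1r addNr.
move=> Hu Hv; elim/ext_homog_ind: Hu => [|c x {}u Hx IHu].
  by rewrite ext_bifun0l /homog linear0.
rewrite [ext_bifun _ _]ext_bifun_linl; apply: homog_lin IHu.
elim/ext_homog_ind: Hv => [|c' y {}v Hy IHv].
  by rewrite r0 /homog linear0.
rewrite ext_bifun_linr; apply: homog_lin IHv; rewrite ext_bifun_inj.
by apply/homog_ext_inj/bm_homog.
Qed.

Fact ext_bifun_leibniz p u v : homog p u ->
  cx_d (ext_complex E) (ext_bifun u v)
    = ext_bifun (cx_d (ext_complex C) u) v
      + (-1 : K) ^ p *: ext_bifun u (cx_d (ext_complex D) v).
Proof.
have r0 w : ext_bifun w 0 = 0.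
  have := ext_bifun_linr w (-1) 0 0.
  by rewrite scaler0 addr0 scaleN1r addNr.
move=> Hu; elim/ext_homog_ind: Hu => [|c x {}u Hx IHu].
  by rewrite !ext_bifun0l !(linear0 (cx_d _)) ext_bifun0l scaler0 addr0.
have lD a w w' t : ext_bifun (a *: w + w') t = a *: ext_bifun w t + ext_bifun w' t.
  exact: ext_bifun_linl.
rewrite linearP !lD linearP IHu !scalerDr addrACA; congr (_ + _).
rewrite scalerA mulrC -scalerA -scalerDr; congr (c *: _) => {IHu c u}.
elim/ext_complex_ind: v => [|c y v IHv].
  by rewrite !(linear0 (cx_d _)) !r0 linear0 scaler0 addr0.
rewrite linearP !ext_bifun_linr linearP IHv !scalerDr addrACA; congr (_ + _).
rewrite [RHS]addrC scalerA mulrC -scalerA addrC -scalerDr; congr (c *: _).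
rewrite !ext_complex_d_inj.
rewrite !ext_bifun_inj ext_complex_d_inj (bm_leibniz _ _ Hx).
by rewrite ext_injD ext_injZ fmorphXz rmorphN1.
Qed.

Definition ext_bimap :
    bichain_map (ext_complex C) (ext_complex D) (ext_complex E) :=
  @BichainMap _ (ext_complex C) (ext_complex D) (ext_complex E) ext_bifun
    ext_bifun_linl ext_bifun_linr ext_bifun_homog ext_bifun_leibniz.

Lemma ext_bimap_inj x y :
  ext_bimap (ext_inj emb x) (ext_inj emb y) = ext_inj emb (f x y).
Proof. exact: ext_bifun_inj. Qed.

End BichainMap.

End ExtComplex.

(* The legs of an element of arity l are 0, ..., l-1.  The three functions below
   compute the labels carried by the legs of x o_i y, of xi_ij x and of x . sigma
   from the lists s, t of the labels of the legs of x, y: the composition o_i glues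
   the leg i of x to the leg 0 of y and puts the other legs of y, in order, in the
   place of the leg i of x; the leg a of x . sigma is the leg (sigma a) of x. *)
Definition glue_legs (i : nat) (s t : seq nat) : seq nat :=
  take i s ++ behead t ++ drop i.+1 s.

Definition contract_legs (i j : nat) (s : seq nat) : seq nat :=
  [seq nth 0%N s a | a <- iota 0 (size s) & (a != i) && (a != j)].

Definition permute_legs (n : nat) (sigma : 'S_n) (s : seq nat) : seq nat :=
  [seq nth 0%N s (sigma a) | a <- enum 'I_n].

(* The components outside of the stable range 2g - 2 + l > 0 are zero.  Genera and
   arities of targets are variables constrained by equations, so that no transport
   along equalities of natural numbers is needed.  An axiom whose two sides number
   their legs differently takes as argument a permutation rho matching the labels;
   the labels of x, y are 0, ..., l-1 and l, l+1, ... *)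
Record modular_operad (k : fieldType) := ModularOperad {
  mo_cx :> nat -> nat -> complex k;

  mo_act : forall g l, 'S_l -> chain_map (mo_cx g l) (mo_cx g l);

  mo_comp : forall g l h m f n, f = (g + h)%N -> n.+2 = (l + m.+1)%N -> 'I_l ->
    bichain_map (mo_cx g l) (mo_cx h m.+1) (mo_cx f n);

  mo_contr : forall g l f n, f = g.+1 -> n.+2 = l -> forall i j : 'I_l, i != j ->
    chain_map (mo_cx g l) (mo_cx f n);

  mo_stable : forall g l, ~~ (2 < g.*2 + l)%N -> forall x : mo_cx g l, x = 0;

  mo_act1 : forall g l (x : mo_cx g l), mo_act g 1%g x = x;

  (* In mathcomp, (tau * sigma)%g is "tau, then sigma". *)
  mo_actM : forall g l (sigma tau : 'S_l) (x : mo_cx g l),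
    mo_act g (tau * sigma)%g x = mo_act g tau (mo_act g sigma x);

  mo_comp_act : forall g l h m f n (ef : f = (g + h)%N) (en : n.+2 = (l + m.+1)%N)
      (i : 'I_l) (sigma : 'S_l) (tau : 'S_m.+1) (rho : 'S_n)
      (x : mo_cx g l) (y : mo_cx h m.+1),
    tau ord0 = ord0 ->
    permute_legs rho (glue_legs (sigma i) (iota 0 l) (iota l m.+1))
      = glue_legs i (permute_legs sigma (iota 0 l)) (permute_legs tau (iota l m.+1)) ->
    mo_comp ef en i (mo_act g sigma x) (mo_act h tau y)
      = mo_act f rho (mo_comp ef en (sigma i) x y);

  mo_contr_act : forall g l f n (ef : f = g.+1) (en : n.+2 = l)
      (i j : 'I_l) (sigma : 'S_l) (ne : i != j) (ne' : sigma i != sigma j)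
      (rho : 'S_n) (x : mo_cx g l),
    permute_legs rho (contract_legs (sigma i) (sigma j) (iota 0 l))
      = contract_legs i j (permute_legs sigma (iota 0 l)) ->
    mo_contr ef en ne (mo_act g sigma x) = mo_act f rho (mo_contr ef en ne' x);

  mo_contrC : forall g l f n (ef : f = g.+1) (en : n.+2 = l)
      (i j : 'I_l) (ne : i != j) (ne' : j != i) (x : mo_cx g l),
    mo_contr ef en ne x = mo_contr ef en ne' x;

  mo_compC : forall g l h m f n (ef : f = (g + h)%N) (ef' : f = (h + g)%N)
      (en : n.+2 = (l.+1 + m.+1)%N) (en' : n.+2 = (m.+1 + l.+1)%N)
      (i : 'I_l.+1) (sigma : 'S_l.+1) (rho : 'S_n)
      p q (x : mo_cx g l.+1) (y : mo_cx h m.+1),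
    homog p x -> homog q y ->
    sigma ord0 = i ->
    permute_legs rho (glue_legs 0 (iota l.+1 m.+1) (permute_legs sigma (iota 0 l.+1)))
      = glue_legs i (iota 0 l.+1) (iota l.+1 m.+1) ->
    mo_comp ef en i x y
      = (-1 : k) ^ (p * q) *: mo_act f rho (mo_comp ef' en' ord0 y (mo_act g sigma x));

  (* (x o_i y) o_j z = x o_i (y o_b z), where j is the leg b > 0 of y *)
  mo_compA : forall g l h m f n g1 r g2 s g3 t
      (e1 : g1 = (g + h)%N) (er : r.+2 = (l + m.+1)%N)
      (e2 : g2 = (h + f)%N) (es : s.+3 = (m.+1 + n.+1)%N)
      (e3 : g3 = (g1 + f)%N) (et : t.+2 = (r + n.+1)%N)
      (e3' : g3 = (g + g2)%N) (et' : t.+2 = (l + s.+1)%N)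
      (i : 'I_l) (b : 'I_m.+1) (j : 'I_r)
      (x : mo_cx g l) (y : mo_cx h m.+1) (z : mo_cx f n.+1),
    b != ord0 -> j.+1 = (i + b)%N ->
    mo_comp e3 et j (mo_comp e1 er i x y) z
      = mo_comp e3' et' i x (mo_comp e2 es b y z);

  (* (x o_i y) o_j z = +- (x o_a z) o_i y, where j is the leg a > i of x *)
  mo_compAC : forall g l h m f n g1 r g2 s g3 t
      (e1 : g1 = (g + h)%N) (er : r.+2 = (l + m.+1)%N)
      (e2 : g2 = (g + f)%N) (es : s.+2 = (l + n.+1)%N)
      (e3 : g3 = (g1 + f)%N) (et : t.+2 = (r + n.+1)%N)
      (e3' : g3 = (g2 + h)%N) (et' : t.+2 = (s + m.+1)%N)
      (i a : 'I_l) (j : 'I_r) (i' : 'I_s)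
      p q (x : mo_cx g l) (y : mo_cx h m.+1) (z : mo_cx f n.+1),
    homog p y -> homog q z ->
    (i < a)%N -> j.+1 = (a + m)%N -> i' = i :> nat ->
    mo_comp e3 et j (mo_comp e1 er i x y) z
      = (-1 : k) ^ (p * q) *: mo_comp e3' et' i' (mo_comp e2 es a x z) y;

  (* xi_ab xi_ij = xi_ij xi_ab, for i, j, a, b distinct *)
  mo_contr_contr : forall g l f n f' n'
      (ef : f = g.+1) (en : n.+2 = l) (ef' : f' = f.+1) (en' : n'.+2 = n)
      (i j a b : 'I_l) (i' j' a' b' : 'I_n)
      (ij : i != j) (ab : a != b) (ij' : i' != j') (ab' : a' != b')
      (x : mo_cx g l),
    nth 0%N (contract_legs i j (iota 0 l)) a' = a ->
    nth 0%N (contract_legs i j (iota 0 l)) b' = b ->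
    nth 0%N (contract_legs a b (iota 0 l)) i' = i ->
    nth 0%N (contract_legs a b (iota 0 l)) j' = j ->
    mo_contr ef' en' ab' (mo_contr ef en ij x)
      = mo_contr ef' en' ij' (mo_contr ef en ab x);

  (* xi_ab (x o_i y) = (xi_ab x) o_i y, for legs a, b of x *)
  mo_contr_compl : forall g l h m f n f' n' g' l'
      (ef : f = (g + h)%N) (en : n.+2 = (l + m.+1)%N) (ef1 : f' = f.+1) (en1 : n'.+2 = n)
      (eg : g' = g.+1) (el : l'.+2 = l) (ef2 : f' = (g' + h)%N) (en2 : n'.+2 = (l' + m.+1)%N)
      (i a b : 'I_l) (ab : a != b) (a' b' : 'I_n) (ab' : a' != b') (i' : 'I_l')
      (x : mo_cx g l) (y : mo_cx h m.+1),
    nth 0%N (glue_legs i (iota 0 l) (iota l m.+1)) a' = a ->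
    nth 0%N (glue_legs i (iota 0 l) (iota l m.+1)) b' = b ->
    nth 0%N (contract_legs a b (iota 0 l)) i' = i ->
    mo_contr ef1 en1 ab' (mo_comp ef en i x y)
      = mo_comp ef2 en2 i' (mo_contr eg el ab x) y;

  (* xi_ab (x o_i y) = x o_i (xi_ab y), for legs a, b > 0 of y *)
  mo_contr_compr : forall g l h m f n f' n' h' m'
      (ef : f = (g + h)%N) (en : n.+2 = (l + m.+1)%N) (ef1 : f' = f.+1) (en1 : n'.+2 = n)
      (eh : h' = h.+1) (em : m'.+3 = m.+1) (ef2 : f' = (g + h')%N) (en2 : n'.+2 = (l + m'.+1)%N)
      (i : 'I_l) (a b : 'I_m.+1) (ab : a != b) (a' b' : 'I_n) (ab' : a' != b')
      (x : mo_cx g l) (y : mo_cx h m.+1),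
    nth 0%N (glue_legs i (iota 0 l) (iota l m.+1)) a' = (l + a)%N ->
    nth 0%N (glue_legs i (iota 0 l) (iota l m.+1)) b' = (l + b)%N ->
    mo_contr ef1 en1 ab' (mo_comp ef en i x y)
      = mo_comp ef2 en2 i x (mo_contr eh em ab y);

  (* Gluing the legs i, a of x to the legs 0, b of y: one may first glue i to 0,
     or first glue a to b, which is the leg 0 of y . tau when tau 0 = b. *)
  mo_contr_compC : forall g l h m f n f' n'
      (ef : f = (g + h)%N) (en : n.+2 = (l + m.+1)%N) (ef1 : f' = f.+1) (en1 : n'.+2 = n)
      (i a : 'I_l) (b : 'I_m.+1) (tau : 'S_m.+1) (rho : 'S_n')
      (a' b' : 'I_n) (ab' : a' != b') (i' c' : 'I_n) (ic' : i' != c')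
      (x : mo_cx g l) (y : mo_cx h m.+1),
    tau ord0 = b ->
    let s := glue_legs i (iota 0 l) (iota l m.+1) in
    let t := glue_legs a (iota 0 l) (permute_legs tau (iota l m.+1)) in
    nth 0%N s a' = a -> nth 0%N s b' = (l + b)%N ->
    nth 0%N t i' = i -> nth 0%N t c' = l ->
    permute_legs rho (contract_legs i' c' t) = contract_legs a' b' s ->
    mo_contr ef1 en1 ab' (mo_comp ef en i x y)
      = mo_act f' rho (mo_contr ef1 en1 ic' (mo_comp ef en a x (mo_act h tau y))) }.

Section HomologyOperad.
Variables (k : fieldType) (P : modular_operad k).

Let H g l := homology (P g l).
Let act g l (sigma : 'S_l) : chain_map (H g l) (H g l) :=
  homology_map (mo_act P g sigma).
Let comp g l h m f n (ef : f = (g + h)%N) (en : n.+2 = (l + m.+1)%N) (i : 'I_l) :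
    bichain_map (H g l) (H h m.+1) (H f n) :=
  homology_bimap (mo_comp P ef en i).
Let contr g l f n (ef : f = g.+1) (en : n.+2 = l) (i j : 'I_l) (ne : i != j) :
    chain_map (H g l) (H f n) :=
  homology_map (mo_contr P ef en ne).

Definition rep (C : complex k) (u : homology C) (x : C) := cycles C x /\ u = hom_pi x.

Lemma rep_ex (C : complex k) (u : homology C) : exists x, rep u x.
Proof. by elim/homology_ind: u => x Zx; exists x. Qed.

Lemma rep_homog_ex (C : complex k) p (u : homology C) :
  homog p u -> exists2 x, homog p x & rep u x.
Proof. by move: u; apply: homology_homog_ind => x Zx Hx; exists x. Qed.

Lemma rep_map (C D : complex k) (f : chain_map C D) u x :
  rep u x -> rep (homology_map f u) (f x).
Proof. by move=> [Zx ->]; split; [apply: cm_cycles | apply: homology_map_pi]. Qed.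

Lemma rep_bimap (C D E : complex k) (f : bichain_map C D E) u v x y :
  rep u x -> rep v y -> rep (homology_bimap f u v) (f x y).
Proof.
by move=> [Zx ->] [Zy ->]; split; [apply: bm_cycles | apply: homology_bimap_pi].
Qed.

Lemma rep_scale (C : complex k) a (u : homology C) x : rep u x -> rep (a *: u) (a *: x).
Proof.
move=> [Zx ->]; split; first exact: (@sm_Z _ _ (cycles C)).
rewrite -[a *: x]addr0 [RHS]hom_pi_lin //; last exact: (sm_0 (cycles C)).
by rewrite [hom_pi 0]sq_pi0 addr0.
Qed.

Lemma rep_eq (C : complex k) (u v : homology C) x y : rep u x -> rep v y -> x = y -> u = v.
Proof. by move=> [_ ->] [_ ->] ->. Qed.

Local Ltac rep_auto := solve [repeat first
  [eassumption | eapply rep_map | eapply rep_bimap | eapply rep_scale]].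
Local Ltac hpi := eapply rep_eq; [rep_auto | rep_auto |].
Local Ltac reps := repeat (let u := fresh "u" in intro u; destruct (rep_ex u) as [? ?]).

Definition homology_operad : modular_operad k.
Proof.
refine (@ModularOperad k H act comp contr _ _ _ _ _ _ _ _ _ _ _ _ _).
- move=> g l Sgl u.
  by have [x [_ ->]] := rep_ex u; rewrite (mo_stable Sgl x); apply: sq_pi0.
- by move=> g l; reps; hpi; rewrite mo_act1.
- by move=> g l sigma tau; reps; hpi; rewrite mo_actM.
- move=> g l h m f n ef en i sigma tau rho; reps; move=> t0 E; hpi.
  by rewrite (mo_comp_act _ _ _ _ t0 E).
- move=> g l f n ef en i j sigma ne ne' rho; reps; move=> E; hpi.
  by rewrite (mo_contr_act _ _ ne ne' _ E).
- by move=> g l f n ef en i j ne ne'; reps; hpi; rewrite (mo_contrC _ _ ne ne').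
- move=> g l h m f n ef ef' en en' i sigma rho p q x y Hx Hy s0 E.
  have [x' Hx' Rx] := rep_homog_ex Hx; have [y' Hy' Ry] := rep_homog_ex Hy; hpi.
  by rewrite (mo_compC ef ef' en en' Hx' Hy' s0 E).
- move=> g l h m f n g1 r g2 s g3 t e1 er e2 es e3 et e3' et' i b j; reps; move=> b0 E; hpi.
  by rewrite (mo_compA e1 er e2 es e3 et e3' et' _ _ _ b0 E).
- move=> g l h m f n g1 r g2 s g3 t e1 er e2 es e3 et e3' et' i a j i' p q x y z Hy Hz ia E E'.
  have [x' Rx] := rep_ex x; have [y' Hy' Ry] := rep_homog_ex Hy.
  have [z' Hz' Rz] := rep_homog_ex Hz; hpi.
  by rewrite (mo_compAC e1 er e2 es e3 et e3' et' x' Hy' Hz' ia E E').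
- move=> g l f n f' n' ef en ef' en' i j a b i' j' a' b' ij ab ij' ab'; reps; move=> E1 E2 E3 E4; hpi.
  by rewrite (mo_contr_contr ef en ef' en' ij ab ij' ab' _ E1 E2 E3 E4).
- move=> g l h m f n f' n' g' l' ef en ef1 en1 eg el ef2 en2 i a b ab a' b' ab' i'.
  reps; move=> E1 E2 E3; hpi.
  by rewrite (mo_contr_compl ef en ef1 en1 eg el ef2 en2 ab ab' _ _ E1 E2 E3).
- move=> g l h m f n f' n' h' m' ef en ef1 en1 eh em ef2 en2 i a b ab a' b' ab'.
  reps; move=> E1 E2; hpi.
  by rewrite (mo_contr_compr ef en ef1 en1 eh em ef2 en2 ab ab' _ _ E1 E2).
- move=> g l h m f n f' n' ef en ef1 en1 i a b tau rho a' b' ab' i' c' ic'.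
  reps; move=> t0 s t E1 E2 E3 E4 E5; hpi.
  by rewrite (mo_contr_compC ef en ef1 en1 ab' ic' _ _ t0 E1 E2 E3 E4 E5).
Defined.

End HomologyOperad.

Section ExtOperad.
Variables (k K : fieldType) (emb : {rmorphism k -> K}) (P : modular_operad k).

Let PK g l := ext_complex emb (P g l).
Let act g l (sigma : 'S_l) : chain_map (PK g l) (PK g l) :=
  ext_map emb (mo_act P g sigma).
Let comp g l h m f n (ef : f = (g + h)%N) (en : n.+2 = (l + m.+1)%N) (i : 'I_l) :
    bichain_map (PK g l) (PK h m.+1) (PK f n) :=
  ext_bimap emb (mo_comp P ef en i).
Let contr g l f n (ef : f = g.+1) (en : n.+2 = l) (i j : 'I_l) (ne : i != j) :
    chain_map (PK g l) (PK f n) :=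
  ext_map emb (mo_contr P ef en ne).

Fact ext_eq (C : complex k) (D : complex K) (f g : ext_complex emb C -> D) :
  linear f -> linear g -> (forall v, f (ext_inj emb v) = g (ext_inj emb v)) ->
  forall u, f u = g u.
Proof.
move=> lf lg fg; elim/ext_complex_ind=> [|c v u IHu]; last by rewrite lf lg fg IHu.
have f0 : f 0 = 0 by have := lf (-1) 0 0; rewrite scaler0 addr0 scaleN1r addNr.
by have := lg (-1) 0 0; rewrite scaler0 addr0 scaleN1r addNr f0.
Qed.

Fact ext_homog_eq (C : complex k) (D : complex K) p (f g : ext_complex emb C -> D) :
  linear f -> linear g ->
  (forall v, homog p v -> f (ext_inj emb v) = g (ext_inj emb v)) ->
  forall u, homog p u -> f u = g u.
Proof.
move=> lf lg fg; apply: ext_homog_ind => [|c v u Hv IHu]; last by rewrite lf lg fg ?IHu.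
have f0 : f 0 = 0 by have := lf (-1) 0 0; rewrite scaler0 addr0 scaleN1r addNr.
by have := lg (-1) 0 0; rewrite scaler0 addr0 scaleN1r addNr f0.
Qed.

Section Linear.
Variables (U V W : complex K).

Lemma lin_id : linear (fun u : U => u).
Proof. by []. Qed.

Lemma lin_scale a (g : U -> V) : linear g -> linear (fun u => a *: g u).
Proof. by move=> lg b u v /=; rewrite lg scalerDr !scalerA mulrC. Qed.

Lemma lin_cm (f : chain_map V W) (g : U -> V) : linear g -> linear (fun u => f (g u)).
Proof. by move=> lg b u v /=; rewrite lg linearP. Qed.

Lemma lin_bml (X : complex K) (f : bichain_map V X W) (g : U -> V) y :
  linear g -> linear (fun u => f (g u) y).
Proof. by move=> lg b u v /=; rewrite lg bm_lDZ. Qed.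

Lemma lin_bmr (X : complex K) (f : bichain_map X V W) (g : U -> V) x :
  linear g -> linear (fun u => f x (g u)).
Proof. by move=> lg b u v /=; rewrite lg bm_rDZ. Qed.

End Linear.

Local Ltac lin := solve [repeat lazymatch goal with
  | |- linear id => exact: lin_id
  | |- linear (fun u => u) => exact: lin_id
  | |- linear (@bm_map _ _ _ _ _ _) => exact: bm_linr
  | |- linear (fun u => @GRing.scale _ _ _ _) => simple eapply lin_scale
  | |- linear (fun u => @bm_map _ _ _ _ _ _ _) =>
      first [simple eapply lin_bml | simple eapply lin_bmr]
  | |- _ => simple eapply lin_cm
  end].
Local Ltac unf := unfold act, comp, contr, PK.
Local Ltac ext x := move: x; apply: ext_eq; [lin | lin | move=> x].

Lemma ext_map_eq (C D : complex k) (f : chain_map C D) u x :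
  u = ext_inj emb x -> ext_map emb f u = ext_inj emb (f x).
Proof. by move=> ->; apply: ext_map_inj. Qed.

Lemma ext_bimap_eq (C D E : complex k) (f : bichain_map C D E) u v x y :
  u = ext_inj emb x -> v = ext_inj emb y ->
  ext_bimap emb f u v = ext_inj emb (f x y).
Proof. by move=> -> ->; apply: ext_bimap_inj. Qed.

Lemma ext_sign_eq (C : complex k) (z : int) (u : ext_complex emb C) x :
  u = ext_inj emb x -> (-1) ^ z *: u = ext_inj emb ((-1) ^ z *: x).
Proof. by move=> ->; rewrite ext_injZ fmorphXz rmorphN1. Qed.

Lemma ext_inj_eq (C : complex k) (u v : ext_complex emb C) x y :
  u = ext_inj emb x -> v = ext_inj emb y -> x = y -> u = v.
Proof. by move=> -> -> ->. Qed.

Local Ltac inj_auto := solve [repeat lazymatch goal with |- ?u = _ =>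
  lazymatch u with
  | ext_inj _ _ => reflexivity
  | @bm_map _ _ _ _ _ _ _ => eapply ext_bimap_eq
  | @GRing.scale _ _ _ _ => eapply ext_sign_eq
  | _ => eapply ext_map_eq
  end end].
Local Ltac einj := eapply ext_inj_eq; [inj_auto | inj_auto |].

Definition ext_operad : modular_operad K.
Proof.
refine (@ModularOperad K PK act comp contr _ _ _ _ _ _ _ _ _ _ _ _ _); unf.
- move=> g l Sgl; elim/ext_complex_ind=> // c x u ->.
  by rewrite (mo_stable Sgl x) ext_inj0 scaler0 addr0.
- by move=> g l x; ext x; einj; rewrite mo_act1.
- by move=> g l sigma tau x; ext x; einj; rewrite mo_actM.
- move=> g l h m f n ef en i sigma tau rho x y t0 E; ext x; ext y; einj.
  by rewrite (mo_comp_act _ _ _ _ t0 E).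
- move=> g l f n ef en i j sigma ne ne' rho x E; ext x; einj.
  by rewrite (mo_contr_act _ _ ne ne' _ E).
- by move=> g l f n ef en i j ne ne' x; ext x; einj; rewrite (mo_contrC _ _ ne ne').
- move=> g l h m f n ef ef' en en' i sigma rho p q x y Hx Hy s0 E.
  move: x Hx; apply: ext_homog_eq; [lin | lin | move=> x Hx].
  move: y Hy; apply: ext_homog_eq; [lin | lin | move=> y Hy]; einj.
  by rewrite (mo_compC ef ef' en en' Hx Hy s0 E).
- move=> g l h m f n g1 r g2 s g3 t e1 er e2 es e3 et e3' et' i b j x y z b0 E.
  ext x; ext y; ext z; einj.
  by rewrite (mo_compA e1 er e2 es e3 et e3' et' _ _ _ b0 E).
- move=> g l h m f n g1 r g2 s g3 t e1 er e2 es e3 et e3' et' i a j i' p q x y z Hy Hz ia E E'.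
  ext x; move: y Hy; apply: ext_homog_eq; [lin | lin | move=> y Hy].
  move: z Hz; apply: ext_homog_eq; [lin | lin | move=> z Hz]; einj.
  by rewrite (mo_compAC e1 er e2 es e3 et e3' et' x Hy Hz ia E E').
- move=> g l f n f' n' ef en ef' en' i j a b i' j' a' b' ij ab ij' ab' x E1 E2 E3 E4.
  ext x; einj.
  by rewrite (mo_contr_contr ef en ef' en' ij ab ij' ab' _ E1 E2 E3 E4).
- move=> g l h m f n f' n' g' l' ef en ef1 en1 eg el ef2 en2 i a b ab a' b' ab' i'.
  move=> x y E1 E2 E3; ext x; ext y; einj.
  by rewrite (mo_contr_compl ef en ef1 en1 eg el ef2 en2 ab ab' _ _ E1 E2 E3).
- move=> g l h m f n f' n' h' m' ef en ef1 en1 eh em ef2 en2 i a b ab a' b' ab'.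
  move=> x y E1 E2; ext x; ext y; einj.
  by rewrite (mo_contr_compr ef en ef1 en1 eh em ef2 en2 ab ab' _ _ E1 E2).
- move=> g l h m f n f' n' ef en ef1 en1 i a b tau rho a' b' ab' i' c' ic'.
  move=> x y t0 E1 E2 E3 E4 E5; ext x; ext y; einj.
  by rewrite (mo_contr_compC ef en ef1 en1 ab' ic' _ _ t0 E1 E2 E3 E4 E5).
Defined.

End ExtOperad.

Record mo_morphism (k : fieldType) (P Q : modular_operad k) := MoMorphism {
  mm_map :> forall g l, chain_map (P g l) (Q g l);
  mm_act : forall g l (sigma : 'S_l) (x : P g l),
    mm_map g l (mo_act P g sigma x) = mo_act Q g sigma (mm_map g l x);
  mm_comp : forall g l h m f n (ef : f = (g + h)%N) (en : n.+2 = (l + m.+1)%N)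
      (i : 'I_l) (x : P g l) (y : P h m.+1),
    mm_map f n (mo_comp P ef en i x y)
      = mo_comp Q ef en i (mm_map g l x) (mm_map h m.+1 y);
  mm_contr : forall g l f n (ef : f = g.+1) (en : n.+2 = l) (i j : 'I_l)
      (ne : i != j) (x : P g l),
    mm_map f n (mo_contr P ef en ne x) = mo_contr Q ef en ne (mm_map g l x) }.

Definition weak_equivalence (k : fieldType) (P Q : modular_operad k)
    (F : mo_morphism P Q) :=
  forall g l, bijective (homology_map (F g l)).

Inductive weq_zigzag (k : fieldType) (P : modular_operad k) :
    modular_operad k -> Prop :=
| zigzag_refl : weq_zigzag P P
| zigzag_fwd Q R (F : mo_morphism Q R) :
    weq_zigzag P Q -> weak_equivalence F -> weq_zigzag P R
| zigzag_bwd Q R (F : mo_morphism R Q) :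
    weq_zigzag P Q -> weak_equivalence F -> weq_zigzag P R.

Definition formal (k : fieldType) (P : modular_operad k) :=
  weq_zigzag P (homology_operad P).

Definition homology_finite_type (k : fieldType) (P : modular_operad k) :=
  forall g l, finite_dimensional (homology (P g l)).

(* Main.v *)
From HB Require Import structures.
From mathcomp Require Import all_boot all_order all_fingroup all_algebra.
From mathcomp Require Import boolp classical_sets freeg ring.
Require Import Defs.

(* Formality is detected by derivations, and derivations, unlike automorphisms, descend
   along a k-linear retraction rho : K -> k.

   A zigzag of weak equivalences is first replaced, using polynomial path objects, by a
   span P (x) K <-f- S -h-> H(P (x) K) of surjective weak equivalences.  The triples
   (p, s, s') with p (x) 1 = f s and h s' = deg (h s) form an operad T over k with a
   surjective weak equivalence pi : T -> P, (p, s, s') |-> p, and a derivation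
   D (p, s, s') = rho (f s') along pi which induces on homology multiplication by the
   degree.

   Given such a pair (pi, D), let B_w be the cone of D - w pi : T -> P, shifted so that
   a pair (t, q) has degree deg t = deg q - 1.  Since k has characteristic zero, the
   homology of B_w is that of P in degree w, plus a part in degree w - 1 which is killed
   by truncation.  The direct sum of the B_w over all integers w is an operad, and its
   suboperad C of elements of degree >= weight (cycles on the diagonal) maps by weak
   equivalences both to P (summing over the weights) and to H(P) (by the classes on the
   diagonal).

   The converse holds because extension of scalars preserves quasi-isomorphisms. *)

Set Implicit Arguments.
Unset Strict Implicit.
Unset Printing Implicit Defensive.

Import Order.TTheory GRing.Theory Num.Theory.
Local Open Scope ring_scope.

(** * Linear and graded algebra *)

(** The Leibniz rule is linear in the derivation: each term has one differentiated factor, while the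
    other comes from P and carries no coefficient in K. Applying rho to coefficients therefore
    preserves the rule, although rho is not multiplicative. For an automorphism both factors would
    have coefficients in K.

    The degree derivation of H(P (x) K) need not lift to P (x) K itself, only along a resolution.
    Surjectivity of h provides an s' for every s, which is why zigzags are straightened to spans and
    why D goes from T to P and not from P to P.

    A grading must then be extracted from D. Eigenspaces of D make no sense on chains, since D is
    not an endomorphism and need not be locally finite. The weight is adjoined from outside instead:
    on homology of degree n, D - w pi acts as n - w, which in characteristic zero is invertible
    unless n = w. The cone thus isolates a single degree. For n = w the map is zero and both its
    kernel and its cokernel survive; the cokernel is the surplus in degree w - 1. *)

Section LinearMaps.
Variables (R : fieldType) (V W : lmodType R).

Definition mk_linear (f : V -> W) (lf : linear f) : {linear V -> W} :=
  HB.pack f (GRing.isLinear.Build R V W _ f lf).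

Arguments mk_linear : simpl never.

Lemma linear_zero (f : V -> W) : linear f -> f 0 = 0.
Proof. by move=> lf; have := lf (-1) 0 0; rewrite scaler0 addr0 scaleN1r addNr. Qed.

Lemma linear_add (f : V -> W) x y : linear f -> f (x + y) = f x + f y.
Proof. by move=> lf; rewrite -[x]scale1r lf !scale1r. Qed.

Lemma linear_scale (f : V -> W) a x : linear f -> f (a *: x) = a *: f x.
Proof. by move=> lf; rewrite -[a *: x]addr0 lf linear_zero // addr0. Qed.

Lemma span_map (E : V -> Prop) (S : submod W) (f : V -> W) : linear f ->
  (forall x, E x -> S (f x)) -> forall x, span E x -> S (f x).
Proof.
move=> lf Ef x; elim=> [|a y z Ey _ IH]; first by rewrite linear_zero //; apply: sm_0.
by rewrite lf; apply: sm_lin => //; apply: Ef.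
Qed.

End LinearMaps.

Section SubmoduleType.
Variables (R : fieldType) (V : lmodType R) (S : submod V).

Fact zero_lin a (x y : V) : x = 0 -> y = 0 -> a *: x + y = 0.
Proof. by move=> -> ->; rewrite scaler0 addr0. Qed.

Definition sm_zero : submod V := Submod (erefl 0) zero_lin.

Definition sm_type : lmodType R := subquot S sm_zero.
Definition sm_in : V -> sm_type := @sq_pi _ _ S sm_zero.
Definition sm_out : sm_type -> V := @sq_val _ _ S sm_zero.

Lemma sm_outP u : S (sm_out u). Proof. exact: sq_val_mem. Qed.

Lemma sm_inK x : S x -> sm_out (sm_in x) = x.
Proof.
move=> Sx; have /eqP : sm_zero (sm_out (sm_in x) - x) by apply: sq_pi_val.
by rewrite subr_eq0 => /eqP.
Qed.

Lemma sm_outK u : sm_in (sm_out u) = u. Proof. exact: sq_piK. Qed.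

Lemma sm_out_inj : injective sm_out. Proof. exact: can_inj sm_outK. Qed.

Lemma sm_out_lin : linear sm_out.
Proof.
move=> a u v; rewrite -[in LHS](sm_outK u) -[in LHS](sm_outK v) /sm_in.
rewrite -sq_pi_lin; try exact: sm_outP.
by rewrite [LHS]sm_inK //; apply: sm_lin; apply: sm_outP.
Qed.

Lemma sm_out0 : sm_out 0 = 0. Proof. exact: linear_zero sm_out_lin. Qed.

End SubmoduleType.

Section Graded.
Variable k : fieldType.
Implicit Types C D E : complex k.

Lemma cx_sumW C (s t : seq int) (x : C) : uniq s -> uniq t -> {subset s <= t} ->
  x = \sum_(p <- s) cx_pr C p x -> x = \sum_(p <- t) cx_pr C p x.
Proof.
move=> Us Ut st def_x; rewrite (bigID (mem s)) /= [X in _ + X]big1 => [|p sp].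
  rewrite addr0 -big_filter {1}def_x; apply/perm_big/uniq_perm; rewrite ?filter_uniq // => p.
  by rewrite mem_filter /= andb_idr //; apply: st.
rewrite def_x linear_sum big1_seq // => q /andP[_ sq].
by rewrite cx_prK; case: eqP sp => // ->; rewrite sq.
Qed.

(** Allowing every larger index set lets two elements be expanded over a common one. *)
Lemma cx_sumE C (x : C) : exists s : seq int, forall t, uniq t -> {subset s <= t} ->
  x = \sum_(p <- t) cx_pr C p x.
Proof.
by have [s Us xE] := cx_sum x; exists s => t Ut st; apply: cx_sumW xE.
Qed.

Lemma pr_eq C (x y : C) : (forall p, cx_pr C p x = cx_pr C p y) -> x = y.
Proof.
move=> e; have [s sE] := cx_sumE x; have [t tE] := cx_sumE y.
rewrite (sE (undup (s ++ t))) ?undup_uniq // => [|p sp].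
  rewrite [RHS](tE (undup (s ++ t))) ?undup_uniq // => [|p tp].
    by apply: eq_bigr => p _; apply: e.
  by rewrite mem_undup mem_cat tp orbT.
by rewrite mem_undup mem_cat sp.
Qed.

Lemma prD_d C p (x : C) : cx_pr C p (cx_d C x) = cx_d C (cx_pr C (p + 1) x).
Proof. by rewrite -cx_prd addrK. Qed.

Lemma pr_homog C p q (x : C) : homog q x -> cx_pr C p x = if p == q then x else 0.
Proof. by rewrite /homog => <-; rewrite cx_prK; case: eqP. Qed.

Lemma homog0 C p : homog p (0 : C). Proof. exact: linear0. Qed.

Lemma homogD C p (x y : C) : homog p x -> homog p y -> homog p (x + y).
Proof. by rewrite /homog linearD => -> ->. Qed.

Lemma homogZ C p a (x : C) : homog p x -> homog p (a *: x).
Proof. by rewrite /homog linearZ => ->. Qed.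

Lemma cm_homog C D (f : chain_map C D) p x : homog p x -> homog p (f x).
Proof. by rewrite /homog -cm_pr => ->. Qed.

(** An additive [c] yields the degree derivation, a sign character yields the Koszul operators
    [sgn]. The support picked by [cid] does not affect the value, which [pr_deg_fun] pins down. *)
Definition deg_fun (c : int -> k) C (x : C) : C :=
  \sum_(p <- undup (sval (cid (cx_sumE x)))) c p *: cx_pr C p x.

Lemma pr_deg_fun c C p (x : C) : cx_pr C p (deg_fun c x) = c p *: cx_pr C p x.
Proof.
rewrite /deg_fun; case: cid => s /= sE; have := sE (undup s) (undup_uniq s).
move=> /(_ (fun q => ltac:(by rewrite mem_undup))) def_x.
rewrite linear_sum {2}def_x linear_sum scaler_sumr; apply: eq_bigr => q _.
by rewrite linearZ /= !cx_prK; case: eqP => [->|] //; rewrite !scaler0.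
Qed.

Fact deg_lin c C : linear (@deg_fun c C).
Proof.
move=> a x y; apply: pr_eq => p; rewrite linearP !pr_deg_fun linearP.
by rewrite scalerDr !scalerA mulrC.
Qed.

Fact deg_op_subproof c C :
  {f : {linear C -> C} | forall p x, cx_pr C p (f x) = c p *: cx_pr C p x}.
Proof. by exists (mk_linear (@deg_lin c C)) => p x; apply: pr_deg_fun. Qed.

Definition deg_op (c : int -> k) C : {linear C -> C} := sval (deg_op_subproof c C).

Lemma pr_deg c C p (x : C) : cx_pr C p (deg_op c C x) = c p *: cx_pr C p x.
Proof. exact: (svalP (deg_op_subproof c C)). Qed.

Lemma deg_pr c C p (x : C) : deg_op c C (cx_pr C p x) = c p *: cx_pr C p x.
Proof.
apply: pr_eq => q; rewrite pr_deg linearZ /= !cx_prK.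
by case: eqP => [->|] //; rewrite !scaler0.
Qed.

Lemma deg_homog c C p (x : C) : homog p x -> deg_op c C x = c p *: x.
Proof. by move=> <-; rewrite deg_pr. Qed.

Lemma deg_cm c C D (f : chain_map C D) x : f (deg_op c C x) = deg_op c D (f x).
Proof. by apply: pr_eq => p; rewrite -cm_pr !pr_deg linearZ /= cm_pr. Qed.

Lemma bm_lZ C D E (f : bichain_map C D E) a x y : f (a *: x) y = a *: f x y.
Proof. by rewrite -[a *: x]addr0 bm_lDZ bm_l0 addr0. Qed.

Lemma bm_rZ C D E (f : bichain_map C D E) a x y : f x (a *: y) = a *: f x y.
Proof. by rewrite -[a *: y]addr0 bm_rDZ bm_r0 addr0. Qed.

Lemma bm_rD C D E (f : bichain_map C D E) x y y' : f x (y + y') = f x y + f x y'.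
Proof. by rewrite -[y]scale1r bm_rDZ !scale1r. Qed.

Lemma bm_ind C D E (f g : C -> D -> E) :
  (forall y, linear (f ^~ y)) -> (forall y, linear (g ^~ y)) ->
  (forall x, linear (f x)) -> (forall x, linear (g x)) ->
  (forall p q x y, homog p x -> homog q y -> f x y = g x y) ->
  forall x y, f x y = g x y.
Proof.
move=> lf lg rf rg fg x y; elim/homog_ind: x => [|x x'|p x Hx].
- by rewrite (linear_zero (lf y)) (linear_zero (lg y)).
- by rewrite (linear_add x x' (lf y)) (linear_add x x' (lg y)) => -> ->.
elim/homog_ind: y => [|y y'|q y Hy].
- by rewrite (linear_zero (rf x)) (linear_zero (rg x)).
- by rewrite (linear_add y y' (rf x)) (linear_add y y' (rg x)) => -> ->.
exact: fg Hx Hy.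
Qed.

Lemma deg_bm c c1 c2 C D E (f : bichain_map C D E) x y :
  (forall p q, c (p + q) = c1 p * c2 q) ->
  deg_op c E (f x y) = f (deg_op c1 C x) (deg_op c2 D y).
Proof.
move=> cE; move: x y; apply: bm_ind => [y a u v|y a u v|x a u v|x a u v|p q x y Hx Hy] /=.
- by rewrite bm_lDZ linearP.
- by rewrite linearP bm_lDZ.
- by rewrite bm_rDZ linearP.
- by rewrite linearP bm_rDZ.
by rewrite (deg_homog _ (bm_homog f Hx Hy)) (deg_homog _ Hx) (deg_homog _ Hy) bm_lZ bm_rZ scalerA cE.
Qed.

Lemma deg_bm_der c C D E (f : bichain_map C D E) x y :
  (forall p q, c (p + q) = c p + c q) ->
  deg_op c E (f x y) = f (deg_op c C x) y + f x (deg_op c D y).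
Proof.
move=> cE; move: x y; apply: bm_ind => [y a u v|y a u v|x a u v|x a u v|p q x y Hx Hy] /=.
- by rewrite bm_lDZ linearP.
- by rewrite linearP !bm_lDZ scalerDr addrACA.
- by rewrite bm_rDZ linearP.
- by rewrite linearP !bm_rDZ scalerDr addrACA.
rewrite (deg_homog _ (bm_homog f Hx Hy)) (deg_homog _ Hx) (deg_homog _ Hy) bm_lZ bm_rZ.
by rewrite -scalerDl cE.
Qed.

(** The Koszul sign for moving a symbol of degree n past the argument. *)
Definition sgn (n : int) C : {linear C -> C} := deg_op (fun p => (-1) ^ (n * p)) C.

Lemma sgn_homog n C p (x : C) : homog p x -> sgn n C x = (-1) ^ (n * p) *: x.
Proof. exact: deg_homog. Qed.

Lemma sgn_pr n C p (x : C) : sgn n C (cx_pr C p x) = cx_pr C p (sgn n C x).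
Proof. by rewrite deg_pr pr_deg. Qed.

Lemma sgn_cm n C D (f : chain_map C D) x : f (sgn n C x) = sgn n D (f x).
Proof. exact: deg_cm. Qed.

Lemma sign2 (a : int) : (-1 : k) ^ a * (-1) ^ a = 1.
Proof. by rewrite -expfzMl mulrNN mulr1 exp1rz. Qed.

Lemma signD (a b : int) : (-1 : k) ^ (a + b) = (-1) ^ a * (-1) ^ b.
Proof. by rewrite expfzDr // oppr_eq0 oner_eq0. Qed.

Lemma signN (a : int) : (-1 : k) ^ (- a) = (-1) ^ a.
Proof.
transitivity ((-1 : k) ^ (- a) * ((-1) ^ a * (-1) ^ a)); first by rewrite sign2 mulr1.
by rewrite mulrA -signD addNr expr0z mul1r.
Qed.

Lemma sign_even (a b c : int) : a = b + (c + c) -> (-1 : k) ^ a = (-1) ^ b.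
Proof. by move=> ->; rewrite !signD sign2 mulr1. Qed.

Lemma sgn_bm n C D E (f : bichain_map C D E) x y :
  sgn n E (f x y) = f (sgn n C x) (sgn n D y).
Proof. by apply: deg_bm => p q; rewrite mulrDr signD. Qed.

Lemma sgn_d n C x : cx_d C (sgn n C x) = (-1) ^ n *: sgn n C (cx_d C x).
Proof.
apply: pr_eq => p; rewrite linearZ /= !(pr_deg, prD_d) linearZ /= scalerA -signD.
by rewrite mulrDr mulr1 addrC.
Qed.

Lemma sgnK n C x : sgn n C (sgn n C x) = x.
Proof. by apply: pr_eq => p; rewrite !pr_deg scalerA sign2 scale1r. Qed.

Lemma sgn0 C x : sgn 0 C x = x.
Proof. by apply: pr_eq => p; rewrite pr_deg mul0r expr0z scale1r. Qed.

End Graded.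

(** * Quasi-isomorphisms and acyclic fibrations *)

Section QuasiIsomorphisms.
Variable k : fieldType.
Implicit Types C D E : complex k.

(** Phrased with representatives, so that chain-level liftings and contractions apply without
    passing to classes. *)
Definition quasi_iso C D (f : chain_map C D) :=
  (forall y, cycles D y -> exists2 x, cycles C x & boundaries D (f x - y)) /\
  (forall x, cycles C x -> boundaries D (f x) -> boundaries C x).

Lemma hom_pi_eqP C (x y : C) : cycles C x -> cycles C y ->
  (hom_pi x = hom_pi y :> homology C) <-> boundaries C (x - y).
Proof. exact: sq_pi_eq. Qed.

Lemma hom_pi_eq0P C (x : C) : cycles C x ->
  (hom_pi x = 0 :> homology C) <-> boundaries C x.
Proof.
move=> Zx; have := hom_pi_eqP Zx (sm_0 (cycles C)); rewrite subr0.
by rewrite [hom_pi 0]sq_pi0.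
Qed.

Lemma quasi_isoP C D (f : chain_map C D) :
  quasi_iso f <-> bijective (homology_map f).
Proof.
split=> [[fs fi]|[g gK Kg]].
  have surj v : exists u, homology_map f u = v.
    elim/homology_ind: v => y Zy; have [x Zx Bx] := fs y Zy; exists (hom_pi x).
    by rewrite homology_map_pi //; apply: hom_pi_eq => //; apply: cm_cycles.
  have inj : injective (homology_map f).
    move=> u v /eqP; rewrite -subr_eq0 -linearB => /eqP uv; apply/eqP.
    rewrite -subr_eq0; apply/eqP; move: (u - v) uv; elim/homology_ind=> x Zx.
    rewrite homology_map_pi // => /hom_pi_eq0P Bfx; apply/hom_pi_eq0P => //.
    by apply: fi => //; apply: Bfx; apply: cm_cycles.
  exists (fun v => sval (cid (surj v))) => [u|v]; last by case: cid.
  by apply: inj; case: cid.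
split=> [y Zy|x Zx Bfx].
  have [x [Zx gx]] := rep_ex (g (hom_pi y)); exists x => //.
  apply/hom_pi_eqP => //; first exact: cm_cycles.
  by rewrite -homology_map_pi // -gx Kg.
apply/hom_pi_eq0P => //; rewrite -[LHS]gK homology_map_pi //.
by rewrite (proj2 (hom_pi_eq0P (cm_cycles f Zx))) // -[RHS]gK linear0.
Qed.

(* Lifting a bounding chain: equivalent to being a surjective quasi-isomorphism. *)
Definition acyclic_fib C D (f : chain_map C D) := forall z w,
  cycles C z -> cx_d D w = f z -> exists2 x, f x = w & cx_d C x = z.

Lemma acyclic_fib_cycle C D (f : chain_map C D) y : acyclic_fib f -> cycles D y ->
  exists2 x, f x = y & cycles C x.
Proof.
by move=> Lf Zy; apply: Lf; [apply: sm_0 | rewrite linear0; apply: Zy].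
Qed.

Lemma acyclic_fib_boundary C D (f : chain_map C D) x :
  acyclic_fib f -> cycles C x -> f x = 0 -> boundaries C x.
Proof.
move=> Lf Zx fx; have [|z _ <-] := Lf x 0 Zx; first by rewrite linear0.
by exists z.
Qed.

Lemma acyclic_fib_quasi_iso C D (f : chain_map C D) : acyclic_fib f -> quasi_iso f.
Proof.
move=> Lf; split=> [y /(acyclic_fib_cycle Lf)[x <- Zx]|x Zx [w fx]].
  by exists x => //; rewrite subrr; apply: sm_0.
by have [y _ <-] := Lf x w Zx (esym fx); exists y.
Qed.

End QuasiIsomorphisms.

(** * Morphisms of modular operads and fibrations *)

Section Morphisms.
Variable k : fieldType.
Implicit Types P Q R : modular_operad k.

Definition cm_id (C : complex k) : chain_map C C :=
  @ChainMap k C C idfun (fun _ _ => erefl) (fun=> erefl).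

Fact cm_comp_pr (C D E : complex k) (f : chain_map C D) (g : chain_map D E) p x :
  (g \o f) (cx_pr C p x) = cx_pr E p ((g \o f) x).
Proof. by rewrite /= !cm_pr. Qed.

Fact cm_comp_d (C D E : complex k) (f : chain_map C D) (g : chain_map D E) x :
  (g \o f) (cx_d C x) = cx_d E ((g \o f) x).
Proof. by rewrite /= !cm_d. Qed.

Definition cm_comp (C D E : complex k) (f : chain_map C D) (g : chain_map D E) :
  chain_map C E := @ChainMap k C E (g \o f) (@cm_comp_pr _ _ _ f g) (@cm_comp_d _ _ _ f g).

Definition mm_id P : mo_morphism P P.
Proof. by apply: (@MoMorphism k P P (fun g l => cm_id (P g l))). Defined.

Definition mm_trans P Q R (F : mo_morphism P Q) (G : mo_morphism Q R) : mo_morphism P R.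
Proof.
apply: (@MoMorphism k P R (fun g l => cm_comp (F g l) (G g l))).
- by move=> g l sigma x /=; rewrite !mm_act.
- by move=> g l h m f n ef en i x y /=; rewrite !mm_comp.
- by move=> g l f n ef en i j ne x /=; rewrite !mm_contr.
Defined.

Definition fibration P Q (F : mo_morphism P Q) := forall g l, acyclic_fib (F g l).

Lemma fibration_id P : fibration (mm_id P).
Proof. by move=> g l z w _ dw; exists w. Qed.

Lemma fibration_trans P Q R (F : mo_morphism P Q) (G : mo_morphism Q R) :
  fibration F -> fibration G -> fibration (mm_trans F G).
Proof.
move=> LF LG g l z w Zz dw.
have [y Gy dy] := LG g l _ w (cm_cycles (F g l) Zz) dw.
by have [x Fx dx] := LF g l z y Zz dy; exists x; rewrite //= Fx.
Qed.

Lemma weak_equivalenceP P Q (F : mo_morphism P Q) :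
  weak_equivalence F <-> forall g l, quasi_iso (F g l).
Proof. by split=> wF g l; apply/quasi_isoP. Qed.

End Morphisms.

(** * Suboperads of products *)

Section RestrictionOfScalars.
Variables (k K : fieldType) (emb : {rmorphism k -> K}) (V : lmodType K).

(** A separate name for the carrier keeps the scalars from k apart from the K-module structure of
    V. *)
Definition res_car : Type := V.
HB.instance Definition _ := GRing.Zmodule.on res_car.

Definition res_scale (a : k) (v : res_car) : res_car := emb a *: (v : V).

Fact res_scaleA a b v : res_scale a (res_scale b v) = res_scale (a * b) v.
Proof. by rewrite /res_scale scalerA rmorphM. Qed.

Fact res_scale1 : left_id 1 res_scale.
Proof. by move=> v; rewrite /res_scale rmorph1 scale1r. Qed.

Fact res_scaleDr : right_distributive res_scale +%R.
Proof. by move=> a u v; rewrite /res_scale scalerDr. Qed.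

Fact res_scaleDl v : {morph res_scale^~ v : a b / a + b}.
Proof. by move=> a b; rewrite /res_scale rmorphD scalerDl. Qed.

HB.instance Definition _ := GRing.Zmodule_isLmodule.Build k res_car
  res_scaleA res_scale1 res_scaleDr res_scaleDl.

Definition res : lmodType k := res_car.

End RestrictionOfScalars.

(* The suboperad of the product of P and of the restriction of Q to k formed by the
   pairs in the relation U. *)
Section SubProduct.
Variables (k K : fieldType) (emb : {rmorphism k -> K}).
Variables (P : modular_operad k) (Q : modular_operad K).

(** Two fields are allowed because the descent step pairs chains over k with chains over K. With
    [emb] the identity the same construction gives pullbacks and the truncated operad with its
    homology classes. *)
Record closed_rel (U : forall g l, P g l -> Q g l -> Prop) : Prop := ClosedRel {
  cr_0 : forall g l, U g l 0 0;
  cr_lin : forall g l a x y x' y', U g l x y -> U g l x' y' ->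
    U g l (a *: x + x') (emb a *: y + y');
  cr_pr : forall g l p x y, U g l x y -> U g l (cx_pr _ p x) (cx_pr _ p y);
  cr_d : forall g l x y, U g l x y -> U g l (cx_d _ x) (cx_d _ y);
  cr_act : forall g l (sigma : 'S_l) x y, U g l x y ->
    U g l (mo_act P g sigma x) (mo_act Q g sigma y);
  cr_comp : forall g l h m f n (ef : f = (g + h)%N) (en : n.+2 = (l + m.+1)%N) (i : 'I_l)
      x y x' y', U g l x y -> U h m.+1 x' y' ->
    U f n (mo_comp P ef en i x x') (mo_comp Q ef en i y y');
  cr_contr : forall g l f n (ef : f = g.+1) (en : n.+2 = l) (i j : 'I_l) (ne : i != j)
      x y, U g l x y -> U f n (mo_contr P ef en ne x) (mo_contr Q ef en ne y) }.

Variables (U : forall g l, P g l -> Q g l -> Prop) (cU : closed_rel U).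

Definition sp_sub g l : submod (P g l * res emb (Q g l))%type :=
  @Submod _ (P g l * res emb (Q g l))%type (fun z => U z.1 z.2) (cr_0 cU g l)
    (fun a x y Ux Uy => cr_lin cU a Ux Uy).

Definition sp_car g l : lmodType k := sm_type (sp_sub g l).
Definition sp1 g l (u : sp_car g l) : P g l := (sm_out u).1.
Definition sp2 g l (u : sp_car g l) : Q g l := (sm_out u).2.
Definition sp_in g l (x : P g l) (y : Q g l) : sp_car g l := sm_in (sp_sub g l) (x, y).

Lemma spP g l (u : sp_car g l) : U (sp1 u) (sp2 u).
Proof. exact: (sm_outP u). Qed.

Lemma sp_eq g l (u v : sp_car g l) : sp1 u = sp1 v -> sp2 u = sp2 v -> u = v.
Proof.
rewrite /sp1 /sp2 => e1 e2; apply: sm_out_inj.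
by case: (sm_out u) (sm_out v) e1 e2 => ? ? [? ?] /= -> ->.
Qed.

Lemma sp1_in g l (x : P g l) y : U x y -> sp1 (sp_in x y) = x.
Proof. by move=> Uxy; rewrite /sp1 sm_inK. Qed.

Lemma sp2_in g l (x : P g l) y : U x y -> sp2 (sp_in x y) = y.
Proof. by move=> Uxy; rewrite /sp2 sm_inK. Qed.

Lemma sp1_lin g l : linear (@sp1 g l).
Proof. by move=> a u v; rewrite /sp1 sm_out_lin. Qed.

Lemma sp2_lin g l a (u v : sp_car g l) : sp2 (a *: u + v) = emb a *: sp2 u + sp2 v.
Proof. by rewrite /sp2 sm_out_lin. Qed.

Lemma sp2_scale g l a (u : sp_car g l) : sp2 (a *: u) = emb a *: sp2 u.
Proof. by rewrite -[a *: u]addr0 sp2_lin /sp2 sm_out0 addr0. Qed.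

Lemma sp1_sum g l I (s : seq I) (F : I -> sp_car g l) :
  sp1 (\sum_(i <- s) F i) = \sum_(i <- s) sp1 (F i).
Proof. exact: (linear_sum (mk_linear (@sp1_lin g l))). Qed.

Lemma sp2_sum g l I (s : seq I) (F : I -> sp_car g l) :
  sp2 (\sum_(i <- s) F i) = \sum_(i <- s) sp2 (F i).
Proof.
elim/big_rec2: _ => [|i x y _ <-]; first by rewrite /sp2 sm_out0.
by rewrite -[F i]scale1r sp2_lin rmorph1 !scale1r.
Qed.

Section Linear.
Variables (g l f n : nat) (F : {linear P g l -> P f n}) (G : {linear Q g l -> Q f n}).
Hypothesis FG : forall x y, U x y -> U (F x) (G y).

Definition sp_fun (u : sp_car g l) : sp_car f n := sp_in (F (sp1 u)) (G (sp2 u)).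

Lemma sp1_fun u : sp1 (sp_fun u) = F (sp1 u).
Proof. by rewrite sp1_in //; apply: FG; apply: spP. Qed.
Lemma sp2_fun u : sp2 (sp_fun u) = G (sp2 u).
Proof. by rewrite sp2_in //; apply: FG; apply: spP. Qed.

Fact sp_fun_lin : linear sp_fun.
Proof.
by move=> a u v; apply: sp_eq; rewrite !(sp1_lin, sp2_lin, sp1_fun, sp2_fun) linearP.
Qed.

Definition sp_linear : {linear sp_car g l -> sp_car f n} := mk_linear sp_fun_lin.

End Linear.

Section Complex.
Variables g l : nat.

Definition sp_pr p : {linear sp_car g l -> sp_car g l} :=
  sp_linear (@cr_pr _ cU g l p).
Definition sp_d : {linear sp_car g l -> sp_car g l} :=
  sp_linear (@cr_d _ cU g l).

Lemma sp1_pr p u : sp1 (sp_pr p u) = cx_pr _ p (sp1 u).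
Proof. exact: (sp1_fun (@cr_pr _ cU g l p)). Qed.
Lemma sp2_pr p u : sp2 (sp_pr p u) = cx_pr _ p (sp2 u).
Proof. exact: (sp2_fun (@cr_pr _ cU g l p)). Qed.
Lemma sp1_d u : sp1 (sp_d u) = cx_d _ (sp1 u).
Proof. exact: (sp1_fun (@cr_d _ cU g l)). Qed.
Lemma sp2_d u : sp2 (sp_d u) = cx_d _ (sp2 u).
Proof. exact: (sp2_fun (@cr_d _ cU g l)). Qed.

Fact sp_prK p q u : sp_pr p (sp_pr q u) = if p == q then sp_pr q u else 0.
Proof.
apply: sp_eq; rewrite ?(sp1_pr, sp2_pr) cx_prK; case: (p == q);
  by rewrite ?(sp1_pr, sp2_pr) // /sp1 /sp2 sm_out0.
Qed.

Fact sp_sum u : exists2 s : seq int, uniq s & u = \sum_(p <- s) sp_pr p u.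
Proof.
have [s sE] := cx_sumE (sp1 u); have [t tE] := cx_sumE (sp2 u).
exists (undup (s ++ t)); first exact: undup_uniq.
apply: sp_eq; rewrite ?(sp1_sum, sp2_sum).
  under eq_bigr do rewrite sp1_pr; apply: sE; first exact: undup_uniq.
  by move=> p sp; rewrite mem_undup mem_cat sp.
under eq_bigr do rewrite sp2_pr; apply: tE; first exact: undup_uniq.
by move=> p tp; rewrite mem_undup mem_cat tp orbT.
Qed.

Fact sp_prd p u : sp_pr (p - 1) (sp_d u) = sp_d (sp_pr p u).
Proof. by apply: sp_eq; rewrite ?(sp1_pr, sp2_pr, sp1_d, sp2_d) cx_prd. Qed.

Fact sp_dd u : sp_d (sp_d u) = 0.
Proof. by apply: sp_eq; rewrite ?(sp1_d, sp2_d) cx_dd /sp1 /sp2 sm_out0. Qed.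

Definition sp_cx : complex k := Complex sp_prK sp_sum sp_prd sp_dd.

End Complex.

Lemma sp1_homog g l p (u : sp_cx g l) : homog p u -> homog p (sp1 u).
Proof. by move=> Hu; rewrite /homog -sp1_pr; apply: congr1 Hu. Qed.

Lemma sp2_homog g l p (u : sp_cx g l) : homog p u -> homog p (sp2 u).
Proof. by move=> Hu; rewrite /homog -sp2_pr; apply: congr1 Hu. Qed.

Section ChainMap.
Variables (g l f n : nat) (F : chain_map (P g l) (P f n)) (G : chain_map (Q g l) (Q f n)).
Hypothesis FG : forall x y, U x y -> U (F x) (G y).

Let H : {linear sp_cx g l -> sp_cx f n} := sp_linear FG.

Fact sp_map_pr p u : H (cx_pr _ p u) = cx_pr _ p (H u).
Proof.
by apply: sp_eq; rewrite ?(sp1_pr, sp2_pr) ?(sp1_fun FG, sp2_fun FG) ?(sp1_pr, sp2_pr) cm_pr.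
Qed.

Fact sp_map_d u : H (cx_d _ u) = cx_d _ (H u).
Proof.
by apply: sp_eq; rewrite ?(sp1_d, sp2_d) ?(sp1_fun FG, sp2_fun FG) ?(sp1_d, sp2_d) cm_d.
Qed.

Definition sp_map : chain_map (sp_cx g l) (sp_cx f n) := ChainMap sp_map_pr sp_map_d.

End ChainMap.

Section BichainMap.
Variables (g l h m f n : nat).
Variables (F : bichain_map (P g l) (P h m) (P f n)) (G : bichain_map (Q g l) (Q h m) (Q f n)).
Hypothesis FG : forall x y x' y', U x y -> U x' y' -> U (F x x') (G y y').

Definition sp_bifun (u : sp_cx g l) (v : sp_cx h m) : sp_cx f n :=
  sp_in (F (sp1 u) (sp1 v)) (G (sp2 u) (sp2 v)).

Lemma sp1_bifun u v : sp1 (sp_bifun u v) = F (sp1 u) (sp1 v).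
Proof. by rewrite sp1_in //; apply: FG; apply: spP. Qed.
Lemma sp2_bifun u v : sp2 (sp_bifun u v) = G (sp2 u) (sp2 v).
Proof. by rewrite sp2_in //; apply: FG; apply: spP. Qed.

Fact sp_bi_linl v : linear (sp_bifun ^~ v).
Proof.
by move=> a u u'; apply: sp_eq; rewrite !(sp1_lin, sp2_lin, sp1_bifun, sp2_bifun) bm_lDZ.
Qed.

Fact sp_bi_linr u : linear (sp_bifun u).
Proof.
by move=> a v v'; apply: sp_eq; rewrite !(sp1_lin, sp2_lin, sp1_bifun, sp2_bifun) bm_rDZ.
Qed.

Fact sp_bi_homog p q u v : homog p u -> homog q v -> homog (p + q) (sp_bifun u v).
Proof.
move=> Hu Hv; apply: sp_eq; rewrite ?(sp1_pr, sp2_pr, sp1_bifun, sp2_bifun).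
  exact: bm_homog (sp1_homog Hu) (sp1_homog Hv).
exact: bm_homog (sp2_homog Hu) (sp2_homog Hv).
Qed.

Fact sp_bi_leibniz p u v : homog p u -> cx_d (sp_cx f n) (sp_bifun u v)
  = sp_bifun (cx_d (sp_cx g l) u) v + (-1 : k) ^ p *: sp_bifun u (cx_d (sp_cx h m) v).
Proof.
move=> Hu; rewrite [RHS]addrC; apply: sp_eq.
  rewrite sp1_d sp1_lin !sp1_bifun !sp1_d addrC.
  by rewrite (bm_leibniz _ _ (sp1_homog Hu)).
rewrite sp2_d sp2_lin !sp2_bifun !sp2_d addrC.
by rewrite (bm_leibniz _ _ (sp2_homog Hu)) fmorphXz rmorphN1.
Qed.

Definition sp_bimap : bichain_map (sp_cx g l) (sp_cx h m) (sp_cx f n) :=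
  BichainMap sp_bi_linl sp_bi_linr sp_bi_homog sp_bi_leibniz.

End BichainMap.

Let act g l (sigma : 'S_l) : chain_map (sp_cx g l) (sp_cx g l) :=
  sp_map (@cr_act _ cU g l sigma).
Let comp g l h m f n (ef : f = (g + h)%N) (en : n.+2 = (l + m.+1)%N) (i : 'I_l) :
    bichain_map (sp_cx g l) (sp_cx h m.+1) (sp_cx f n) :=
  sp_bimap (@cr_comp _ cU g l h m f n ef en i).
Let contr g l f n (ef : f = g.+1) (en : n.+2 = l) (i j : 'I_l) (ne : i != j) :
    chain_map (sp_cx g l) (sp_cx f n) :=
  sp_map (@cr_contr _ cU g l f n ef en i j ne).

Let act1 g l (s : 'S_l) (u : sp_cx g l) : sp1 (act g s u) = mo_act P g s (sp1 u).
Proof. exact: (sp1_fun (@cr_act _ cU g l s)). Qed.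
Let act2 g l (s : 'S_l) (u : sp_cx g l) : sp2 (act g s u) = mo_act Q g s (sp2 u).
Proof. exact: (sp2_fun (@cr_act _ cU g l s)). Qed.
Let comp1 g l h m f n ef en i (u : sp_cx g l) (v : sp_cx h m.+1) :
  sp1 (@comp g l h m f n ef en i u v) = mo_comp P ef en i (sp1 u) (sp1 v).
Proof. exact: (sp1_bifun (@cr_comp _ cU g l h m f n ef en i)). Qed.
Let comp2 g l h m f n ef en i (u : sp_cx g l) (v : sp_cx h m.+1) :
  sp2 (@comp g l h m f n ef en i u v) = mo_comp Q ef en i (sp2 u) (sp2 v).
Proof. exact: (sp2_bifun (@cr_comp _ cU g l h m f n ef en i)). Qed.
Let contr1 g l f n ef en i j ne (u : sp_cx g l) :
  sp1 (@contr g l f n ef en i j ne u) = mo_contr P ef en ne (sp1 u).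
Proof. exact: (sp1_fun (@cr_contr _ cU g l f n ef en i j ne)). Qed.
Let contr2 g l f n ef en i j ne (u : sp_cx g l) :
  sp2 (@contr g l f n ef en i j ne u) = mo_contr Q ef en ne (sp2 u).
Proof. exact: (sp2_fun (@cr_contr _ cU g l f n ef en i j ne)). Qed.
Let scale1 g l a (u : sp_cx g l) : sp1 (a *: u) = a *: sp1 u.
Proof. by rewrite (linear_scale _ _ (@sp1_lin g l)). Qed.
Let sign_2 g l z (u : sp_cx g l) : sp2 ((-1) ^ z *: u) = (-1) ^ z *: sp2 u.
Proof. by rewrite sp2_scale fmorphXz rmorphN1. Qed.

Let E := (act1, comp1, contr1, act2, comp2, contr2, scale1, sign_2).
Local Ltac sp := apply: sp_eq; rewrite !E.

Definition sub_product : modular_operad k.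
Proof.
refine (@ModularOperad k sp_cx act comp contr _ _ _ _ _ _ _ _ _ _ _ _ _).
- move=> g l Sgl u; apply: sp_eq; rewrite /sp1 /sp2 sm_out0; exact: mo_stable.
- by move=> g l u; sp; rewrite mo_act1.
- by move=> g l sigma tau u; sp; rewrite mo_actM.
- by move=> g l h m f n ef en i sigma tau rho x y t0 e; sp; rewrite (mo_comp_act _ _ _ _ t0 e).
- by move=> g l f n ef en i j sigma ne ne' rho x e; sp; rewrite (mo_contr_act _ _ ne ne' _ e).
- by move=> g l f n ef en i j ne ne' x; sp; rewrite (mo_contrC _ _ ne ne').
- move=> g l h m f n ef ef' en en' i sigma rho p q x y Hx Hy s0 e; sp.
    by rewrite (mo_compC ef ef' en en' (sp1_homog Hx) (sp1_homog Hy) s0 e).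
  by rewrite (mo_compC ef ef' en en' (sp2_homog Hx) (sp2_homog Hy) s0 e).
- move=> g l h m f n g1 r g2 s g3 t e1 er e2 es e3 et e3' et' i b j x y z b0 e; sp;
  by rewrite (mo_compA e1 er e2 es e3 et e3' et' _ _ _ b0 e).
- move=> g l h m f n g1 r g2 s g3 t e1 er e2 es e3 et e3' et' i a j i' p q x y z Hy Hz ia e e'.
  sp; first by rewrite (mo_compAC e1 er e2 es e3 et e3' et' _ (sp1_homog Hy) (sp1_homog Hz) ia e e').
  by rewrite (mo_compAC e1 er e2 es e3 et e3' et' _ (sp2_homog Hy) (sp2_homog Hz) ia e e').
- move=> g l f n f' n' ef en ef' en' i j a b i' j' a' b' ij ab ij' ab' x E1 E2 E3 E4; sp;
  by rewrite (mo_contr_contr ef en ef' en' ij ab ij' ab' _ E1 E2 E3 E4).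
- move=> g l h m f n f' n' g' l' ef en ef1 en1 eg el ef2 en2 i a b ab a' b' ab' i'.
  move=> x y E1 E2 E3; sp;
  by rewrite (mo_contr_compl ef en ef1 en1 eg el ef2 en2 ab ab' _ _ E1 E2 E3).
- move=> g l h m f n f' n' h' m' ef en ef1 en1 eh em ef2 en2 i a b ab a' b' ab'.
  move=> x y E1 E2; sp;
  by rewrite (mo_contr_compr ef en ef1 en1 eh em ef2 en2 ab ab' _ _ E1 E2).
- move=> g l h m f n f' n' ef en ef1 en1 i a b tau rho a' b' ab' i' c' ic'.
  move=> x y t0 s t E1 E2 E3 E4 E5; sp;
  by rewrite (mo_contr_compC ef en ef1 en1 ab' ic' _ _ t0 E1 E2 E3 E4 E5).
Defined.

Lemma sp2_act g l (s : 'S_l) (u : sub_product g l) :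
  sp2 (mo_act sub_product g s u) = mo_act Q g s (sp2 u).
Proof. exact: act2. Qed.

Lemma sp2_comp g l h m f n (ef : f = (g + h)%N) (en : n.+2 = (l + m.+1)%N) (i : 'I_l)
    (u : sub_product g l) (v : sub_product h m.+1) :
  sp2 (mo_comp sub_product ef en i u v) = mo_comp Q ef en i (sp2 u) (sp2 v).
Proof. exact: comp2. Qed.

Lemma sp2_contr g l f n (ef : f = g.+1) (en : n.+2 = l) (i j : 'I_l) (ne : i != j)
    (u : sub_product g l) :
  sp2 (mo_contr sub_product ef en ne u) = mo_contr Q ef en ne (sp2 u).
Proof. exact: contr2. Qed.

Definition sp_cm1 g l : chain_map (sub_product g l) (P g l) :=
  @ChainMap k (sp_cx g l) (P g l) (mk_linear (@sp1_lin g l)) (@sp1_pr g l) (@sp1_d g l).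

Definition sp_fst : mo_morphism sub_product P :=
  @MoMorphism k sub_product P sp_cm1 act1 comp1 contr1.

End SubProduct.

Section SubProductSame.
Variables (k : fieldType) (P Q : modular_operad k).
Variables (U : forall g l, P g l -> Q g l -> Prop) (cU : closed_rel (idfun : {rmorphism k -> k}) U).

Fact sp_snd_lin g l : linear (@sp2 _ _ _ _ _ _ cU g l).
Proof. by move=> a u v; rewrite sp2_lin. Qed.

Definition sp_cm2 g l : chain_map (sub_product cU g l) (Q g l) :=
  @ChainMap k (sp_cx cU g l) (Q g l) (mk_linear (@sp_snd_lin g l))
    (@sp2_pr _ _ _ _ _ _ cU g l) (@sp2_d _ _ _ _ _ _ cU g l).

Definition sp_snd : mo_morphism (sub_product cU) Q :=
  @MoMorphism k (sub_product cU) Q sp_cm2 (@sp2_act _ _ _ _ _ _ cU)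
    (@sp2_comp _ _ _ _ _ _ cU) (@sp2_contr _ _ _ _ _ _ cU).

End SubProductSame.

(** * Square-zero extensions *)

(* A derivation of degree -1-n along F, for the bimodule P shifted by n. *)
Record twist (k : fieldType) (S P : modular_operad k) (F : mo_morphism S P) (n : int) :=
  Twist {
  tw_map :> forall g l, {linear S g l -> P g l};
  tw_pr : forall g l p x, tw_map g l (cx_pr _ p x) = cx_pr _ (p - 1 - n) (tw_map g l x);
  tw_d : forall g l x, tw_map g l (cx_d _ x) = - cx_d _ (tw_map g l x);
  tw_act : forall g l (sigma : 'S_l) (x : S g l),
    tw_map g l (mo_act S g sigma x) = mo_act P g sigma (tw_map g l x);
  tw_comp : forall g l h m f r (ef : f = (g + h)%N) (er : r.+2 = (l + m.+1)%N)
      (i : 'I_l) p (x : S g l) (y : S h m.+1), homog p x ->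
    tw_map f r (mo_comp S ef er i x y)
      = mo_comp P ef er i (tw_map g l x) (sgn n _ (F h m.+1 y))
        + (-1) ^ p *: mo_comp P ef er i (F g l x) (tw_map h m.+1 y);
  tw_contr : forall g l f r (ef : f = g.+1) (er : r.+2 = l) (i j : 'I_l)
      (ne : i != j) (x : S g l),
    tw_map f r (mo_contr S ef er ne x) = mo_contr P ef er ne (tw_map g l x) }.

Section ZeroTwist.
Variables (k : fieldType) (S P : modular_operad k) (F : mo_morphism S P) (n : int).

Definition zero_twist : twist F n.
Proof.
apply: (@Twist k S P F n (fun g l => \0)) => //=.
- by move=> *; rewrite linear0.
- by move=> *; rewrite linear0 oppr0.
- by move=> *; rewrite linear0.
- by move=> *; rewrite bm_l0 bm_r0 scaler0 addr0.
- by move=> *; rewrite linear0.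
Defined.

End ZeroTwist.

(* The operad S + P.u with u of degree n, u^2 = 0 and d x = (d x) + (T x).u for x in S. *)
Section Extension.
Variables (k : fieldType) (S P : modular_operad k) (F : mo_morphism S P) (n : int).
Variable T : twist F n.

Definition et_car g l : lmodType k := (S g l * P g l)%type.

Lemma et_eq g l (u v : et_car g l) : u.1 = v.1 -> u.2 = v.2 -> u = v.
Proof. by case: u v => ? ? [? ?] /= -> ->. Qed.

Section Complex.
Variables g l : nat.

Definition et_pr_fun p (u : et_car g l) : et_car g l :=
  (cx_pr _ p u.1, cx_pr _ (p - n) u.2).
Definition et_d_fun (u : et_car g l) : et_car g l :=
  (cx_d _ u.1, T g l u.1 + cx_d _ u.2).

Fact et_pr_lin p : linear (et_pr_fun p).
Proof. by move=> a u v; apply: et_eq; rewrite /= linearP. Qed.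

Fact et_d_lin : linear et_d_fun.
Proof.
move=> a u v; apply: et_eq; rewrite /= !linearP //.
by rewrite scalerDr addrACA.
Qed.

Definition et_pr p : {linear et_car g l -> et_car g l} := mk_linear (et_pr_lin p).
Definition et_d : {linear et_car g l -> et_car g l} := mk_linear et_d_lin.

Fact et_prK p q u : et_pr p (et_pr q u) = if p == q then et_pr q u else 0.
Proof.
apply: et_eq => /=; rewrite cx_prK ?(inj_eq (addIr (- n))); by case: eqP.
Qed.

Fact et_sum u : exists2 s : seq int, uniq s & u = \sum_(p <- s) et_pr p u.
Proof.
have [s sE] := cx_sumE u.1; have [t tE] := cx_sumE u.2.
exists (undup (s ++ [seq q + n | q <- t])); first exact: undup_uniq.
apply: et_eq.
  rewrite (linear_sum fst) /=; apply: sE; first exact: undup_uniq.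
  by move=> p sp; rewrite mem_undup mem_cat sp.
rewrite (linear_sum snd) /=; set r := undup _.
rewrite -(big_map (fun p => p - n) xpredT (fun q => cx_pr (P g l) q u.2)).
apply: tE; first by rewrite map_inj_uniq ?undup_uniq //; apply: addIr.
move=> p tp; apply/mapP; exists (p + n); rewrite ?addrK //.
by rewrite mem_undup mem_cat (map_f (fun q => q + n) tp) orbT.
Qed.

Fact et_prd p u : et_pr (p - 1) (et_d u) = et_d (et_pr p u).
Proof.
apply: et_eq; rewrite /= ?cx_prd // linearD /= tw_pr; congr (_ + _).
by rewrite addrAC cx_prd.
Qed.

Fact et_dd u : et_d (et_d u) = 0.
Proof. by apply: et_eq; rewrite /= ?linearD /= !cx_dd // addr0 tw_d addNr. Qed.

Definition et_cx : complex k := Complex et_prK et_sum et_prd et_dd.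

Lemma et_homogP p (u : et_cx) : homog p u <-> homog p u.1 /\ homog (p - n) u.2.
Proof.
split=> [Hu|[H1 H2]]; last by apply: et_eq.
by split; [apply: (congr1 fst Hu) | apply: (congr1 snd Hu)].
Qed.

End Complex.

Section ChainMap.
Variables (g l f r : nat) (G : chain_map (S g l) (S f r)) (H : chain_map (P g l) (P f r)).
Hypothesis GH : forall x, T f r (G x) = H (T g l x).

Definition et_map_fun (u : et_cx g l) : et_cx f r := (G u.1, H u.2).

Fact et_map_lin : linear et_map_fun.
Proof. by move=> a u v; apply: et_eq; rewrite /= linearP. Qed.

Fact et_map_pr p u : mk_linear et_map_lin (cx_pr _ p u) = cx_pr _ p (mk_linear et_map_lin u).
Proof. by apply: et_eq; rewrite /= cm_pr. Qed.

Fact et_map_d u : mk_linear et_map_lin (cx_d _ u) = cx_d _ (mk_linear et_map_lin u).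
Proof. by apply: et_eq; rewrite /= ?linearD /= cm_d // GH. Qed.

Definition et_map : chain_map (et_cx g l) (et_cx f r) := ChainMap et_map_pr et_map_d.

End ChainMap.

Section BichainMap.
Variables (g l h m f r : nat).
Variables (ef : f = (g + h)%N) (er : r.+2 = (l + m.+1)%N) (i : 'I_l).
Let cS := mo_comp S ef er i.
Let cP := mo_comp P ef er i.

(** This is (x + a u)(y + b u) with u^2 = 0: coefficients are kept to the left of u, and moving u
    past y in a u y produces [sgn n]. *)
Definition et_comp_fun (u : et_cx g l) (v : et_cx h m.+1) : et_cx f r :=
  (cS u.1 v.1, cP (F g l u.1) v.2 + cP u.2 (sgn n _ (F h m.+1 v.1))).

Fact et_comp_linl v : linear (et_comp_fun ^~ v).
Proof.
move=> a u u'; apply: et_eq; rewrite /= ?bm_lDZ // linearP !bm_lDZ.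
by rewrite scalerDr addrACA.
Qed.

Fact et_comp_linr u : linear (et_comp_fun u).
Proof.
move=> a v v'; apply: et_eq; rewrite /= ?bm_rDZ // !linearP !bm_rDZ.
by rewrite scalerDr addrACA.
Qed.

Fact et_comp_homog p q u v : homog p u -> homog q v -> homog (p + q) (et_comp_fun u v).
Proof.
move=> /et_homogP[H1 H2] /et_homogP[H1' H2']; apply/et_homogP; split.
  exact: bm_homog.
apply: homogD.
  by rewrite -addrA; apply: bm_homog => //; apply: cm_homog.
rewrite addrAC; apply: bm_homog => //; rewrite (@sgn_homog _ _ _ q); last exact: cm_homog.
exact/homogZ/cm_homog.
Qed.

Fact et_comp_leibniz p u v : homog p u -> cx_d (et_cx f r) (et_comp_fun u v)
  = et_comp_fun (cx_d (et_cx g l) u) v + (-1 : k) ^ p *: et_comp_fun u (cx_d (et_cx h m.+1) v).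
Proof.
move=> /et_homogP[H1 H2]; apply: et_eq => /=; first exact: bm_leibniz.
rewrite (tw_comp T _ _ _ _ H1) linearD /= (bm_leibniz _ _ (cm_homog (F g l) H1)).
rewrite (bm_leibniz _ _ H2) !bm_lD !bm_rD !cm_d !scalerDr signD signN.
(* The coefficient a has degree p - n, and commuting the differential with [sgn n] contributes the
   (-1)^n that restores the sign (-1)^p. *)
rewrite sgn_d bm_rZ !scalerA -[_ * _ * _]mulrA sign2 mulr1.
rewrite -/cP -!addrA [X in _ + X = _]addrCA [LHS]addrCA; congr (_ + (_ + _)).
by rewrite [X in _ + X = _]addrCA [LHS]addrCA.
Qed.

Definition et_comp : bichain_map (et_cx g l) (et_cx h m.+1) (et_cx f r) :=
  BichainMap et_comp_linl et_comp_linr et_comp_homog et_comp_leibniz.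

End BichainMap.

Let act g l (sigma : 'S_l) : chain_map (et_cx g l) (et_cx g l) :=
  et_map (@tw_act _ _ _ _ _ T g l sigma).
Let contr g l f r (ef : f = g.+1) (er : r.+2 = l) (i j : 'I_l) (ne : i != j) :
    chain_map (et_cx g l) (et_cx f r) :=
  et_map (@tw_contr _ _ _ _ _ T g l f r ef er i j ne).

Local Ltac et := apply: et_eq => /=.

Definition extension : modular_operad k.
Proof.
refine (@ModularOperad k et_cx act et_comp contr _ _ _ _ _ _ _ _ _ _ _ _ _).
- by move=> g l Sgl u; et; apply: mo_stable.
- by move=> g l u; et; rewrite mo_act1.
- by move=> g l sigma tau u; et; rewrite mo_actM.
- move=> g l h m f r ef er i sigma tau rho x y t0 e; et.
    by rewrite (mo_comp_act _ _ _ _ t0 e).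
  by rewrite !mm_act -!sgn_cm !(mo_comp_act _ _ _ _ t0 e) linearD.
- by move=> g l f r ef er i j sigma ne ne' rho x e; et; rewrite (mo_contr_act _ _ ne ne' _ e).
- by move=> g l f r ef er i j ne ne' x; et; rewrite (mo_contrC _ _ ne ne').
- move=> g l h m f r ef ef' er er' i sigma rho p q x y.
  move=> /et_homogP[H1 H2] /et_homogP[H1' H2'] s0 e; et.
    by rewrite (mo_compC ef ef' er er' H1 H1' s0 e).
  rewrite (sgn_homog _ (cm_homog _ H1')) (sgn_homog _ (cm_homog _ (cm_homog _ H1))).
  rewrite !bm_rZ (mo_compC ef ef' er er' (cm_homog (F g l.+1) H1) H2' s0 e).
  rewrite (mo_compC ef ef' er er' H2 (cm_homog (F h m.+1) H1') s0 e).
  rewrite !linearD /= !linearZ /= !scalerA mm_act [LHS]addrC -!signD.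
  congr (_ + _); congr (_ *: _); first by congr (_ ^ _); ring.
  (* The exponents p (q - n) and p q + n p have the same parity. *)
  by apply: (@sign_even _ _ _ (- (n * p))); ring.
- move=> g l h m f r g1 r1 g2 s g3 t e1 er e2 es e3 et e3' et' i b j x y z b0 e; et.
    by rewrite (mo_compA e1 er e2 es e3 et e3' et' _ _ _ b0 e).
  rewrite !mm_comp !sgn_bm bm_lD bm_rD !(mo_compA e1 er e2 es e3 et e3' et' _ _ _ b0 e).
  by rewrite addrA.
- move=> g l h m f r g1 r1 g2 s g3 t e1 er e2 es e3 et e3' et' i a j i' p q x y z.
  move=> /et_homogP[H1 H2] /et_homogP[H1' H2'] ia e e'; et.
    by rewrite (mo_compAC e1 er e2 es e3 et e3' et' _ H1 H1' ia e e').
  have HF := cm_homog (F h m.+1) H1; have HF' := cm_homog (F f r.+1) H1'.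
  rewrite !mm_comp (sgn_homog _ HF) (sgn_homog _ HF') !bm_lD !bm_rZ !bm_lZ.
  rewrite !(mo_compAC e1 er e2 es e3 et e3' et' _ HF H2' ia e e').
  rewrite !(mo_compAC e1 er e2 es e3 et e3' et' _ H2 HF' ia e e').
  rewrite !(mo_compAC e1 er e2 es e3 et e3' et' _ HF HF' ia e e').
  rewrite !scalerDr !scalerA -!signD !addrA; congr (_ + _); last first.
    by congr (_ *: _); congr (_ ^ _); ring.
  rewrite [LHS]addrC; congr (_ + _); congr (_ *: _); first by congr (_ ^ _); ring.
  by apply: (@sign_even _ _ _ (- (n * p))); ring.
- move=> g l f r f' r' ef er ef' er' i j a b i' j' a' b' ij ab ij' ab' x E1 E2 E3 E4; et;
  by rewrite (mo_contr_contr ef er ef' er' ij ab ij' ab' _ E1 E2 E3 E4).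
- move=> g l h m f r f' r' g' l' ef er ef1 er1 eg el ef2 er2 i a b ab a' b' ab' i'.
  move=> x y E1 E2 E3; et; rewrite ?linearD /= ?mm_contr;
  by rewrite !(mo_contr_compl ef er ef1 er1 eg el ef2 er2 ab ab' _ _ E1 E2 E3).
- move=> g l h m f r f' r' h' m' ef er ef1 er1 eh em ef2 er2 i a b ab a' b' ab'.
  move=> x y E1 E2; et; rewrite ?linearD /= ?mm_contr -?sgn_cm;
  by rewrite !(mo_contr_compr ef er ef1 er1 eh em ef2 er2 ab ab' _ _ E1 E2).
- move=> g l h m f r f' r' ef er ef1 er1 i a b tau rho a' b' ab' i' c' ic'.
  move=> x y t0 s t E1 E2 E3 E4 E5; et; rewrite ?linearD /= ?mm_act -?sgn_cm;
  by rewrite !(mo_contr_compC ef er ef1 er1 ab' ic' _ _ t0 E1 E2 E3 E4 E5).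
Defined.

Definition et_cm1 g l : chain_map (extension g l) (S g l) :=
  @ChainMap k (et_cx g l) (S g l) fst (fun _ _ => erefl) (fun=> erefl).

Definition et_fst : mo_morphism extension S :=
  @MoMorphism k extension S et_cm1 (fun _ _ _ _ => erefl)
    (fun _ _ _ _ _ _ _ _ _ _ _ => erefl) (fun _ _ _ _ _ _ _ _ _ _ => erefl).

End Extension.

(** * Direct sums indexed by a monoid *)

Section DirectSum.
Variables (k : fieldType) (I : nmodType) (V : lmodType k).

Inductive ds_rel : {freeg (I * V)%type / k} -> Prop :=
| DsRel i a v w : ds_rel (<< (i, a *: v + w) >> - (a *: << (i, v) >> + << (i, w) >>)).

(** For I = [nat] these are the polynomials V[t] used for paths; for I = [int] they are Laurent
    polynomials, the exponent being the weight. The presentation by generators makes linear maps out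
    of it easy to define. *)
Definition dsum : lmodType k := subquot (sm_full _) (sm_span ds_rel).

Definition single (i : I) (v : V) : dsum :=
  sq_pi (sm_full _) (sm_span ds_rel) << (i, v) >>.

Lemma single_lin i : linear (single i).
Proof.
move=> a v w; rewrite -sq_pi_lin //; apply/sq_pi_eq => //.
rewrite -[_ - _]scale1r -[_ *: _]addr0; apply: span_step; last exact: span_0.
exact: DsRel.
Qed.

Lemma ds_ind (S : dsum -> Prop) :
  S 0 -> (forall i v u, S u -> S (single i v + u)) -> forall u, S u.
Proof.
move=> S0 SD; elim/sq_ind=> x _; rewrite -(freeg_sumE x).
elim: (dom x) => [|[i v] s IHs]; first by rewrite big_nil.
rewrite big_cons -[coeff (i, v) x]mulr1.
have -> : << coeff (i, v) x * 1 *g (i, v) >> = coeff (i, v) x *: << (i, v) >> :> {freeg _ / k}.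
  by apply/eqP/freeg_eqP => y; rewrite coeffZ !coeffU mulrA.
rewrite sq_pi_lin // -[_ *: _](linear_scale _ _ (single_lin i)); exact: SD.
Qed.

Lemma ds_eq (W : lmodType k) (f g : dsum -> W) : linear f -> linear g ->
  (forall i v, f (single i v) = g (single i v)) -> f =1 g.
Proof.
move=> lf lg fg; elim/ds_ind=> [|i v u IH]; first by rewrite !linear_zero.
by rewrite (linear_add _ _ lf) (linear_add _ _ lg) fg IH.
Qed.

Section Lift.
Variables (W : lmodType k) (phi : I -> V -> W).
Hypothesis phi_lin : forall i, linear (phi i).

Let phi2 (z : I * V) := phi z.1 z.2.

Let lift_lin : linear (fglift phi2).
Proof.
have D : zmod_morphism (fglift phi2) by exact: lift_is_additive.
have DD (u v : {freeg (I * V)%type / k}) : fglift phi2 (u + v) = fglift phi2 u + fglift phi2 v.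
  have N w : fglift phi2 (- w) = - fglift phi2 w.
    by rewrite -[- w]add0r D -{1}(subrr w) D subrr add0r.
  by rewrite -{1}[v]opprK D N opprK.
have L0 : fglift phi2 0 = 0 by rewrite -(subrr 0) D subrr.
move=> c x y; rewrite DD; congr (_ + _); rewrite -[x]freeg_sumE.
elim: (dom x) => [|v s IHs]; first by rewrite !big_nil scaler0 L0 scaler0.
rewrite !big_cons scalerDr !DD IHs scalerDr.
have -> : c *: << coeff v x *g v >> = << c * coeff v x *g v >> :> {freeg _ / k}.
  by apply/eqP/freeg_eqP => z; rewrite coeffZ !coeffU mulrA.
by rewrite !liftU scalerA.
Qed.

Let lift_rel x : sm_span ds_rel x -> fglift phi2 x = 0.
Proof.
apply: (span_map (S := sm_zero W) lift_lin) => {}x [i a v w] /=.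
rewrite lift_is_additive lift_lin !liftU !scale1r /phi2 /= phi_lin.
exact: subrr.
Qed.

Fact ds_lift_subproof : {f : {linear dsum -> W} | forall i v, f (single i v) = phi i v}.
Proof.
pose f (u : dsum) := fglift phi2 (sq_val u).
have f_pi x : f (sq_pi _ _ x) = fglift phi2 x.
  have /lift_rel : sm_span ds_rel (sq_val (sq_pi (sm_full _) (sm_span ds_rel) x) - x).
    exact: sq_pi_val.
  rewrite -scaleN1r addrC lift_lin scaleN1r addrC => /eqP.
  by rewrite subr_eq0 => /eqP.
have lf : linear f.
  move=> a; elim/sq_ind=> x _; elim/sq_ind=> y _.
  by rewrite -sq_pi_lin // !f_pi lift_lin.
by exists (mk_linear lf) => i v; rewrite [LHS]f_pi liftU scale1r.
Qed.

Definition ds_lift : {linear dsum -> W} := sval ds_lift_subproof.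

Lemma ds_liftE i v : ds_lift (single i v) = phi i v.
Proof. exact: (svalP ds_lift_subproof). Qed.

End Lift.

Fact ds_coef_lin (i j : I) : linear (fun v : V => if j == i then v else 0).
Proof. by move=> a u v; case: eqP; rewrite // scaler0 addr0. Qed.

Definition ds_coef (i : I) : {linear dsum -> V} := ds_lift (ds_coef_lin i).

Lemma ds_coefE i j v : ds_coef i (single j v) = if j == i then v else 0.
Proof. exact: ds_liftE. Qed.

Lemma ds_coefK u : exists s : seq I, forall t, uniq t -> {subset s <= t} ->
  u = \sum_(i <- t) single i (ds_coef i u).
Proof.
elim/ds_ind: u => [|j v u [s sE]].
  by exists [::] => t _ _; rewrite big1 // => i _; rewrite linear0 (linear_zero (single_lin i)).
exists (j :: s) => t Ut st; have jt : j \in t by apply: st; rewrite inE eqxx.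
rewrite {1}(sE t) // => [|i si]; last by apply: st; rewrite inE si orbT.
rewrite [RHS](eq_bigr (fun i => single i (ds_coef i (single j v)) + single i (ds_coef i u))).
  rewrite big_split; congr (_ + _); rewrite (bigD1_seq j) //= ds_coefE eqxx.
  rewrite big1 ?addr0 // => i /negPf ij.
  by rewrite ds_coefE eq_sym ij (linear_zero (single_lin i)).
by move=> i _; rewrite linearD (linear_add _ _ (single_lin i)).
Qed.

Lemma ds_coef_eq u v : (forall i, ds_coef i u = ds_coef i v) -> u = v.
Proof.
move=> uv; have [s sE] := ds_coefK u; have [t tE] := ds_coefK v.
rewrite (sE (undup (s ++ t))) ?undup_uniq // => [|i si].
  rewrite [RHS](tE (undup (s ++ t))) ?undup_uniq // => [|i ti].
    by apply: eq_bigr => i _; rewrite uv.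
  by rewrite mem_undup mem_cat ti orbT.
by rewrite mem_undup mem_cat si.
Qed.

End DirectSum.
Arguments ds_coef {k I V} i.

Section DirectSumMap.
Variables (k : fieldType) (I : nmodType) (V W : lmodType k) (f : I -> {linear V -> W}).

Fact ds_map_subproof i : linear (fun v => single i (f i v)).
Proof. by move=> a u v; rewrite linearP single_lin. Qed.

Definition ds_map : {linear dsum I V -> dsum I W} := ds_lift ds_map_subproof.

Lemma ds_mapE i v : ds_map (single i v) = single i (f i v).
Proof. exact: ds_liftE. Qed.

Lemma ds_coef_map i u : ds_coef i (ds_map u) = f i (ds_coef i u).
Proof.
move: u; apply: ds_eq => [a u v|a u v|j v]; rewrite ?linearP //.
by rewrite ds_mapE !ds_coefE; case: eqP => [->|]; rewrite ?linear0.
Qed.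

End DirectSumMap.

Section DirectSumComplex.
Variables (k : fieldType) (I : nmodType).
Implicit Types C D E : complex k.

Lemma single0 (V : lmodType k) i : single i (0 : V) = 0 :> dsum I V.
Proof. exact: linear_zero (single_lin i). Qed.

Lemma singleZ (V : lmodType k) i a (v : V) : single i (a *: v) = a *: single i v :> dsum I V.
Proof. exact: linear_scale (single_lin i). Qed.

Lemma singleD (V : lmodType k) i (v w : V) :
  single i (v + w) = single i v + single i w :> dsum I V.
Proof. exact: linear_add (single_lin i). Qed.

Section Complex.
Variable C : complex k.

Definition ds_pr p : {linear dsum I C -> dsum I C} := ds_map (fun=> cx_pr C p).
Definition ds_d : {linear dsum I C -> dsum I C} := ds_map (fun=> cx_d C).

Fact ds_prK p q u : ds_pr p (ds_pr q u) = if p == q then ds_pr q u else 0.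
Proof.
apply: ds_coef_eq => i; rewrite !ds_coef_map cx_prK.
by case: ifP; rewrite ?ds_coef_map ?linear0.
Qed.

Fact ds_sum u : exists2 s : seq int, uniq s & u = \sum_(p <- s) ds_pr p u.
Proof.
suff [s sE] : exists s : seq int, forall t, uniq t -> {subset s <= t} ->
    u = \sum_(p <- t) ds_pr p u.
  by exists (undup s); rewrite ?undup_uniq //; apply: sE; rewrite ?undup_uniq // => p;
    rewrite mem_undup.
elim/ds_ind: u => [|i v u [s sE]].
  by exists [::] => t _ _; rewrite big1 // => p _; rewrite linear0.
have [r rE] := cx_sumE v; exists (r ++ s) => t Ut rst.
under eq_bigr do rewrite linearD; rewrite big_split; congr (_ + _); last first.
  by apply: sE => // p sp; apply: rst; rewrite mem_cat sp orbT.
rewrite {1}(rE t) // => [|p rp]; last by apply: rst; rewrite mem_cat rp.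
under [RHS]eq_bigr do rewrite ds_mapE.
exact: (linear_sum (mk_linear (@single_lin k I C i))).
Qed.

Fact ds_prd p u : ds_pr (p - 1) (ds_d u) = ds_d (ds_pr p u).
Proof. by apply: ds_coef_eq => i; rewrite !ds_coef_map cx_prd. Qed.

Fact ds_dd u : ds_d (ds_d u) = 0.
Proof. by apply: ds_coef_eq => i; rewrite !ds_coef_map cx_dd linear0. Qed.

Definition ds_cx : complex k := Complex ds_prK ds_sum ds_prd ds_dd.

Lemma ds_cx_ind (S : ds_cx -> Prop) :
  S 0 -> (forall i v u, S u -> S (single i v + u)) -> forall u, S u.
Proof. exact: ds_ind. Qed.

Lemma ds_cx_prE p i v : cx_pr ds_cx p (single i v) = single i (cx_pr C p v).
Proof. exact: ds_mapE. Qed.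

Lemma ds_cx_dE i v : cx_d ds_cx (single i v) = single i (cx_d C v).
Proof. exact: ds_mapE. Qed.

Lemma coef_pr i p (u : ds_cx) : ds_coef i (cx_pr ds_cx p u) = cx_pr C p (ds_coef i u).
Proof. exact: ds_coef_map. Qed.

Lemma coef_d i (u : ds_cx) : ds_coef i (cx_d ds_cx u) = cx_d C (ds_coef i u).
Proof. exact: ds_coef_map. Qed.

Lemma single_homog p i v : homog p v -> homog p (single i v : ds_cx).
Proof. by rewrite /homog ds_cx_prE => ->. Qed.

Lemma ds_homog_ind p (S : ds_cx -> Prop) : S 0 ->
    (forall i v u, homog p v -> S u -> S (single i v + u)) ->
  forall u, homog p u -> S u.
Proof.
move=> S0 SD u <-; elim/ds_cx_ind: u => [|i v u IHu]; first by rewrite linear0.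
by rewrite linearD ds_cx_prE; apply: SD => //; apply: homog_pr.
Qed.

End Complex.

Section ChainMap.
Variables (C D : complex k) (f : chain_map C D).

Let F : {linear ds_cx C -> ds_cx D} := ds_map (fun=> cm_map f).

Fact ds_chain_pr p u : F (cx_pr (ds_cx C) p u) = cx_pr (ds_cx D) p (F u).
Proof. by apply: ds_coef_eq => i; rewrite !(ds_coef_map, coef_pr) cm_pr. Qed.

Fact ds_chain_d u : F (cx_d (ds_cx C) u) = cx_d (ds_cx D) (F u).
Proof. by apply: ds_coef_eq => i; rewrite !(ds_coef_map, coef_d) cm_d. Qed.

Definition ds_chain : chain_map (ds_cx C) (ds_cx D) := ChainMap ds_chain_pr ds_chain_d.

Lemma ds_chainE i v : ds_chain (single i v) = single i (f v).
Proof. exact: ds_mapE. Qed.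

Lemma coef_chain i u : ds_coef i (ds_chain u) = f (ds_coef i u).
Proof. exact: ds_coef_map. Qed.

End ChainMap.

Section BichainMap.
Variables (C D E : complex k) (f : bichain_map C D E).

Fact ds_bi_linr i (v : C) j : linear (fun w => single (i + j) (f v w) : dsum I E).
Proof. by move=> a w w'; rewrite bm_rDZ single_lin. Qed.

Definition ds_bir i (v : C) : {linear dsum I D -> dsum I E} := ds_lift (ds_bi_linr i v).

Fact ds_bi_linl w i : linear (fun v => ds_bir i v w).
Proof.
move=> a v v'; elim/ds_ind: w => [|j w u IH].
  by rewrite !linear0 ?scaler0 addr0.
rewrite !(linearD (ds_bir _ _)) IH !ds_liftE bm_lDZ single_lin.
by rewrite scalerDr addrACA.
Qed.

Definition ds_bifun (u : ds_cx C) (w : ds_cx D) : ds_cx E := ds_lift (ds_bi_linl w) u.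

Lemma ds_bifunE i j v w : ds_bifun (single i v) (single j w) = single (i + j) (f v w).
Proof. by rewrite /ds_bifun !ds_liftE. Qed.

Fact ds_bifun_linl w : linear (ds_bifun ^~ w).
Proof. by move=> a u u'; rewrite /ds_bifun linearP. Qed.

Fact ds_bifun_linr u : linear (ds_bifun u).
Proof.
move=> a w w'; elim/ds_ind: u => [|i v u IH].
  by rewrite /ds_bifun !linear0 ?scaler0 addr0.
have lD x : ds_bifun (single i v + u) x = ds_bir i v x + ds_bifun u x.
  by rewrite /ds_bifun linearD ds_liftE.
by rewrite !lD IH linearP scalerDr addrACA.
Qed.

Fact ds_bifun_homog p q u w : homog p u -> homog q w -> homog (p + q) (ds_bifun u w).
Proof.
move=> Hu Hw; elim/ds_homog_ind: Hu => [|i v {}u Hv IHu].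
  by rewrite (linear_zero (ds_bifun_linl w)); apply: homog0.
rewrite (linear_add _ _ (ds_bifun_linl w)); apply: homogD IHu.
elim/ds_homog_ind: Hw => [|j x {}w Hx IHw].
  by rewrite (linear_zero (ds_bifun_linr _)); apply: homog0.
rewrite (linear_add _ _ (ds_bifun_linr _)) ds_bifunE; apply: homogD IHw.
exact/single_homog/bm_homog.
Qed.

Fact ds_bifun_leibniz p u w : homog p u -> cx_d (ds_cx E) (ds_bifun u w)
  = ds_bifun (cx_d (ds_cx C) u) w + (-1 : k) ^ p *: ds_bifun u (cx_d (ds_cx D) w).
Proof.
have lD x y z := linear_add x y (ds_bifun_linl z).
have rD x y z := linear_add x y (ds_bifun_linr z).
move=> Hu; elim/ds_homog_ind: Hu => [|i v {}u Hv IHu].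
  by rewrite linear0 !(linear_zero (ds_bifun_linl _)) linear0 ?scaler0 addr0.
rewrite linearD !lD linearD IHu scalerDr addrACA; congr (_ + _) => {IHu u}.
elim/ds_cx_ind: w => [|j x w IHw].
  by rewrite linear0 !(linear_zero (ds_bifun_linr _)) linear0 ?scaler0 addr0.
rewrite linearD !rD linearD IHw scalerDr addrACA; congr (_ + _).
by rewrite !ds_cx_dE !ds_bifunE ds_cx_dE (bm_leibniz _ _ Hv) singleD singleZ.
Qed.

Definition ds_bimap : bichain_map (ds_cx C) (ds_cx D) (ds_cx E) :=
  BichainMap ds_bifun_linl ds_bifun_linr ds_bifun_homog ds_bifun_leibniz.

Lemma ds_bimapE i j v w : ds_bimap (single i v) (single j w) = single (i + j) (f v w).
Proof. exact: ds_bifunE. Qed.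

End BichainMap.

Lemma ds_cx_eq C D (f g : ds_cx C -> D) : linear f -> linear g ->
  (forall i v, f (single i v) = g (single i v)) -> forall u, f u = g u.
Proof. exact: ds_eq. Qed.

Lemma ds_homog_eq C D p (f g : ds_cx C -> D) : linear f -> linear g ->
  (forall i v, homog p v -> f (single i v) = g (single i v)) ->
  forall u, homog p u -> f u = g u.
Proof.
move=> lf lg fg; apply: ds_homog_ind => [|i v u Hv IH]; first by rewrite !linear_zero.
by rewrite (linear_add _ _ lf) (linear_add _ _ lg) fg // IH.
Qed.

End DirectSumComplex.

Section DirectSumOperad.
Variables (k : fieldType) (I : nmodType) (P : modular_operad k).

Let Q g l := ds_cx I (P g l).
Let act g l (sigma : 'S_l) : chain_map (Q g l) (Q g l) := ds_chain I (mo_act P g sigma).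
Let comp g l h m f n (ef : f = (g + h)%N) (en : n.+2 = (l + m.+1)%N) (i : 'I_l) :
    bichain_map (Q g l) (Q h m.+1) (Q f n) :=
  ds_bimap I (mo_comp P ef en i).
Let contr g l f n (ef : f = g.+1) (en : n.+2 = l) (i j : 'I_l) (ne : i != j) :
    chain_map (Q g l) (Q f n) :=
  ds_chain I (mo_contr P ef en ne).

Section Linear.
Variables (U V W : complex k).

Lemma lin_id : linear (fun u : U => u).
Proof. by []. Qed.

Lemma lin_scale a (g : U -> V) : linear g -> linear (fun u => a *: g u).
Proof. by move=> lg b u v /=; rewrite lg scalerDr !scalerA mulrC. Qed.

Lemma lin_cm (f : chain_map V W) (g : U -> V) : linear g -> linear (fun u => f (g u)).
Proof. by move=> lg b u v /=; rewrite lg linearP. Qed.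

Lemma lin_bml (X : complex k) (f : bichain_map V X W) (g : U -> V) y :
  linear g -> linear (fun u => f (g u) y).
Proof. by move=> lg b u v /=; rewrite lg bm_lDZ. Qed.

Lemma lin_bmr (X : complex k) (f : bichain_map X V W) (g : U -> V) x :
  linear g -> linear (fun u => f x (g u)).
Proof. by move=> lg b u v /=; rewrite lg bm_rDZ. Qed.

End Linear.

Local Ltac lin := solve [repeat lazymatch goal with
  | |- linear id => exact: lin_id
  | |- linear (fun u => u) => exact: lin_id
  | |- linear (@bm_map _ _ _ _ _ _) => exact: bm_linr
  | |- linear (fun u => @GRing.scale _ _ _ _) => simple eapply lin_scale
  | |- linear (fun u => @bm_map _ _ _ _ _ _ _) =>
      first [simple eapply lin_bml | simple eapply lin_bmr]
  | |- _ => simple eapply lin_cm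
  end].
Local Ltac gen x i := move: x; apply: ds_cx_eq; [lin | lin | move=> i x].
Local Ltac hgen x Hx i := move: x Hx; apply: ds_homog_eq; [lin | lin | move=> i x Hx].

Let E := (ds_chainE, ds_bimapE).

Definition ds_operad : modular_operad k.
Proof.
refine (@ModularOperad k Q act comp contr _ _ _ _ _ _ _ _ _ _ _ _ _); rewrite /act /comp /contr.
- move=> g l Sgl x; elim/ds_cx_ind: x => [|i x u IH]; first by [].
  by rewrite IH (mo_stable Sgl x) single0 addr0.
- by move=> g l x; gen x a; rewrite !E mo_act1.
- by move=> g l sigma tau x; gen x a; rewrite !E mo_actM.
- move=> g l h m f n ef en i sigma tau rho x y t0 e; gen x a; gen y b; rewrite !E.
  by rewrite (mo_comp_act _ _ _ _ t0 e).
- move=> g l f n ef en i j sigma ne ne' rho x e; gen x a; rewrite !E.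
  by rewrite (mo_contr_act _ _ ne ne' _ e).
- by move=> g l f n ef en i j ne ne' x; gen x a; rewrite !E (mo_contrC _ _ ne ne').
- move=> g l h m f n ef ef' en en' i sigma rho p q x y Hx Hy s0 e.
  hgen x Hx a; hgen y Hy b; rewrite !E.
  by rewrite (mo_compC ef ef' en en' Hx Hy s0 e) singleZ addrC.
- move=> g l h m f n g1 r g2 s g3 t e1 er e2 es e3 et e3' et' i b j x y z b0 e.
  gen x c1; gen y c2; gen z c3; rewrite !E.
  by rewrite (mo_compA e1 er e2 es e3 et e3' et' _ _ _ b0 e) addrA.
- move=> g l h m f n g1 r g2 s g3 t e1 er e2 es e3 et e3' et' i a j i' p q x y z Hy Hz ia e e'.
  gen x c1; hgen y Hy c2; hgen z Hz c3; rewrite !E.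
  by rewrite (mo_compAC e1 er e2 es e3 et e3' et' x Hy Hz ia e e') singleZ addrAC.
- move=> g l f n f' n' ef en ef' en' i j a b i' j' a' b' ij ab ij' ab' x E1 E2 E3 E4.
  gen x c; rewrite !E.
  by rewrite (mo_contr_contr ef en ef' en' ij ab ij' ab' _ E1 E2 E3 E4).
- move=> g l h m f n f' n' g' l' ef en ef1 en1 eg el ef2 en2 i a b ab a' b' ab' i'.
  move=> x y E1 E2 E3; gen x c1; gen y c2; rewrite !E.
  by rewrite (mo_contr_compl ef en ef1 en1 eg el ef2 en2 ab ab' _ _ E1 E2 E3).
- move=> g l h m f n f' n' h' m' ef en ef1 en1 eh em ef2 en2 i a b ab a' b' ab'.
  move=> x y E1 E2; gen x c1; gen y c2; rewrite !E.
  by rewrite (mo_contr_compr ef en ef1 en1 eh em ef2 en2 ab ab' _ _ E1 E2).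
- move=> g l h m f n f' n' ef en ef1 en1 i a b tau rho a' b' ab' i' c' ic'.
  move=> x y t0 E1 E2 E3 E4 E5; gen x c1; gen y c2; rewrite !E.
  by rewrite (mo_contr_compC ef en ef1 en1 ab' ic' _ _ t0 E1 E2 E3 E4 E5).
Defined.

Lemma ds_actE g l (sigma : 'S_l) i (x : P g l) :
  mo_act ds_operad g sigma (single i x) = single i (mo_act P g sigma x).
Proof. exact: ds_chainE. Qed.

Lemma ds_compE g l h m f n (ef : f = (g + h)%N) (en : n.+2 = (l + m.+1)%N) (i : 'I_l)
    a b (x : P g l) (y : P h m.+1) :
  mo_comp ds_operad ef en i (single a x) (single b y) = single (a + b) (mo_comp P ef en i x y).
Proof. exact: ds_bimapE. Qed.

Lemma ds_contrE g l f n (ef : f = g.+1) (en : n.+2 = l) (i j : 'I_l) (ne : i != j)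
    a (x : P g l) :
  mo_contr ds_operad ef en ne (single a x) = single a (mo_contr P ef en ne x).
Proof. exact: ds_chainE. Qed.

End DirectSumOperad.

(** * Derivations *)

Record derivation (k : fieldType) (S P : modular_operad k) (F : mo_morphism S P) :=
  Derivation {
  dv_map :> forall g l, {linear S g l -> P g l};
  dv_pr : forall g l p x, dv_map g l (cx_pr _ p x) = cx_pr _ p (dv_map g l x);
  dv_d : forall g l x, dv_map g l (cx_d _ x) = cx_d _ (dv_map g l x);
  dv_act : forall g l (sigma : 'S_l) (x : S g l),
    dv_map g l (mo_act S g sigma x) = mo_act P g sigma (dv_map g l x);
  dv_comp : forall g l h m f n (ef : f = (g + h)%N) (en : n.+2 = (l + m.+1)%N)
      (i : 'I_l) (x : S g l) (y : S h m.+1),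
    dv_map f n (mo_comp S ef en i x y)
      = mo_comp P ef en i (dv_map g l x) (F h m.+1 y)
        + mo_comp P ef en i (F g l x) (dv_map h m.+1 y);
  dv_contr : forall g l f n (ef : f = g.+1) (en : n.+2 = l) (i j : 'I_l)
      (ne : i != j) (x : S g l),
    dv_map f n (mo_contr S ef en ne x) = mo_contr P ef en ne (dv_map g l x) }.

Section DerivationTwist.
Variables (k : fieldType) (S P : modular_operad k) (F : mo_morphism S P).
Variable D : derivation F.

Lemma dv_sgn n g l x : D g l (sgn n _ x) = sgn n _ (D g l x).
Proof. by apply: pr_eq => p; rewrite -dv_pr !pr_deg linearZ /= dv_pr. Qed.

(** A derivation of degree 0 becomes the coefficient of a symbol u of degree -1. The sign operator
    turns commutation of D with the differentials into the anticommutation required for d^2 = 0. *)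
Definition derivation_twist : twist F (-1).
Proof.
apply: (@Twist k S P F (-1) (fun g l => D g l \o sgn (-1) (S g l) : {linear _ -> _})) => /=.
- by move=> g l p x; rewrite sgn_pr dv_pr opprK subrK.
- by move=> g l x; rewrite -dv_d sgn_d exprN1 invrN1 scaleN1r linearN opprK.
- by move=> g l sigma x; rewrite -sgn_cm dv_act.
- move=> g l h m f r ef er i p x y Hx; rewrite sgn_bm dv_comp sgn_cm; congr (_ + _).
  by rewrite (sgn_homog _ Hx) linearZ /= bm_lZ mulN1r signN.
- by move=> g l f r ef er i j ne x; rewrite -sgn_cm dv_contr.
Defined.

End DerivationTwist.

(** * Evaluation, functoriality and the weight derivation on direct sums *)

Section DirectSumMorphisms.
Variables (k : fieldType) (I : nmodType).
Implicit Types S P : modular_operad k.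

Section Evaluation.
Variables (P : modular_operad k) (chi : I -> k).
Hypothesis chiD : forall i j, chi (i + j) = chi i * chi j.

Fact ds_eval_subproof g l i : linear (fun v : P g l => chi i *: v).
Proof. by move=> a u v; rewrite scalerDr !scalerA mulrC. Qed.

Definition ds_eval_lin g l : {linear ds_cx I (P g l) -> P g l} :=
  ds_lift (@ds_eval_subproof g l).

Lemma ds_eval_linE g l i v : ds_eval_lin g l (single i v) = chi i *: v.
Proof. exact: ds_liftE. Qed.

Fact ds_eval_pr g l p u : ds_eval_lin g l (cx_pr (ds_cx I (P g l)) p u)
  = cx_pr _ p (ds_eval_lin g l u).
Proof.
elim/ds_cx_ind: u => [|i v u IH]; first by rewrite !linear0.
by rewrite !linearD IH ds_cx_prE !ds_eval_linE linearZ.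
Qed.

Fact ds_eval_d g l u : ds_eval_lin g l (cx_d (ds_cx I (P g l)) u)
  = cx_d _ (ds_eval_lin g l u).
Proof.
elim/ds_cx_ind: u => [|i v u IH]; first by rewrite !linear0.
by rewrite !linearD IH ds_cx_dE !ds_eval_linE linearZ.
Qed.

Definition ds_eval_cm g l : chain_map (ds_cx I (P g l)) (P g l) :=
  @ChainMap k (ds_cx I (P g l)) (P g l) (ds_eval_lin g l) (@ds_eval_pr g l) (@ds_eval_d g l).

Let ds_eval_cmE g l i v : ds_eval_cm g l (single i v) = chi i *: v.
Proof. exact: ds_eval_linE. Qed.

(** For powers of c as [chi] this is evaluation of polynomials at t = c; for the constant 1 it is
    summation over all weights. *)
Definition ds_eval : mo_morphism (ds_operad I P) P.
Proof.
apply: (@MoMorphism k (ds_operad I P) P ds_eval_cm).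
- move=> g l sigma; elim/ds_cx_ind=> [|i v u IH]; first by rewrite !linear0.
  by rewrite !linearD IH ds_actE !ds_eval_cmE linearZ.
- move=> g l h m f n ef en i x y; elim/ds_cx_ind: x => [|a v u IH].
    by rewrite bm_l0 !linear0 bm_l0.
  rewrite bm_lD !linearD bm_lD IH; congr (_ + _) => {u IH}.
  elim/ds_cx_ind: y => [|b w u IH]; first by rewrite bm_r0 !linear0 bm_r0.
  rewrite bm_rD !linearD bm_rD IH; congr (_ + _) => {u IH}.
  by rewrite ds_compE !ds_eval_cmE bm_lZ bm_rZ scalerA chiD.
- move=> g l f n ef en i j ne; elim/ds_cx_ind=> [|a v u IH]; first by rewrite !linear0.
  by rewrite !linearD IH ds_contrE !ds_eval_cmE linearZ.
Defined.

Lemma ds_evalE g l i v : ds_eval g l (single i v) = chi i *: v.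
Proof. exact: ds_eval_linE. Qed.

End Evaluation.

Section Functor.
Variables (S P : modular_operad k) (F : mo_morphism S P).

Definition ds_morph : mo_morphism (ds_operad I S) (ds_operad I P).
Proof.
apply: (@MoMorphism k (ds_operad I S) (ds_operad I P) (fun g l => ds_chain I (F g l))).
- move=> g l sigma; elim/ds_cx_ind=> [|i v u IH]; first by rewrite !linear0.
  by rewrite !linearD IH ds_actE !ds_chainE ?ds_actE mm_act.
- move=> g l h m f n ef en i x y; elim/ds_cx_ind: x => [|a v u IH].
    by rewrite bm_l0 !linear0 bm_l0.
  rewrite bm_lD !linearD bm_lD IH; congr (_ + _) => {u IH}.
  elim/ds_cx_ind: y => [|b w u IH]; first by rewrite bm_r0 !linear0 bm_r0.
  by rewrite bm_rD !linearD bm_rD IH ds_compE !ds_chainE ?ds_compE mm_comp.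
- move=> g l f n ef en i j ne; elim/ds_cx_ind=> [|a v u IH]; first by rewrite !linear0.
  by rewrite !linearD IH ds_contrE !ds_chainE ?ds_contrE mm_contr.
Defined.

Lemma ds_morphE g l i v : ds_morph g l (single i v) = single i (F g l v).
Proof. exact: ds_chainE. Qed.

Variables (D : derivation F) (omega : I -> k).
Hypothesis omegaD : forall i j, omega (i + j) = omega i + omega j.

Fact wt_der_subproof g l i : linear (fun v => D g l v - omega i *: F g l v).
Proof.
by move=> a u v; rewrite !linearP addrACA -scalerDr.
Qed.

Let wt_der_map g l : {linear ds_cx I (S g l) -> ds_cx I (P g l)} :=
  ds_map (fun i => mk_linear (@wt_der_subproof g l i)).

Let wtE g l i v : wt_der_map g l (single i v) = single i (D g l v - omega i *: F g l v).
Proof. exact: ds_mapE. Qed.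

(* D minus the weight derivation, which multiplies F by [omega i] on the summand i. *)
Definition wt_der : derivation ds_morph.
Proof.
apply: (@Derivation k _ _ ds_morph wt_der_map).
- move=> g l p u; apply: ds_coef_eq => i.
  by rewrite ds_coef_map !coef_pr ds_coef_map /mk_linear /= dv_pr cm_pr linearB /= [cx_pr _ _ (_ *: _)]linearZ.
- move=> g l u; apply: ds_coef_eq => i.
  by rewrite ds_coef_map !coef_d ds_coef_map /mk_linear /= dv_d cm_d linearB /= [cx_d _ (_ *: _)]linearZ.
- move=> g l sigma; elim/ds_cx_ind=> [|i v u IH]; first by rewrite !linear0.
  rewrite !linearD IH ds_actE !wtE ds_actE.
  by rewrite mm_act dv_act linearB /= [mo_act _ _ _ (_ *: _)]linearZ.
- move=> g l h m f n ef en i x y; elim/ds_cx_ind: x => [|a v u IH].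
    by rewrite bm_l0 !linear0 !bm_l0 addr0.
  rewrite bm_lD !linearD !bm_lD IH addrACA; congr (_ + _) => {u IH}.
  elim/ds_cx_ind: y => [|b w u IH]; first by rewrite bm_r0 !linear0 !bm_r0 addr0.
  rewrite bm_rD !linearD !bm_rD IH addrACA; congr (_ + _) => {u IH}.
  rewrite ds_compE !wtE !ds_morphE.
  rewrite !ds_compE -singleD.
  congr (single _ _); rewrite dv_comp mm_comp -!scaleNr.
  by rewrite bm_lD bm_rD bm_lZ bm_rZ addrACA -scalerDl omegaD opprD.
- move=> g l f n ef en i j ne; elim/ds_cx_ind=> [|a v u IH]; first by rewrite !linear0.
  rewrite !linearD IH ds_contrE !wtE ds_contrE.
  by rewrite mm_contr dv_contr linearB /= [mo_contr _ _ _ _ (_ *: _)]linearZ.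
Defined.

Lemma coef_wt_der g l i u :
  ds_coef i (wt_der g l u) = D g l (ds_coef i u) - omega i *: F g l (ds_coef i u).
Proof. exact: ds_coef_map. Qed.

End Functor.

End DirectSumMorphisms.

Section PolynomialDerivative.
Variables (k : fieldType) (P : modular_operad k).

Let Q := ds_operad nat P.

(** This is d/dt on P[t]. For i = 0 the index [i.-1] is a harmless default, since the coefficient is
    0. *)
Fact deriv_subproof g l (i : nat) : linear (fun v : P g l => single i.-1 (i%:R *: v)).
Proof. by move=> a u v; rewrite scalerDr scalerA mulrC -scalerA single_lin. Qed.

Definition deriv_map g l : {linear Q g l -> Q g l} := ds_lift (@deriv_subproof g l).

Lemma deriv_mapE g l i v : deriv_map g l (single i v) = single i.-1 (i%:R *: v).
Proof. exact: ds_liftE. Qed.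

Definition ds_deriv : derivation (mm_id Q).
Proof.
apply: (@Derivation k Q Q (mm_id Q) deriv_map).
- move=> g l p; elim/ds_cx_ind=> [|i v u IH]; first by rewrite !linear0.
  by rewrite !linearD IH ds_cx_prE !deriv_mapE ds_cx_prE linearZ.
- move=> g l; elim/ds_cx_ind=> [|i v u IH]; first by rewrite !linear0.
  by rewrite !linearD IH ds_cx_dE !deriv_mapE ds_cx_dE linearZ.
- move=> g l sigma; elim/ds_cx_ind=> [|i v u IH]; first by rewrite !linear0.
  by rewrite !linearD IH ds_actE !deriv_mapE ds_actE linearZ.
- move=> g l h m f n ef en i x y.
  have idE g' l' (z : Q g' l') : mm_id Q g' l' z = z by [].
  rewrite !idE.
  elim/ds_cx_ind: x => [|a v u IH].
    by rewrite bm_l0 !linear0 !bm_l0 addr0.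
  rewrite bm_lD !linearD !bm_lD IH addrACA; congr (_ + _) => {u IH}.
  elim/ds_cx_ind: y => [|b w u IH]; first by rewrite bm_r0 !linear0 !bm_r0 addr0.
  rewrite bm_rD !linearD !bm_rD IH addrACA; congr (_ + _) => {u IH}.
  rewrite ds_compE !deriv_mapE !ds_compE bm_lZ bm_rZ natrD scalerDl singleD.
  congr (_ + _).
    (* Only for a vanishing exponent does [.-1] fail to commute with the sum of exponents, and then
       the coefficient is 0. *)
    by case: a => [|a]; rewrite ?scale0r ?single0.
  by case: b => [|b]; rewrite ?scale0r ?single0 // -[_.-1]/((a + b.+1)%N.-1) addnS.
- move=> g l f n ef en i j ne; elim/ds_cx_ind=> [|a v u IH]; first by rewrite !linear0.
  by rewrite !linearD IH ds_contrE !deriv_mapE ds_contrE linearZ.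
Defined.

Lemma ds_derivE g l i v : ds_deriv g l (single i v) = single i.-1 (i%:R *: v).
Proof. exact: deriv_mapE. Qed.

End PolynomialDerivative.

(** * Pullbacks and path objects *)

Section Pullback.
Variables (k : fieldType) (A B Z : modular_operad k).
Variables (F : mo_morphism A Z) (G : mo_morphism B Z).

Fact pullback_rel :
  closed_rel (idfun : {rmorphism k -> k}) (fun g l (x : A g l) (y : B g l) => F g l x = G g l y).
Proof.
split.
- by move=> g l; rewrite !linear0.
- by move=> g l a x y x' y' /= e e'; rewrite !linearP e e'.
- by move=> g l p x y e; rewrite !cm_pr e.
- by move=> g l x y e; rewrite !cm_d e.
- by move=> g l sigma x y e; rewrite !mm_act e.
- by move=> g l h m f n ef en i x y x' y' e e'; rewrite !mm_comp e e'.
- by move=> g l f n ef en i j ne x y e; rewrite !mm_contr e.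
Qed.

Definition pullback : modular_operad k := sub_product pullback_rel.
Definition pb_fst : mo_morphism pullback A := sp_fst pullback_rel.
Definition pb_snd : mo_morphism pullback B := sp_snd pullback_rel.

Lemma pbP g l (u : pullback g l) : F g l (pb_fst g l u) = G g l (pb_snd g l u).
Proof. exact: (spP u). Qed.

Lemma pb_ex g l x y : F g l x = G g l y ->
  exists2 u : pullback g l, pb_fst g l u = x & pb_snd g l u = y.
Proof.
move=> e; exists (@sp_in _ _ _ _ _ _ pullback_rel g l x y); first exact: sp1_in.
exact: sp2_in.
Qed.

Lemma pb_eq g l (u v : pullback g l) :
  pb_fst g l u = pb_fst g l v -> pb_snd g l u = pb_snd g l v -> u = v.
Proof. exact: sp_eq. Qed.

(** Base change: the first coordinate is prescribed, and the second is found by lifting its image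
    along G. *)
Lemma fibration_pb_fst : fibration G -> fibration pb_fst.
Proof.
move=> LG g l z w Zz dw.
have Zz2 : cycles (B g l) (pb_snd g l z) by exact: cm_cycles.
have [y Gy dy] : exists2 y, G g l y = F g l w & cx_d _ y = pb_snd g l z.
  by apply: LG => //; rewrite -cm_d dw pbP.
have [u u1 u2] := pb_ex (esym Gy); exists u => //.
by apply: pb_eq; rewrite cm_d ?u1 ?u2.
Qed.

Lemma fibration_pb_snd : fibration F -> fibration pb_snd.
Proof.
move=> LF g l z w Zz dw.
have Zz1 : cycles (A g l) (pb_fst g l z) by exact: cm_cycles.
have [y Fy dy] : exists2 y, F g l y = G g l w & cx_d _ y = pb_fst g l z.
  by apply: LF => //; rewrite -cm_d dw -pbP.
have [u u1 u2] := pb_ex Fy; exists u => //.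
by apply: pb_eq; rewrite cm_d ?u1 ?u2.
Qed.

End Pullback.

(* The operad of paths in Y: polynomial differential forms on the line with values in Y. *)
Section PathObject.
Variables (k : fieldType) (char_k : [pchar k] =i pred0) (Y : modular_operad k).

Let Yt := ds_operad nat Y.

(** The adjoined symbol is dt, of degree -1 because differentials lower the degree. *)
Definition path_operad : modular_operad k :=
  extension (derivation_twist (ds_deriv Y)).

Fact expD (c : k) (i j : nat) : c ^+ (i + j)%R = c ^+ i * c ^+ j.
Proof. exact: exprD. Qed.

Let evt c : mo_morphism Yt Y := ds_eval Y (expD c).

Definition path_ev c : mo_morphism path_operad Y := mm_trans (et_fst _) (evt c).

Section Primitive.
Variables g l : nat.
Let C := ds_cx nat (Y g l).

Fact prim_subproof (i : nat) :
  linear (fun v : Y g l => single i.+1 (i.+1%:R^-1 *: v) : dsum nat (Y g l)).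
Proof. by move=> a u v; rewrite scalerDr scalerA mulrC -scalerA single_lin. Qed.

(** Integration from 0 to t; dividing by i + 1 is where the characteristic enters. *)
Definition prim : {linear C -> C} := ds_lift prim_subproof.

Lemma primE i v : prim (single i v) = single i.+1 (i.+1%:R^-1 *: v).
Proof. exact: ds_liftE. Qed.

Lemma prim_d u : cx_d C (prim u) = prim (cx_d C u).
Proof.
elim/ds_cx_ind: u => [|i v u IH]; first by rewrite !linear0.
by rewrite !linearD IH primE !ds_cx_dE primE linearZ.
Qed.

Lemma deriv_prim u : ds_deriv Y g l (prim u) = u.
Proof.
elim/ds_cx_ind: u => [|i v u IH]; first by rewrite !linear0.
rewrite !linearD IH primE ds_derivE /= scalerA divff ?scale1r //.
by rewrite (pcharf0P k).1.
Qed.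

Lemma prim_deriv u : prim (ds_deriv Y g l u) = u - single 0%N (evt 0 g l u).
Proof.
elim/ds_cx_ind: u => [|i v u IH]; first by rewrite !linear0 single0 subr0.
rewrite !linearD IH singleD opprD [RHS]addrACA; congr (_ + _).
rewrite ds_derivE ds_evalE primE; case: i => [|i] /=.
  by rewrite expr0 scale1r scale0r scaler0 single0 subrr.
rewrite exprS mul0r scale0r single0 subr0 scalerA mulVf ?scale1r //.
by rewrite (pcharf0P k).1.
Qed.

End Primitive.

Lemma path_cycle g l (z : path_operad g l) : cycles _ z ->
  cx_d (Yt g l) z.1 = 0 /\ ds_deriv Y g l (sgn (-1) _ z.1) = - cx_d (Yt g l) z.2.
Proof.
move=> /= Zz; split; first exact: (congr1 fst Zz).
by apply/eqP; rewrite -addr_eq0; apply/eqP; apply: (congr1 snd Zz).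
Qed.

(** Let z = z1 + z2 dt be a cycle. Integrating z2 gives J with dJ = z1 - z1(0), and adding the
    constant w - J(c) to J gives a chain with value w at c. Its differential is z1, since dw = z1(c)
    and dJ(c) = z1(c) - z1(0). *)
Lemma fibration_path_ev c : fibration (path_ev c).
Proof.
move=> g l z w /path_cycle[Zg dE] dw.
have dw' : cx_d _ w = evt c g l z.1 by [].
(* The sign operator undoes the one built into [derivation_twist]. *)
pose J := prim g l (sgn (-1) (Yt g l) z.2).
have dJ : cx_d (Yt g l) J = z.1 - single 0%N (evt 0 g l z.1).
  rewrite /J prim_d -prim_deriv; congr (prim _ _ _).
  by rewrite sgn_d exprN1 invrN1 scaleN1r -linearN -dE dv_sgn sgnK.
pose X : Yt g l := J + single 0%N (w - evt c g l J).
have X1 : cx_d (Yt g l) X = z.1.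
  rewrite linearD ds_cx_dE dJ [cx_d _ (w - _)]linearB -cm_d dJ dw' [evt c g l (_ - _)]linearB ds_evalE expr0 scale1r.
  by rewrite opprB addrCA subrr addr0 subrK.
have X2 : ds_deriv Y g l (sgn (-1) _ X) = z.2.
  by rewrite dv_sgn linearD ds_derivE scale0r single0 addr0 /J deriv_prim sgnK.
exists (X, 0 : Yt g l).
  have -> : path_ev c g l (X, 0) = evt c g l X by [].
  by rewrite linearD ds_evalE expr0 scale1r addrC subrK.
apply: et_eq; first exact: X1.
transitivity (ds_deriv Y g l (sgn (-1) _ X) + cx_d (Yt g l) 0); first by [].
by rewrite linear0 addr0 X2.
Qed.

End PathObject.

(** * From zigzags to spans *)

Section Spans.
Variables (k : fieldType) (char_k : [pchar k] =i pred0).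
Implicit Types P Q R X Y Z : modular_operad k.

Definition spanned P R := exists (S : modular_operad k) (F : mo_morphism S P)
  (G : mo_morphism S R), fibration F /\ fibration G.

Lemma spanned_sym P R : spanned P R -> spanned R P.
Proof. by move=> [S [F [G [LF LG]]]]; exists S, G, F. Qed.

(** Spans compose by fibre product over the middle operad, since acyclic fibrations are stable under
    base change and composition. *)
Lemma spanned_trans P Q R : spanned P Q -> spanned Q R -> spanned P R.
Proof.
move=> [S [F [G [LF LG]]]] [S' [F' [G' [LF' LG']]]].
exists (pullback G F'), (mm_trans (pb_fst _ _) F), (mm_trans (pb_snd _ _) G'); split.
  by apply: fibration_trans => //; apply: fibration_pb_fst.
by apply: fibration_trans => //; apply: fibration_pb_snd.
Qed.

(** The straight path from the given chain to 0, with no dt part. Adding its differential to a path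
    moves the start by a boundary and leaves the end fixed. *)
Lemma path_ev_boundary Y g l (t : Y g l) : exists2 h : path_operad Y g l,
  path_ev Y 0 g l h = t & path_ev Y 1 g l h = 0.
Proof.
exists (single 0%N t - single 1%N t, 0).
  have -> : path_ev Y 0 g l (single 0%N t - single 1%N t, 0)
    = ds_eval Y (expD 0) g l (single 0%N t - single 1%N t) by [].
  by rewrite linearB !ds_evalE expr0 expr1 scale1r scale0r subr0.
have -> : path_ev Y 1 g l (single 0%N t - single 1%N t, 0)
  = ds_eval Y (expD 1) g l (single 0%N t - single 1%N t) by [].
by rewrite linearB !ds_evalE expr0 expr1 scale1r subrr.
Qed.

(* The paths in Y starting in the image of X. *)
Lemma spanned_weq X Y (F : mo_morphism X Y) : weak_equivalence F -> spanned X Y.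
Proof.
move=> /weak_equivalenceP wF; pose E := pullback F (path_ev Y 0).
exists E, (pb_fst _ _), (mm_trans (pb_snd _ _) (path_ev Y 1)); split.
  exact/fibration_pb_fst/fibration_path_ev.
move=> g l z w Zz dw; have [Fs Fi] := wF g l.
pose x := pb_fst F (path_ev Y 0) g l z; pose p := pb_snd F (path_ev Y 0) g l z.
have Zp : cycles _ p by exact: cm_cycles.
have Zx : cycles _ x by exact: cm_cycles.
(* This lift of the path component ends at w, but its start has no reason to come from X. The rest
   of the proof corrects the start. *)
have [q qw dq] := fibration_path_ev char_k Zp dw.
have dy : cx_d _ (path_ev Y 0 g l q) = F g l x by rewrite -cm_d dq -pbP.
(* The start of q bounds F x, so injectivity on homology makes x a boundary. *)
have [x0 dx0] : boundaries (X g l) x by apply: Fi => //; exists (path_ev Y 0 g l q).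
have Zy : cycles (Y g l) (path_ev Y 0 g l q - F g l x0).
  by rewrite /= linearB dy -cm_d -dx0 subrr.
(* The defect between the start of q and F x0 is a cycle, hence homologous to some F x1. The
   bounding chain t is absorbed by the differential of the straight path h, which ends at 0. *)
have [x1 Zx1 [t dt]] := Fs _ Zy; have [h h0 h1] := path_ev_boundary t.
have : F g l (x0 + x1) = path_ev Y 0 g l (q + cx_d _ h).
  rewrite !linearD cm_d h0 -dt opprB [RHS]addrC -[RHS]addrA subrK.
  exact: addrC.
move=> /(@pb_ex _ _ _ _ F (path_ev Y 0))[u u1 u2]; exists u.
  have -> : mm_trans (pb_snd F (path_ev Y 0)) (path_ev Y 1) g l u
    = path_ev Y 1 g l (pb_snd F (path_ev Y 0) g l u) by [].
  by rewrite u2 linearD cm_d h1 linear0 addr0.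
apply: pb_eq; rewrite cm_d ?u1 ?u2 linearD ?cx_dd ?addr0 //.
by rewrite (Zx1 : cx_d _ _ = 0) addr0 -dx0.
Qed.

Lemma zigzag_spanned P R : weq_zigzag P R -> spanned P R.
Proof.
elim=> [|Q Q' F _ IH /spanned_weq|Q Q' F _ IH /spanned_weq /spanned_sym].
- by exists P, (mm_id P), (mm_id P); split; apply: fibration_id.
- exact: spanned_trans.
- exact: spanned_trans.
Qed.

End Spans.

(** * Functionals on an extension field *)

Section SeparatingFunctional.
Variables (k : fieldType) (V : lmodType k) (M : submod V) (c : V).
Hypothesis Mc : ~ M c.

Let avoiding := {S : submod V | (forall x, M x -> S x) /\ ~ S c}.
Let incl (S T : avoiding) := `[< forall x, sval S x -> sval T x >].

Let chain_bound (A : set avoiding) : total_on A incl ->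
  exists T, forall S, A S -> incl S T.
Proof.
(* M is joined to the union so that the empty chain also has an upper bound. *)
move=> totA; pose U x := M x \/ exists2 S : avoiding, A S & sval S x.
have U0 : U 0 by left; apply: sm_0.
have Ulin a x y : U x -> U y -> U (a *: x + y).
  move=> [Mx|[S AS Sx]] [My|[T AT Ty]].
  - by left; apply: sm_lin.
  - right; exists T => //; apply: sm_lin => //; exact: (svalP T).1.
  - right; exists S => //; apply: sm_lin => //; exact: (svalP S).1.
  right; case: (totA S T AS AT) => /asboolP ST.
    by exists T => //; apply: sm_lin => //; apply: ST.
  by exists S => //; apply: sm_lin => //; apply: ST.
have UP : (forall x, M x -> Submod U0 Ulin x) /\ ~ Submod U0 Ulin c.
  split=> [x Mx|[//|[S _ Sc]]]; first by left.
  exact: (svalP S).2.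
exists (exist _ (Submod U0 Ulin) UP) => S AS; apply/asboolP => x Sx.
by right; exists S.
Qed.

(** By Zorn there is a subspace S maximal among those containing M and avoiding c. Maximality forces
    V to be S plus the line of c, and rho is the coordinate along c. *)
Lemma separating_functional :
  exists2 rho : V -> k, forall a x y, rho (a *: x + y) = a * rho x + rho y
    & (forall x, M x -> rho x = 0) /\ rho c = 1.
Proof.
have MP : (forall x, M x -> M x) /\ ~ M c by [].
have [||S maxS] := @ZL_preorder avoiding (exist _ M MP) incl _ _ chain_bound.
- by move=> S; apply/asboolP.
- by move=> R S T /asboolP RS /asboolP ST; apply/asboolP => x /RS /ST.
have [MS Sc] := svalP S.
have coord x : exists a, sval S (x - a *: c).
  have [Sx|Sx] := pselect (sval S x); first by exists 0; rewrite scale0r subr0.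
  (* This is S + k x. If it avoided c, maximality would put x in S; so it contains c, and solving
     for x gives the coordinate. *)
  pose U y := exists2 b, sval S (y - b *: x) & True.
  have U0 : U 0 by exists 0 => //; rewrite scale0r subr0; apply: sm_0.
  have Ulin a y z : U y -> U z -> U (a *: y + z).
    move=> [b Sb _] [d Sd _]; exists (a * b + d) => //.
    by rewrite scalerDl opprD addrACA -scalerA -scalerBr; apply: sm_lin.
  have [Uc|Uc] := pselect (U c).
    have [b Sb _] := Uc; have b0 : b != 0.
      by apply/eqP => b0; apply: Sc; move: Sb; rewrite b0 scale0r subr0.
    exists b^-1; have := sm_Z (- b^-1) Sb.
    by rewrite scalerBr !scalerA mulNr mulVf // !scaleNr scale1r opprK addrC.
  have UP : (forall y, M y -> Submod U0 Ulin y) /\ ~ Submod U0 Ulin c.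
    by split=> // y My; exists 0 => //; rewrite scale0r subr0; apply: MS.
  case: Sx; have /asboolP/(_ x) : incl (exist _ (Submod U0 Ulin) UP) S.
    apply: maxS; apply/asboolP => y Sy; exists 0 => //.
    by rewrite scale0r subr0.
  by apply; exists 1 => //; rewrite scale1r subrr; apply: sm_0.
have uniq a b x : sval S (x - a *: c) -> sval S (x - b *: c) -> a = b.
  move=> Sa Sb; apply: contrapT => ab; apply: Sc.
  have ba : b - a != 0 by rewrite subr_eq0; apply/eqP => /esym.
  suff : sval S ((b - a)^-1 *: ((b - a) *: c)) by rewrite scalerA mulVf // scale1r.
  apply: sm_Z.
  have -> : (b - a) *: c = (x - a *: c) - (x - b *: c).
    by rewrite opprB [RHS]addrC addrA subrK scalerBl.
  exact: sm_B.
exists (fun x => sval (cid (coord x))) => [a x y|].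
  case: (cid (coord x)) => b Sb; case: (cid (coord y)) => d Sd /=.
  case: cid => e Se /=; apply: uniq Se _.
  by rewrite scalerDl opprD addrACA -scalerA -scalerBr; apply: sm_lin.
split=> [x Mx|]; case: cid => a Sa /=; apply: uniq Sa _.
  by rewrite scale0r subr0; apply: MS.
by rewrite scale1r subrr; apply: sm_0.
Qed.

End SeparatingFunctional.

(** * Applying a functional to the coefficients of a tensor *)

Section Contraction.
Variables (k K : fieldType) (emb : {rmorphism k -> K}) (rho : K -> k).
Hypothesis rho_lin : forall a x y, rho (emb a * x + y) = a * rho x + rho y.

Lemma klin0 : rho 0 = 0.
Proof. by have := rho_lin (-1) 0 0; rewrite mulr0 addr0 mulN1r addNr. Qed.

Lemma klinD x y : rho (x + y) = rho x + rho y.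
Proof. by rewrite -[x]mul1r -(rmorph1 emb) rho_lin mul1r rmorph1 mul1r. Qed.

Lemma klinZ a x : rho (emb a * x) = a * rho x.
Proof. by rewrite -[emb a * x]addr0 rho_lin klin0 addr0. Qed.

Section Module.
Variable V : lmodType k.

(** The universal property [ext_lift] yields K-linear maps only, while rho is merely k-linear; the
    map is therefore built by hand on the free module. *)
Let fr (x : {freeg V / K}) : V := \sum_(v <- dom x) rho (coeff v x) *: v.

Let frE x (s : seq V) : uniq s -> {subset dom x <= s} ->
  fr x = \sum_(v <- s) rho (coeff v x) *: v.
Proof.
move=> Us xs; rewrite [RHS](bigID (mem (dom x))) /= [X in _ + X]big1 => [|v /coeff_outdom ->].
  rewrite addr0 -[RHS]big_filter; apply/perm_big/uniq_perm; rewrite ?uniq_dom ?filter_uniq // => v.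
  by rewrite mem_filter /= andb_idr //; apply: xs.
by rewrite klin0 scale0r.
Qed.

Let frD x y : fr (x + y) = fr x + fr y.
Proof.
pose s := undup (dom x ++ dom y ++ dom (x + y)).
have Us : uniq s := undup_uniq _.
rewrite !(@frE _ s) //; try by move=> v vx; rewrite mem_undup !mem_cat vx ?orbT.
by rewrite -big_split; apply: eq_bigr => v _; rewrite coeffD klinD scalerDl.
Qed.

Let frU c v : fr << c *g v >> = rho c *: v.
Proof.
rewrite (@frE _ [:: v]) ?big_seq1 // => [|w].
  by rewrite coeffU eqxx mulr1.
by rewrite mem_dom coeffU inE; case: (v =P w) => [->|_]; rewrite ?mulr0 ?eqxx.
Qed.

Let fr_rel x : sm_span (@ext_rel _ _ emb V) x -> fr x = 0.
Proof.
have fr0 : fr 0 = 0 by apply: (addrI (fr 0)); rewrite -frD !addr0.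
have frN y : fr (- y) = - fr y by apply/eqP; rewrite -addr_eq0 -frD addNr fr0.
elim=> [//|c _ z [a v w] _ IH].
rewrite frD IH addr0 scalerBr scalerDr scalerA !fgscaleU frD frN frD !frU !mulr1.
by rewrite [c * _]mulrC klinZ scalerDr scalerA [rho c * a]mulrC subrr.
Qed.

(* rho (x) id : K (x) V -> V *)
Definition contract (u : ext_scalars emb V) : V := fr (sq_val u).

Lemma contract_pi x : contract (sq_pi _ _ x) = fr x.
Proof.
have /fr_rel : sm_span (@ext_rel _ _ emb V)
    (sq_val (sq_pi (sm_full _) (sm_span (@ext_rel _ _ emb V)) x) - x) by exact: sq_pi_val.
set y := sq_val _ => yx0; rewrite -[fr x]add0r -yx0 -frD subrK //.
Qed.

Lemma contractD u v : contract (u + v) = contract u + contract v.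
Proof.
elim/sq_ind: u => x _; elim/sq_ind: v => y _.
by rewrite -{1}[sq_pi _ _ x]scale1r -sq_pi_lin // scale1r !contract_pi frD.
Qed.

Lemma contract_inj c v : contract (c *: ext_inj emb v) = rho c *: v.
Proof.
rewrite -[_ *: _]addr0 -(sq_pi0 (sm_full _) (sm_span (@ext_rel _ _ emb V))) -sq_pi_lin //.
by rewrite contract_pi addr0 fgscaleU frU mulr1.
Qed.

Lemma contract0 : contract 0 = 0.
Proof. by apply: (addrI (contract 0)); rewrite -contractD !addr0. Qed.

Lemma contractZ a u : contract (emb a *: u) = a *: contract u.
Proof.
elim/ext_ind: u => [|c v u IH]; first by rewrite scaler0 contract0 scaler0.
by rewrite scalerDr !contractD IH scalerA !contract_inj klinZ scalerDr scalerA.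
Qed.

End Module.

Lemma contract_map (C D : complex k) (f : chain_map C D) u :
  contract (ext_map emb f u) = f (contract u).
Proof.
elim/ext_complex_ind: u => [|c v u IH]; first by rewrite linear0 !contract0 linear0.
by rewrite linearP ext_map_inj !contractD !contract_inj linearD linearZ IH.
Qed.

Lemma contract_pr (C : complex k) p u :
  contract (cx_pr (ext_complex emb C) p u) = cx_pr C p (contract u).
Proof.
elim/ext_complex_ind: u => [|c v u IH]; first by rewrite linear0 !contract0 linear0.
by rewrite linearP ext_complex_pr_inj !contractD !contract_inj linearD linearZ IH.
Qed.

Lemma contract_d (C : complex k) u :
  contract (cx_d (ext_complex emb C) u) = cx_d C (contract u).
Proof.
elim/ext_complex_ind: u => [|c v u IH]; first by rewrite linear0 !contract0 linear0.
by rewrite linearP ext_complex_d_inj !contractD !contract_inj linearD linearZ IH.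
Qed.

(** Since rho is not multiplicative, one factor must come from k. This is exactly the shape of the
    terms in the Leibniz rule for [descent_der]. *)
Lemma contract_bimap_l (C D E : complex k) (f : bichain_map C D E) x v :
  contract (ext_bimap emb f (ext_inj emb x) v) = f x (contract v).
Proof.
elim/ext_complex_ind: v => [|c y v IH]; first by rewrite bm_r0 !contract0 bm_r0.
by rewrite bm_rDZ ext_bimap_inj !contractD !contract_inj bm_rDZ IH.
Qed.

Lemma contract_bimap_r (C D E : complex k) (f : bichain_map C D E) u y :
  contract (ext_bimap emb f u (ext_inj emb y)) = f (contract u) y.
Proof.
elim/ext_complex_ind: u => [|c x u IH]; first by rewrite bm_l0 !contract0 bm_l0.
by rewrite bm_lDZ ext_bimap_inj !contractD !contract_inj bm_lDZ IH.
Qed.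

End Contraction.

(** * Descent of the degree derivation *)

Definition lifts_degree (k : fieldType) (S P : modular_operad k) (F : mo_morphism S P)
    (D : derivation F) :=
  forall g l (n : int) (x : S g l), cycles _ x -> homog n x ->
    boundaries _ (D g l x - n%:~R *: F g l x).

Section Descent.
Variables (k K : fieldType) (emb : {rmorphism k -> K}) (P : modular_operad k).
Variables (S H : modular_operad K).
Variables (f : mo_morphism S (ext_operad emb P)) (h : mo_morphism S H).
Hypotheses (Lf : fibration f) (Lh : fibration h).
Hypothesis Hd : forall g l (u : H g l), cx_d _ u = 0.
Variable rho : K -> k.
Hypothesis rho_lin : forall a x y, rho (emb a * x + y) = a * rho x + rho y.
Hypothesis rho1 : rho 1 = 1.

(** Dual numbers S[eps] with eps of degree 0: a pair (s, s') stands for s + s' eps. *)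
Let Seps := extension (zero_twist (mm_id S) 0).
Let delta g l : {linear H g l -> H g l} := deg_op intr (H g l).

(** The second condition says that h sends s + s' eps into the graph of the degree derivation, that
    is, into the image of id + eps delta. *)
Let U g l (p : P g l) (t : Seps g l) :=
  ext_inj emb p = f g l t.1 /\ h g l t.2 = delta g l (h g l t.1).

(** Closure under composition holds because [delta] is a derivation. The differential does not
    commute with [delta], and closure under it rests on the differential of H being zero. *)
Fact descent_rel : closed_rel emb U.
Proof.
split.
- by move=> g l; split; rewrite ?ext_inj0 !linear0.
- move=> g l a x y x' y' [e1 e2] [e1' e2']; split=> /=.
    by rewrite ext_inj_lin e1 e1' linearP.
  by rewrite !linearP e2 e2'.
- move=> g l p x y [e1 e2]; split=> /=.
    by rewrite cm_pr -e1 [RHS]ext_complex_pr_inj.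
  by rewrite !cm_pr subr0 e2 deg_pr pr_deg.
- move=> g l x y [e1 e2]; split=> /=.
    by rewrite cm_d -e1 [RHS]ext_complex_d_inj.
  by rewrite add0r !cm_d !Hd linear0.
- move=> g l sigma x y [e1 e2]; split=> /=.
    by rewrite (mm_act f sigma y.1) -e1 [RHS]ext_map_inj.
  by rewrite !mm_act e2 deg_cm.
- move=> g l h' m r n ef en i x y x' y' [e1 e2] [e1' e2']; split=> /=.
    by rewrite (mm_comp f ef en i y.1 y'.1) -e1 -e1' [RHS]ext_bimap_inj.
  rewrite linearD /= !mm_comp e2 e2' sgn0 /delta deg_bm_der 1?addrC //.
  by move=> p q; rewrite intrD.
- move=> g l r n ef en i j ne x y [e1 e2]; split=> /=.
    by rewrite (mm_contr f ef en ne y.1) -e1 [RHS]ext_map_inj.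
  by rewrite !mm_contr e2 deg_cm.
Qed.

Definition descent : modular_operad k := sub_product descent_rel.
Definition descent_fst : mo_morphism descent P := sp_fst descent_rel.

Let epart g l (t : descent g l) : Seps g l := sp2 t.

Let relP g l (t : descent g l) : U (descent_fst g l t) (epart t).
Proof. exact: (spP t). Qed.

Let cycle_parts g l (z : descent g l) : cycles _ z ->
  cx_d _ (epart z).1 = 0 /\ cx_d _ (epart z).2 = 0.
Proof.
move=> Zz; have dz : cx_d (Seps g l) (epart z) = 0.
  have <- : sp2 (cx_d (descent g l) z) = cx_d (Seps g l) (epart z) by apply: sp2_d.
  by rewrite (Zz : cx_d _ z = 0) /sp2 sm_out0.
split; first exact: (congr1 fst dz).
by rewrite -[LHS]add0r; apply: (congr1 snd dz).
Qed.

(** The two conditions are solved in turn: s1 lifts w (x) 1 along f, then s2 lifts [delta] of h s1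
    along h. *)
Lemma fibration_descent : fibration descent_fst.
Proof.
move=> g l z w Zz dw; have [e1 e2] := relP z.
have [dz1 dz2] := cycle_parts Zz.
have [s1 fs1 ds1] : exists2 s1, f g l s1 = ext_inj emb w & cx_d _ s1 = (epart z).1.
  by apply: Lf => //; rewrite -e1 -dw; apply: ext_complex_d_inj.
have [s2 hs2 ds2] : exists2 s2, h g l s2 = delta g l (h g l s1) & cx_d _ s2 = (epart z).2.
  by apply: Lh => //; rewrite e2 -ds1 cm_d !Hd linear0.
have Uw : U w ((s1, s2) : Seps g l) by [].
exists (@sp_in _ _ _ _ _ _ descent_rel g l w (s1, s2)); first exact: sp1_in.
apply: sp_eq.
  by rewrite [LHS]sp1_d sp1_in.
rewrite [LHS]sp2_d sp2_in //; apply: et_eq; rewrite /= ?ds1 // add0r ds2 //.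
Qed.

Let contr_rho g l : ext_operad emb P g l -> P g l := @contract _ _ emb rho (P g l).

Fact descent_der_subproof g l : linear (fun t : descent g l => contr_rho (f g l (epart t).2)).
Proof.
move=> a t u; rewrite /epart sp2_lin /= linearP.
by rewrite /contr_rho (contractD rho_lin) (contractZ rho_lin).
Qed.

Definition descent_der : derivation descent_fst.
Proof.
apply: (@Derivation k _ _ descent_fst (fun g l => mk_linear (@descent_der_subproof g l))).
- move=> g l p x; rewrite /mk_linear /= /epart sp2_pr /= subr0 cm_pr.
  exact: contract_pr.
- move=> g l x; rewrite /mk_linear /= /epart sp2_d /= add0r cm_d.
  exact: contract_d.
- move=> g l sigma x; rewrite /mk_linear /= /epart sp2_act /= (mm_act f sigma (sp2 x).2).
  exact: contract_map.
- move=> g l h' m r n ef en i x y; rewrite /mk_linear /= /epart sp2_comp /= linearD /= sgn0.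
  rewrite (mm_comp f ef en i (sp2 x).1 (sp2 y).2) (mm_comp f ef en i (sp2 x).2 (sp2 y).1).
  rewrite /contr_rho (contractD rho_lin) addrC; congr (_ + _).
    rewrite -(relP y).1; exact: contract_bimap_r.
  rewrite -(relP x).1; exact: contract_bimap_l.
- move=> g l r n ef en i j ne x; rewrite /mk_linear /= /epart sp2_contr /= (mm_contr f ef en ne (sp2 x).2).
  exact: contract_map.
Defined.

(** On a cycle of degree n, s' - n s is a cycle killed by h, hence a boundary in S. Applying f and
    then rho gives the claim, because rho 1 = 1 sends f s = p (x) 1 back to p. *)
Lemma descent_lifts_degree : lifts_degree descent_der.
Proof.
move=> g l n z Zz Hz; have [e1 e2] := relP z.
have [dz1 dz2] := cycle_parts Zz.
have Hz1 : homog n (epart z).1 by have /et_homogP[] := sp2_homog Hz.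
have [y dy] : boundaries (S g l) ((epart z).2 - n%:~R *: (epart z).1).
  apply: (acyclic_fib_boundary (@Lh g l)).
    by rewrite /= linearB linearZ /= dz1 dz2 scaler0 subrr.
  by rewrite linearB linearZ /= e2 (deg_homog _ (cm_homog (h g l) Hz1)) subrr.
exists (contr_rho (f g l y)).
transitivity (contr_rho (f g l ((epart z).2 - n%:~R *: (epart z).1))); last first.
  by rewrite dy cm_d; apply: contract_d.
(* The integer is written as a scalar coming from k, the only kind that passes through the
   contraction. *)
have -> : (epart z).2 - n%:~R *: (epart z).1 = emb (- n%:~R) *: (epart z).1 + (epart z).2.
  by rewrite rmorphN rmorph_int scaleNr addrC.
rewrite linearP -e1 /contr_rho (contractD rho_lin) (contractZ rho_lin) addrC scaleNr.
congr (- (_ *: _) + _).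
by rewrite -[ext_inj _ _]scale1r (contract_inj rho_lin) rho1 scale1r.
Qed.

End Descent.

(** * Weight gradings and formality *)

Lemma pair_eq (T T' : Type) (u v : T * T') : u.1 = v.1 -> u.2 = v.2 -> u = v.
Proof. by case: u v => ? ? [? ?] /= -> ->. Qed.

Section FormalityOfDegreeLift.
Variables (k : fieldType) (char_k : [pchar k] =i pred0).
Variables (S P : modular_operad k) (F : mo_morphism S P) (D : derivation F).
Hypotheses (LF : fibration F) (FD : lifts_degree D).

Let H := homology_operad P.

Let SZ := ds_operad int S.
Let PZ := ds_operad int P.

Let intr_add (i j : int) : (i + j)%:~R = i%:~R + j%:~R :> k.
Proof. exact: intrD. Qed.

(* On the summand of weight w, B is the shifted cone of D - w F: its homology is that of P
   in degree w and vanishes in higher degrees. *)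
Definition weight_operad : modular_operad k :=
  extension (derivation_twist (wt_der D intr_add)).
Local Notation B := weight_operad.

Let one_mul (i j : int) : 1 = 1 * 1 :> k. Proof. by rewrite mulr1. Qed.

(** The components q form an ideal, so forgetting them respects compositions; the remaining
    components t are summed over the weights and mapped by F. *)
Definition aug : mo_morphism B P :=
  mm_trans (et_fst _) (mm_trans (@ds_eval k int S (fun=> 1) one_mul) F).

(** * The homology of the summand of weight w *)

Section Weights.
Variables g l : nat.
Implicit Types (b : B g l) (w p : int).

Definition bsingle w (s : S g l) (q : P g l) : B g l := (single w s, single w q).

Definition wpr w b : B g l := bsingle w (ds_coef w b.1) (ds_coef w b.2).

Lemma wpr_lin w : linear (wpr w).
Proof. by move=> a b b'; apply: et_eq; rewrite /= linearP single_lin. Qed.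

Lemma wprK w v b : wpr w (wpr v b) = if v == w then wpr v b else 0.
Proof.
by apply: et_eq; rewrite /= ds_coefE; case: eqP => [->|] //=; rewrite single0.
Qed.

Lemma wpr_pr w p b : wpr w (cx_pr _ p b) = cx_pr _ p (wpr w b).
Proof. by apply: et_eq; rewrite /= coef_pr ds_cx_prE. Qed.

Lemma coef_sgn n w (u : SZ g l) : ds_coef w (sgn n _ u) = sgn n _ (ds_coef w u).
Proof. by apply: pr_eq => p; rewrite -coef_pr !pr_deg linearZ /= coef_pr. Qed.

Lemma coef_d2 w b : ds_coef w (cx_d _ b).2
  = D g l (sgn (-1) _ (ds_coef w b.1)) - w%:~R *: F g l (sgn (-1) _ (ds_coef w b.1))
    + cx_d _ (ds_coef w b.2).
Proof. by rewrite /= linearD coef_d -coef_sgn; congr (_ + _); apply: coef_wt_der. Qed.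

Lemma coef_d1 w b : ds_coef w (cx_d _ b).1 = cx_d _ (ds_coef w b.1).
Proof. exact: coef_d. Qed.

Lemma wpr_d w b : wpr w (cx_d _ b) = cx_d _ (wpr w b).
Proof.
apply: et_eq; apply: ds_coef_eq => v; rewrite ?(coef_d1, coef_d2) ![ds_coef v _]ds_coefE.
  by rewrite coef_d1; case: eqP; rewrite ?linear0.
rewrite coef_d2; case: eqP => [<-|] //.
by rewrite !linear0 ?scaler0 ?subrr !addr0.
Qed.

Lemma wpr_sum b : exists s : seq int, forall t, uniq t -> {subset s <= t} ->
  b = \sum_(w <- t) wpr w b.
Proof.
have [s sE] := ds_coefK b.1; have [r rE] := ds_coefK b.2.
exists (s ++ r) => t Ut srt; apply: et_eq.
  rewrite (linear_sum fst) /=; apply: sE => // w sw.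
  by apply: srt; rewrite mem_cat sw.
rewrite (linear_sum snd) /=; apply: rE => // w rw.
by apply: srt; rewrite mem_cat rw orbT.
Qed.

Lemma aug_bsingle w s q : aug g l (bsingle w s q) = F g l s.
Proof.
have -> : aug g l (bsingle w s q) = F g l (@ds_eval k int S (fun=> 1) one_mul g l (single w s)).
  by [].
by rewrite ds_evalE scale1r.
Qed.

Lemma homog_bsingle p w s q : homog p (bsingle w s q) <-> homog p s /\ homog (p + 1) q.
Proof.
have inj V : injective (@single k int V w).
  by move=> x y /(congr1 (ds_coef w)); rewrite !ds_coefE eqxx.
split=> [/et_homogP[/= H1 H2]|[H1 H2]].
  by split; [move: H1 | move: H2; rewrite opprK]; rewrite /homog ds_cx_prE => /inj.
by apply/et_homogP; rewrite opprK; split; apply: single_homog.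
Qed.

Lemma intr_neq0 (n : int) : n != 0 -> n%:~R != 0 :> k.
Proof.
have c0 := (pcharf0P k).1 char_k.
case: n => [n|n] n0; first by rewrite -pmulrn c0.
by rewrite NegzE mulrNz oppr_eq0 -pmulrn c0.
Qed.

Lemma bsingle_lin w a s q s' q' :
  bsingle w (a *: s + s') (a *: q + q') = a *: bsingle w s q + bsingle w s' q'.
Proof. by apply: et_eq; rewrite /= single_lin. Qed.

Lemma bsingle_inj w s q s' q' : bsingle w s q = bsingle w s' q' -> s = s' /\ q = q'.
Proof.
move=> e; have := congr1 (ds_coef w \o fst) e; have := congr1 (ds_coef w \o snd) e.
by rewrite /= !ds_coefE !eqxx.
Qed.

Lemma bsingle0 w : bsingle w 0 0 = 0.
Proof. by apply: et_eq; rewrite /= single0. Qed.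

Lemma d_bsingle w s q : cx_d _ (bsingle w s q) = bsingle w (cx_d _ s)
  (D g l (sgn (-1) _ s) - w%:~R *: F g l (sgn (-1) _ s) + cx_d _ q).
Proof.
have <- : wpr w (cx_d _ (bsingle w s q)) = cx_d _ (bsingle w s q).
  by rewrite wpr_d /wpr /= !ds_coefE eqxx.
by rewrite /wpr coef_d1 coef_d2 /= !ds_coefE eqxx.
Qed.

Lemma bsingle_cycle w p s q : homog p s -> cycles _ (bsingle w s q) ->
  cx_d _ s = 0 /\ D g l s - w%:~R *: F g l s = cx_d _ (- ((-1) ^ p *: q)).
Proof.
move=> Hs Zb; have : bsingle w 0 0 = cx_d _ (bsingle w s q) by rewrite bsingle0 Zb.
rewrite d_bsingle => /bsingle_inj[<- /esym].
rewrite (sgn_homog _ Hs) mulN1r signN !linearZ /= scalerA [w%:~R * _]mulrC -scalerA -scalerDr.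
rewrite scalerN => /eqP; rewrite addr_eq0 => /eqP De; split=> //.
by rewrite [cx_d _ _]linearN -De scalerA sign2 scale1r.
Qed.

(** For the component s of b, D s - w F s bounds because b is a cycle, and D s - p F s bounds
    because D lifts the degree. Their difference is (p - w) F s, and p - w is invertible. *)
Lemma aug_boundary w p b : wpr w b = b -> homog p b -> cycles _ b -> p != w ->
  boundaries _ (aug g l b).
Proof.
move=> <-; rewrite /wpr; move: (ds_coef w b.1) (ds_coef w b.2) => s q {b}.
move=> /homog_bsingle[Hs Hq] /(bsingle_cycle Hs)[Zs De] pw; rewrite aug_bsingle.
have [y Dy] := FD Zs Hs.
have n0 : (p - w)%:~R != 0 :> k by apply: intr_neq0; rewrite subr_eq0.
exists ((p - w)%:~R^-1 *: (- ((-1) ^ p *: q) - y)).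
rewrite [cx_d _ _]linearZ [cx_d _ (_ - _)]linearB -De -Dy opprB [X in _ = _ *: X]addrC addrA subrK -scalerBl.
by rewrite -intrB scalerA mulVf // scale1r.
Qed.

(** In degrees at least w, homology of the summand injects into that of P. The component s is
    removed first, by injectivity of F on homology; what remains is a cycle in the component q,
    which is reached through D - w F. *)
Lemma weight_boundary w p b : wpr w b = b -> homog p b -> cycles _ b -> w <= p ->
  boundaries _ (aug g l b) -> exists c, [/\ wpr w c = c, homog (p + 1) c & cx_d _ c = b].
Proof.
move=> bE Hb Zb wp Bb.
suff [c dc] : exists c, cx_d _ c = b.
  (* Any bounding chain can be cut down to weight w and degree p + 1, as the differential respects
     both decompositions. *)
  exists (cx_pr _ (p + 1) (wpr w c)); split; last by rewrite -prD_d -wpr_d dc bE Hb.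
    by rewrite wpr_pr wprK eqxx.
  exact: homog_pr.
move: bE Hb Zb Bb => <-; rewrite /wpr; move: (ds_coef w b.1) (ds_coef w b.2) => s q {b}.
move=> /homog_bsingle[Hs Hq] Zb; rewrite aug_bsingle => Bs.
have [Zs _] := bsingle_cycle Hs Zb.
have [s1 ds1] := (acyclic_fib_quasi_iso (@LF g l)).2 _ Zs Bs.
pose s' := cx_pr _ (p + 1) s1; have ds' : cx_d _ s' = s by rewrite -prD_d -ds1.
have Hs' : homog (p + 1) (bsingle w s' 0).
  by apply/homog_bsingle; split; [apply: homog_pr | apply: homog0].
(* Subtracting the differential of (s', 0) kills the component s and leaves this correction of q. *)
pose q' := q - (D g l (sgn (-1) _ s') - w%:~R *: F g l (sgn (-1) _ s')).
have q'E : bsingle w 0 q' = bsingle w s q - cx_d _ (bsingle w s' 0).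
  by rewrite d_bsingle linear0 addr0 ds' addrC -scaleN1r -bsingle_lin !scaleN1r addNr addrC.
have Hq' : homog (p + 1) q'.
  suff /homog_bsingle[] : homog p (bsingle w 0 q') by [].
  rewrite q'E -scaleN1r; apply: homogD; first exact/homog_bsingle.
  by apply: homogZ; have := homog_d Hs'; rewrite addrK.
have Zq' : cx_d _ q' = 0.
  have : cx_d _ (bsingle w 0 q') = bsingle w 0 0.
    by rewrite q'E [cx_d _ _]linearB cx_dd subr0 bsingle0; exact: Zb.
  by rewrite d_bsingle !linear0 ?scaler0 ?subrr ?add0r => /bsingle_inj[].
(* A cycle of S over q' is multiplied by D - w F, up to a boundary, by p + 1 - w. *)
have [s2 Fs2 Zs2] := acyclic_fib_cycle (@LF g l) Zq'.
pose s0 := cx_pr _ (p + 1) s2; have Hs0 : homog (p + 1) s0 by apply: homog_pr.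
have Fs0 : F g l s0 = q' by rewrite cm_pr Fs2.
have Zs0 : cx_d _ s0 = 0 by apply: cycles_pr.
have [y Dy] := FD Zs0 Hs0; rewrite Fs0 in Dy.
(* The factor vanishes exactly when p = w - 1, the degree of the surplus homology; this is excluded
   by w <= p. *)
have n0 : (p + 1 - w)%:~R != 0 :> k.
  by apply: intr_neq0; rewrite subr_eq0 gt_eqF // (le_lt_trans wp) // ltrDl.
set n := _%:~R in n0.
have c2E : cx_d _ (bsingle w ((-1) ^ (p + 1) *: (n^-1 *: s0)) (- (n^-1 *: y))) = bsingle w 0 q'.
  rewrite d_bsingle; congr bsingle; first by rewrite 2!linearZ /= Zs0 !scaler0.
  rewrite (sgn_homog _ (homogZ _ (homogZ _ Hs0))) mulN1r signN 2!scalerA mulrA sign2 mul1r.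
  rewrite [D _ _ _]linearZ [F _ _ _]linearZ [cx_d _ _]linearN [cx_d _ _]linearZ -Dy /= Fs0.
  rewrite scalerA mulrC -scalerA -scalerBr -scalerBr opprB [X in _ *: X]addrC addrA subrK.
  by rewrite -scalerBl -intrB scalerA mulVf // scale1r.
exists (bsingle w s' 0 + bsingle w ((-1) ^ (p + 1) *: (n^-1 *: s0)) (- (n^-1 *: y))).
by rewrite [cx_d _ _]linearD c2E q'E addrC subrK.
Qed.

End Weights.

Lemma sgn_single n (C : complex k) w (v : C) :
  sgn n (ds_cx int C) (single w v) = single w (sgn n C v).
Proof.
apply: pr_eq => p; rewrite pr_deg !ds_cx_prE.
by rewrite -singleZ pr_deg.
Qed.

Lemma comp_bsingle g l h m f n (ef : f = (g + h)%N) (en : n.+2 = (l + m.+1)%N) (i : 'I_l)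
    w v (s : S g l) q (s' : S h m.+1) q' :
  mo_comp B ef en i (bsingle w s q) (bsingle v s' q')
    = bsingle (w + v) (mo_comp S ef en i s s')
        (mo_comp P ef en i (F g l s) q' + mo_comp P ef en i q (sgn (-1) _ (F h m.+1 s'))).
Proof.
apply: (@et_eq k SZ PZ f n); first exact: ds_compE.
transitivity (mo_comp PZ ef en i (ds_morph int F g l (single w s)) (single v q')
  + mo_comp PZ ef en i (single w q) (sgn (-1) _ (ds_morph int F h m.+1 (single v s')))) => //.
by rewrite !ds_morphE sgn_single !ds_compE /= singleD.
Qed.

Lemma wpr_comp g l h m f n (ef : f = (g + h)%N) (en : n.+2 = (l + m.+1)%N) (i : 'I_l)
    w v (b : B g l) (b' : B h m.+1) : wpr w b = b -> wpr v b' = b' ->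
  wpr (w + v) (mo_comp B ef en i b b') = mo_comp B ef en i b b'.
Proof.
by move=> <- <-; rewrite /wpr comp_bsingle /bsingle /= !ds_coefE eqxx.
Qed.

Lemma wpr_act g l (sigma : 'S_l) w (b : B g l) :
  wpr w (mo_act B g sigma b) = mo_act B g sigma (wpr w b).
Proof.
apply: (@et_eq k SZ PZ g l).
  by rewrite [RHS](ds_actE sigma) /= coef_chain.
by rewrite [RHS](ds_actE sigma) /= coef_chain.
Qed.

Lemma wpr_contr g l f n (ef : f = g.+1) (en : n.+2 = l) (i j : 'I_l) (ne : i != j) w
    (b : B g l) : wpr w (mo_contr B ef en ne b) = mo_contr B ef en ne (wpr w b).
Proof.
apply: (@et_eq k SZ PZ f n).
  by rewrite [RHS](ds_contrE ef en ne) /= coef_chain.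
by rewrite [RHS](ds_contrE ef en ne) /= coef_chain.
Qed.

(** Only cycles are kept on the diagonal, which removes the degree w - 1 and retains all chains of
    higher degree. The class 0 above the diagonal is consistent with the augmentation, since cycles
    there map to boundaries by [aug_boundary]. *)
Inductive diag_gen g l : B g l * H g l -> Prop :=
| DiagHigh w p b : w < p -> homog p b -> wpr w b = b -> diag_gen (b, 0)
| DiagZero w b : homog w b -> wpr w b = b -> cycles _ b -> diag_gen (b, hom_pi (aug g l b)).

(* The truncation of B above the diagonal degree = weight, together with homology classes. *)
Definition diag_rel g l (b : B g l) (h : H g l) := span (@diag_gen g l) (b, h).

Lemma diag_rel_gen g l (b : B g l) (h : H g l) : diag_gen (b, h) -> diag_rel b h.
Proof.
move=> bh; rewrite /diag_rel -[(b, h)]scale1r -[_ *: _]addr0.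
by apply: span_step => //; apply: span_0.
Qed.

Lemma diag_rel_map g l f n (G : {linear B g l -> B f n}) (G' : {linear H g l -> H f n}) b h :
  (forall w p b, w < p -> homog p b -> wpr w b = b -> diag_rel (G b) (G' 0)) ->
  (forall w b, homog w b -> wpr w b = b -> cycles _ b ->
    diag_rel (G b) (G' (hom_pi (aug g l b)))) ->
  diag_rel b h ->
  diag_rel (G b) (G' h).
Proof.
move=> GG GG0; pose T (z : B g l * H g l) : (B f n * H f n)%type := (G z.1, G' z.2).
have lT : linear T by move=> a x y; rewrite /T /= !linearP.
apply: (span_map (S := sm_span (@diag_gen f n)) lT) => _ [w p b' wp Hb bE|w b' Hb bE Zb].
  exact: (GG w p).
exact: (GG0 w).
Qed.

Lemma aug_cycle g l (b : B g l) : cycles _ b -> cycles _ (aug g l b).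
Proof. exact: cm_cycles. Qed.

Fact diag_relP : closed_rel (idfun : {rmorphism k -> k}) diag_rel.
Proof.
split.
- by move=> g l; apply: span_0.
- by move=> g l a x y x' y' Uxy Uxy'; apply: (span_lin a Uxy Uxy').
- move=> g l q b0 h0; apply: diag_rel_map => [w p b wp Hb bE|w b Hb bE Zb].
    rewrite (pr_homog _ Hb) linear0; case: eqP => _; last exact: span_0.
    exact/diag_rel_gen/(DiagHigh wp).
  have Hh : homog w (hom_pi (aug g l b) : H g l).
    by rewrite /homog [LHS]hom_pr_pi ?(cm_homog (aug g l) Hb) //; apply: aug_cycle.
  rewrite (pr_homog _ Hb) (pr_homog _ Hh); case: eqP => _; last exact: span_0.
  exact/diag_rel_gen/(DiagZero Hb).
- move=> g l b0 h0; apply: diag_rel_map => [w p b wp Hb bE|w b Hb bE Zb].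
    have dHb := homog_d Hb; have dbE : wpr w (cx_d _ b) = cx_d _ b by rewrite wpr_d bE.
    rewrite linear0; have [wp1|pw1] := ltP w (p - 1).
      exact/diag_rel_gen/(DiagHigh wp1).
    (* An element one degree above the diagonal has its differential on the diagonal; there its
       class is that of a boundary, hence 0. *)
    have wE : w = p - 1.
      by apply/eqP; rewrite eq_le pw1 andbT -(lerD2r 1) subrK lezD1.
    suff <- : hom_pi (aug g l (cx_d _ b)) = 0 :> H g l.
      by rewrite -wE in dHb; apply/diag_rel_gen/(DiagZero dHb dbE)/cx_dd.
    by rewrite cm_d; apply: hom_pi_eq0.
  by rewrite (Zb : cx_d _ b = 0); apply: span_0.
- move=> g l sigma b0 h0; apply: diag_rel_map => [w p b wp Hb bE|w b Hb bE Zb].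
    rewrite linear0; apply/diag_rel_gen/(DiagHigh wp); first exact: cm_homog.
    by rewrite wpr_act bE.
  rewrite [mo_act (homology_operad P) _ _ _]homology_map_pi; last exact: aug_cycle.
  rewrite -mm_act; apply/diag_rel_gen/(@DiagZero _ _ w); first exact: cm_homog.
    by rewrite wpr_act bE.
  exact: cm_cycles.
- move=> g l h m f n ef en i b u b' u' Ubu Ubu'.
  pose T1 (z : B g l * H g l) : (B f n * H f n)%type :=
    (mo_comp B ef en i z.1 b', mo_comp H ef en i z.2 u').
  have lT1 : linear T1 by move=> a x y; apply: pair_eq; apply: bm_lDZ.
  (* By bilinearity both arguments may be generators. Degree minus weight is additive, so the result
     stays on the diagonal only if both factors do; otherwise the product of classes is 0. *)
  apply: (span_map (S := sm_span (@diag_gen f n)) lT1 _ Ubu) => z Gz.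
  pose T2 (x : B h m.+1 * H h m.+1) : (B f n * H f n)%type :=
    (mo_comp B ef en i z.1 x.1, mo_comp H ef en i z.2 x.2).
  have lT2 : linear T2 by move=> a x x'; apply: pair_eq; apply: bm_rDZ.
  apply: (span_map (S := sm_span (@diag_gen f n)) lT2 _ Ubu') => x Gx.
  rewrite /T2 {T1 T2 lT1 lT2 Ubu Ubu'}; case: z / Gz => [w p c wp Hc cE|w c Hc cE Zc].
    rewrite bm_l0; case: x / Gx => [w' p' c' wp' Hc' cE'|w' c' Hc' cE' Zc'].
      apply/diag_rel_gen/(DiagHigh (ltrD wp wp')); [exact: bm_homog|exact: wpr_comp].
    apply/diag_rel_gen/(@DiagHigh _ _ (w + w') (p + w')); rewrite ?ltrD2r //.
      exact: bm_homog.
    exact: wpr_comp.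
  case: x / Gx => [w' p' c' wp' Hc' cE'|w' c' Hc' cE' Zc'].
    rewrite bm_r0; apply/diag_rel_gen/(@DiagHigh _ _ (w + w') (w + p')); rewrite ?ltrD2l //.
      exact: bm_homog.
    exact: wpr_comp.
  rewrite [mo_comp (homology_operad P) _ _ _ _ _]homology_bimap_pi; try exact: aug_cycle.
  rewrite -mm_comp; apply/diag_rel_gen/(@DiagZero _ _ (w + w')); first exact: bm_homog.
    exact: wpr_comp.
  exact: bm_cycles.
- move=> g l f n ef en i j ne b0 h0; apply: diag_rel_map => [w p b wp Hb bE|w b Hb bE Zb].
    rewrite linear0; apply/diag_rel_gen/(DiagHigh wp); first exact: cm_homog.
    by rewrite wpr_contr bE.
  rewrite [mo_contr (homology_operad P) _ _ _ _]homology_map_pi; last exact: aug_cycle.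
  rewrite -mm_contr; apply/diag_rel_gen/(@DiagZero _ _ w); first exact: cm_homog.
    by rewrite wpr_contr bE.
  exact: cm_cycles.
Qed.

(** * The homology of the truncated operad *)

Section Homology.
Variables g l : nat.
Implicit Types (b : B g l) (h : H g l).

(** Membership in a span does not expose the components of b. These conditions are linear in the
    pair, so checking them on generators makes the components accessible. *)
Definition diag_spec b h :=
  (forall w p, p < w -> cx_pr _ p (wpr w b) = 0) /\
  (forall w, cycles _ (cx_pr _ w (wpr w b)) /\
             hom_pi (aug g l (cx_pr _ w (wpr w b))) = cx_pr _ w h).

Let cmp_lin w p : linear (fun b => cx_pr _ p (wpr w b)).
Proof. by move=> a b b'; rewrite wpr_lin linearP. Qed.

Let hom_pi_aug0 : hom_pi (aug g l 0) = 0 :> H g l.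
Proof. by rewrite linear0; apply: sq_pi0. Qed.

Fact diag_spec0 : diag_spec 0 0.
Proof.
split=> [w p _|w]; rewrite [cx_pr _ _ _](linear_zero (cmp_lin _ _)) //.
by split; [apply: sm_0 | rewrite hom_pi_aug0 linear0].
Qed.

Fact diag_spec_lin a b h b' h' : diag_spec b h -> diag_spec b' h' ->
  diag_spec (a *: b + b') (a *: h + h').
Proof.
move=> [z1 z2] [z1' z2']; split=> [w p pw|w].
  by rewrite [LHS](cmp_lin w p) z1 // z1' // scaler0 addr0.
have [Zc hc] := z2 w; have [Zc' hc'] := z2' w.
rewrite [cx_pr _ _ (wpr _ _)](cmp_lin w w); split; first exact: (@sm_lin _ _ (cycles _)).
by rewrite [aug _ _ _]linearP [LHS]hom_pi_lin ?hc ?hc' ?linearP //; apply: aug_cycle.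
Qed.

Lemma diag_relE b h : diag_rel b h -> diag_spec b h.
Proof.
pose T : submod (B g l * H g l)%type := @Submod _ (B g l * H g l)%type
  (fun z => diag_spec z.1 z.2) diag_spec0 (fun a x y => @diag_spec_lin a x.1 x.2 y.1 y.2).
apply: (span_map (S := T) (f := id)) => // _ [v m {}b vm Hb bE|v {}b Hb bE Zb].
  suff : diag_spec b 0 by [].
  have cE w p : cx_pr _ p (wpr w b) = if (v == w) && (p == m) then b else 0.
    by rewrite -bE wprK bE; case: eqP => _; rewrite ?linear0 // (pr_homog p Hb).
  split=> [w p pw|w]; rewrite cE.
    by case: andP => // -[/eqP vw /eqP pm]; move: vm; rewrite vw -pm ltNge ltW.
  case: andP => [[/eqP vw /eqP pm]|_]; first by move: vm; rewrite vw pm ltxx.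
  by split; [apply: sm_0 | rewrite hom_pi_aug0 linear0].
suff : diag_spec b (hom_pi (aug g l b)) by [].
have cE w p : cx_pr _ p (wpr w b) = if (v == w) && (p == v) then b else 0.
  by rewrite -bE wprK bE; case: eqP => _; rewrite ?linear0 // (pr_homog p Hb).
have Hh : homog v (hom_pi (aug g l b) : H g l).
  by rewrite /homog [LHS]hom_pr_pi ?(cm_homog (aug g l) Hb) //; apply: aug_cycle.
split=> [w p pw|w]; rewrite cE.
  by case: andP => // -[/eqP vw /eqP pv]; move: pw; rewrite -vw pv ltxx.
rewrite (pr_homog w Hh) [w == v]eq_sym andbb; case: eqP => _; first by split.
by split; [apply: sm_0 | apply: hom_pi_aug0].
Qed.

Lemma cmp_cycle w p b : cycles _ b -> cycles _ (cx_pr _ p (wpr w b)).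
Proof.
move=> Zb; apply: cycles_pr; have := wpr_d w b.
by rewrite (Zb : cx_d _ b = 0) (linear_zero (wpr_lin w)) => /esym.
Qed.

Let wpr_cmp w p b : wpr w (cx_pr _ p (wpr w b)) = cx_pr _ p (wpr w b).
Proof. by rewrite wpr_pr wprK eqxx. Qed.

(** In degree n only the summand of weight n contributes to the class: all other components have
    augmentations that bound by [aug_boundary]. *)
Lemma diag_class b h : diag_rel b h -> cycles _ b -> h = hom_pi (aug g l b).
Proof.
move=> /diag_relE[_ bh] Zb; apply: pr_eq => n; have [Zn <-] := bh n.
rewrite [RHS]hom_pr_pi; last exact: aug_cycle.
rewrite -[cx_pr _ n (aug g l b)]cm_pr.
apply: hom_pi_eq; try by apply: aug_cycle => //; apply: cycles_pr.
have [s sE] := wpr_sum b; pose t := undup (n :: s).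
have bE : b = \sum_(w <- t) wpr w b.
  by apply: sE => [|w ws]; rewrite ?undup_uniq // mem_undup inE ws orbT.
have -> : cx_pr _ n b = cx_pr _ n (wpr n b) + \sum_(w <- t | w != n) cx_pr _ n (wpr w b).
  rewrite {1}bE linear_sum (bigD1_seq n) ?undup_uniq //.
  by rewrite mem_undup inE eqxx.
rewrite [aug _ _ (_ + _)]linearD opprD addrA subrr add0r; apply: (@sm_N _ _ (boundaries _)).
rewrite [aug _ _ _]linear_sum; apply: (big_ind (boundaries (P g l))) => [|x y|w wn].
- exact: sm_0.
- exact: (@sm_D _ _ (boundaries _)).
apply: (@aug_boundary g l w n); rewrite ?wpr_cmp //; first exact: homog_pr.
  exact: cmp_cycle.
by rewrite eq_sym.
Qed.

(** Each component of b in weight w and degree p >= w bounds a chain of degree p + 1, which lies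
    strictly above the diagonal and so has class 0. *)
Lemma diag_acyclic b : diag_rel b 0 -> cycles _ b ->
  exists2 c, diag_rel c 0 & cx_d _ c = b.
Proof.
move=> /diag_relE[b1 b2] Zb; have [s sE] := wpr_sum b; have [r rE] := cx_sumE b.
pose bnd x := exists2 c : B g l, diag_rel c 0 & cx_d _ c = x.
have bnd0 : bnd 0 by exists 0; [apply: span_0 | rewrite linear0].
have bndD x y : bnd x -> bnd y -> bnd (x + y).
  move=> [c Uc <-] [c' Uc' <-]; exists (c + c'); last by rewrite linearD.
  rewrite /diag_rel; have -> : (c + c', 0) = 1 *: (c, 0) + (c', 0) :> (B g l * H g l)%type.
    by rewrite scale1r; apply: pair_eq => //; rewrite /= addr0.
  exact: span_lin.
rewrite -/(bnd b) (sE (undup s)) ?undup_uniq // => [|w]; last by rewrite mem_undup.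
apply: (big_ind bnd) => // w _.
have -> : wpr w b = \sum_(p <- undup r) wpr w (cx_pr _ p b).
  rewrite {1}(rE (undup r)) ?undup_uniq // => [|p]; last by rewrite mem_undup.
  exact: (linear_sum (mk_linear (@wpr_lin g l w))).
apply: (big_ind bnd) => // p _; rewrite wpr_pr; have [pw|wp] := ltP p w; first by rewrite [cx_pr _ _ _]b1.
have Hx := homog_pr p (wpr w b); have Zx := cmp_cycle w p Zb.
have [|c [cE Hc <-]] := weight_boundary (wpr_cmp w p b) Hx Zx wp.
  (* Off the diagonal the augmentation always bounds; on it, the class is the component of the
     prescribed class, here 0. *)
  have [pw|pw] := eqVneq p w; last exact: aug_boundary (wpr_cmp w p b) Hx Zx pw.
  have [_ hw] := b2 w; apply/hom_pi_eq0P; first exact: aug_cycle.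
  by rewrite pw [LHS]hw linear0.
exists c => //; apply/diag_rel_gen/(DiagHigh _ Hc cE).
by rewrite (le_lt_trans wp) // ltrDl.
Qed.

(** A cycle of degree n lifts to a cycle s of S, and D s - n F s = dy. Completing s by y, up to
    sign, gives a cycle of weight and degree n. *)
Lemma diag_surj h : exists2 b, diag_rel b h & cycles _ b.
Proof.
elim/homog_ind: h => [|h h' [b Ub Zb] [b' Ub' Zb']|n h].
- by exists 0; [apply: span_0 | apply: sm_0].
- exists (b + b'); last exact: (@sm_D _ _ (cycles _)).
  rewrite /diag_rel; have -> : (b + b', h + h') = 1 *: (b, h) + (b', h') :> (B g l * H g l)%type.
    by rewrite scale1r.
  exact: span_lin.
elim/homology_homog_ind=> x Zx Hx.
have [s1 Fs1 Zs1] := acyclic_fib_cycle (@LF g l) Zx.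
pose s := cx_pr _ n s1; have Hs : homog n s by apply: homog_pr.
have Fs : F g l s = x by rewrite cm_pr Fs1.
have Zs : cx_d _ s = 0 by apply: cycles_pr.
have [y Dy] := FD Zs Hs.
(* The sign matches the [sgn (-1)] in the differential. The projection to degree n is needed because
   y was not chosen homogeneous. *)
pose b1 := bsingle n s (- ((-1) ^ n *: y)); pose b := cx_pr _ n b1.
have b1E : wpr n b1 = b1 by rewrite /wpr /b1 /bsingle /= !ds_coefE eqxx.
have Zb : cycles _ b.
  apply: cycles_pr; suff : cx_d _ b1 = 0 by [].
  rewrite d_bsingle Zs (sgn_homog _ Hs) mulN1r signN [D _ _ _]linearZ [F _ _ _]linearZ.
  rewrite [cx_d _ _]linearN [cx_d _ _]linearZ -Dy.
  by rewrite scalerA [_ * (-1) ^ n]mulrC -scalerA -scalerBr subrr bsingle0.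
exists b => //; have <- : hom_pi (aug g l b) = hom_pi x :> H g l.
  by rewrite cm_pr aug_bsingle Fs Hx.
apply/diag_rel_gen/(DiagZero (homog_pr n b1)) => //.
by rewrite -/b wpr_pr b1E.
Qed.

End Homology.

Definition diag_operad : modular_operad k := sub_product diag_relP.
Definition diag_to_homology : mo_morphism diag_operad H := sp_snd diag_relP.
Definition diag_to_operad : mo_morphism diag_operad P := mm_trans (sp_fst diag_relP) aug.

Let diagP g l (u : diag_operad g l) : diag_rel (sp1 u) (sp2 u).
Proof. exact: (spP u). Qed.

Let diag_ex g l b h : @diag_rel g l b h -> exists2 u : diag_operad g l, sp1 u = b & sp2 u = h.
Proof.
move=> Ubh; exists (@sp_in _ _ _ _ _ _ diag_relP g l b h); first exact: sp1_in.
exact: sp2_in.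
Qed.

Let diag_d1 g l (u : diag_operad g l) : sp1 (cx_d _ u) = cx_d _ (sp1 u).
Proof. exact: sp1_d. Qed.

Let diag_cycle g l (u : diag_operad g l) : cycles _ u <-> cycles _ (sp1 u).
Proof.
split=> [Zu|Zu].
  suff : cx_d _ (sp1 u) = 0 by [].
  by rewrite -diag_d1 (Zu : cx_d _ u = 0) /sp1 sm_out0.
suff : cx_d _ u = 0 by [].
apply: sp_eq; first by rewrite diag_d1 (Zu : cx_d _ _ = 0) /sp1 sm_out0.
by rewrite [LHS]sp2_d /sp2 sm_out0.
Qed.

Let diag_boundary g l (u : diag_operad g l) : cycles _ u -> sp2 u = 0 -> boundaries _ u.
Proof.
move=> /diag_cycle Zu u0; have := diagP u; rewrite u0 => /diag_acyclic /(_ Zu)[c Uc dc].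
have [v v1 v2] := diag_ex Uc; exists v; apply: sp_eq; first by rewrite diag_d1 v1.
by rewrite u0 [RHS]sp2_d.
Qed.

Lemma diag_to_homology_weq : weak_equivalence diag_to_homology.
Proof.
apply/weak_equivalenceP => g l; split=> [y _|u Zu [v u0]]; last exact: diag_boundary.
have [b Ub Zb] := diag_surj y; have [u u1 u2] := diag_ex Ub.
exists u; first by apply/diag_cycle; rewrite u1.
have -> : diag_to_homology g l u = y by [].
by rewrite subrr; apply: sm_0.
Qed.

(** By [diag_class] the augmentation of a cycle represents its class, so this map and the one to
    homology agree on homology and the same two lemmas settle both. *)
Lemma diag_to_operad_weq : weak_equivalence diag_to_operad.
Proof.
apply/weak_equivalenceP => g l; split=> [y Zy|u Zu Bu].
  have [b Ub Zb] := diag_surj (hom_pi y : H g l); have [u u1 u2] := diag_ex Ub.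
  exists u; first by apply/diag_cycle; rewrite u1.
  have -> : diag_to_operad g l u = aug g l b by rewrite -u1.
  by apply/hom_pi_eqP => //; [apply: aug_cycle | rewrite -(diag_class Ub)].
apply: diag_boundary => //; have Zu1 := (diag_cycle u).1 Zu.
rewrite (diag_class (diagP u) Zu1); apply/hom_pi_eq0P => //; exact: aug_cycle.
Qed.

Theorem formal_of_lifts_degree : formal P.
Proof.
apply: (zigzag_fwd (F := diag_to_homology)); last exact: diag_to_homology_weq.
by apply: (zigzag_bwd (F := diag_to_operad)) diag_to_operad_weq; apply: zigzag_refl.
Qed.

End FormalityOfDegreeLift.

(** * Flatness and the theorem *)

Section Flatness.
Variables (k K : fieldType) (emb : {rmorphism k -> K}).

Definition klinear (rho : K -> k) := forall a x y, rho (emb a * x + y) = a * rho x + rho y.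

Lemma functional_ex (c : K) : c != 0 -> exists2 rho, klinear rho & rho c = 1.
Proof.
move=> c0; have [|rho rl [_ r1]] := @separating_functional k (res emb K^o) (sm_zero _) c.
  exact/eqP.
by exists rho.
Qed.

Lemma klinear_sum (rho : K -> k) n (a : nat -> k) (c : nat -> K) : klinear rho ->
  rho (\sum_(i < n) emb (a i) * c i) = \sum_(i < n) a i * rho (c i).
Proof.
move=> rl; elim: n => [|n IH]; first by rewrite !big_ord0 (klin0 rl).
by rewrite !big_ord_recr /= (klinD rl) (klinZ rl) IH.
Qed.

Section Module.
Variable V : lmodType k.

Lemma contract_sum (rho : K -> k) n (c : nat -> K) (v : nat -> V) : klinear rho ->
  contract (emb := emb) rho (\sum_(i < n) c i *: ext_inj emb (v i))
    = \sum_(i < n) rho (c i) *: v i.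
Proof.
move=> rl; elim: n => [|n IH]; first by rewrite !big_ord0 (contract0 rl).
by rewrite !big_ord_recr /= (contractD rl) (contract_inj rl) IH.
Qed.

(** Every tensor has coefficients independent over k, and the functionals rho_i dual to them recover
    each v_i from u. Induction on the number of terms, in the manner of Gram-Schmidt. *)
Lemma ext_independent (u : ext_scalars emb V) :
  exists n (c : nat -> K) (v : nat -> V) (rho : nat -> K -> k),
  [/\ forall i, klinear (rho i),
      forall i j, (i < n)%N -> (j < n)%N -> rho i (c j) = (i == j)%:R
    & u = \sum_(i < n) c i *: ext_inj emb (v i)].
Proof.
elim/ext_ind: u => [|c v u [n [cs [vs [rho [rl rc ->]]]]]].
  exists 0, (fun=> 0), (fun=> 0), (fun _ _ => 0); split; rewrite ?big_ord0 //.
  by move=> _ a x y; rewrite mulr0 addr0.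
(* The part of c along the earlier c_i is moved onto the vectors v_i, leaving a remainder c0 killed
   by every rho_i. *)
pose b i := rho i c; pose c0 := c - \sum_(i < n) emb (b i) * cs i.
pose vs' i := vs i + b i *: v.
have uE : c *: ext_inj emb v + \sum_(i < n) cs i *: ext_inj emb (vs i)
    = \sum_(i < n) cs i *: ext_inj emb (vs' i) + c0 *: ext_inj emb v.
  rewrite scalerBl scaler_suml [c *: _ - _]addrC addrA [LHS]addrC; congr (_ + _).
  rewrite -sumrB; apply: eq_bigr => i _.
  by rewrite ext_injD ext_injZ scalerDr scalerA [cs i * _]mulrC addrK.
have rc0 j : (j < n)%N -> rho j c0 = 0.
  move=> jn; rewrite /c0 addrC -mulN1r -(rmorphN1 emb) rl klinear_sum //.
  rewrite (bigD1 (Ordinal jn)) //= big1 => [|i /negPf ij].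
    by rewrite rc // eqxx mulr1 addr0 mulN1r addNr.
  by rewrite rc // [j == i]eq_sym [_ == j]ij mulr0.
have [c00|c0n] := eqVneq c0 0.
  by exists n, cs, vs', rho; split=> //; rewrite uE c00 scale0r addr0.
have [sigma sl s1] := functional_ex c0n.
(* The correction makes the new functional vanish on all c_i and leaves its value 1 at c0. *)
pose rn x := sigma x - \sum_(i < n) sigma (cs i) * rho i x.
exists n.+1, (fun i => if i == n then c0 else cs i), (fun i => if i == n then v else vs' i),
  (fun i => if i == n then rn else rho i); split.
- move=> i; case: eqP => // _ a x y; rewrite /rn sl mulrBr.
  rewrite [RHS]addrACA -opprD; congr (_ - _).
  by rewrite mulr_sumr -big_split; apply: eq_bigr => j _ /=; rewrite rl mulrDr mulrCA.
- have rnc j : (j < n)%N -> rn (cs j) = 0.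
    move=> jn; rewrite /rn (bigD1 (Ordinal jn)) //= big1 => [|i /negPf ij].
      by rewrite rc // eqxx mulr1 addr0 subrr.
    by rewrite rc // [_ == j]ij mulr0.
  have rnc0 : rn c0 = 1.
    by rewrite /rn s1 big1 ?subr0 // => i _; rewrite rc0 ?mulr0.
  move=> i j; rewrite !ltnS => iN jN.
  case: (j =P n) => [->|/eqP jn]; case: (i =P n) => [iE|/eqP i_n] //.
  + by rewrite rc0 // ltn_neqAle i_n.
  + by rewrite iE eq_sym (negPf jn) rnc // ltn_neqAle jn.
  by rewrite rc // ltn_neqAle ?i_n ?jn.
rewrite uE [RHS]big_ord_recr (eqxx n); apply: (congr2 +%R) => //=.
by apply: eq_bigr => i _; rewrite (ltn_eqF (ltn_ord i)).
Qed.

End Module.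

Lemma dual_coef (V : lmodType k) n (c : nat -> K) (v : nat -> V) (rho : nat -> K -> k) :
  (forall i, klinear (rho i)) ->
  (forall i j, (i < n)%N -> (j < n)%N -> rho i (c j) = (i == j)%:R) ->
  forall i, (i < n)%N ->
    contract (emb := emb) (rho i) (\sum_(j < n) c j *: ext_inj emb (v j)) = v i.
Proof.
move=> rl rc i ltin; rewrite contract_sum // (bigD1 (Ordinal ltin)) //= big1 => [|j /negPf ij].
  by rewrite rc // eqxx scale1r addr0.
by rewrite rc // [i == j]eq_sym [_ == i]ij scale0r.
Qed.

(** The v_i are contractions of u, and contraction commutes with the differential. *)
Lemma ext_independent_cycle (C : complex k) (u : ext_complex emb C) : cycles _ u ->
  exists n (c : nat -> K) (v : nat -> C) (rho : nat -> K -> k),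
  [/\ forall i, klinear (rho i),
      forall i, (i < n)%N -> contract (emb := emb) (rho i) u = v i,
      forall i, (i < n)%N -> cycles C (v i)
    & u = \sum_(i < n) c i *: ext_inj emb (v i)].
Proof.
move=> Zu; have [n [c [v [rho [rl rc uE]]]]] := ext_independent u.
have uv i : (i < n)%N -> contract (emb := emb) (rho i) u = v i.
  by rewrite uE; apply: dual_coef.
exists n, c, v, rho; split=> // i ltin.
suff : cx_d C (v i) = 0 by [].
by rewrite -uv // -(contract_d (rl i)) (Zu : cx_d _ u = 0) (contract0 (rl i)).
Qed.

Lemma ext_cycles (C : complex k) (v : C) : cycles C v ->
  cycles (ext_complex emb C) (ext_inj emb v).
Proof. by move=> Zv; rewrite /= [LHS]ext_complex_d_inj (Zv : cx_d C v = 0) ext_inj0. Qed.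

Lemma ext_boundaries (C : complex k) (v : C) : boundaries C v ->
  boundaries (ext_complex emb C) (ext_inj emb v).
Proof. by move=> [w ->]; exists (ext_inj emb w); rewrite ext_complex_d_inj. Qed.

(** Surjectivity is checked on each v_i. For injectivity, contracting a bounding chain by the dual
    functionals shows that each f v_i bounds. *)
Lemma ext_quasi_iso (C D : complex k) (f : chain_map C D) :
  quasi_iso f -> quasi_iso (ext_map emb f).
Proof.
move=> [fs fi]; split=> [y /ext_independent_cycle|x /ext_independent_cycle].
  move=> [n [c [v [rho [_ _ Zv ->]]]]].
  pose good y := exists2 x, cycles (ext_complex emb C) x & boundaries _ (ext_map emb f x - y).
  apply: (big_ind good) => [|a b [x Zx Bx] [x' Zx' Bx']|i _].
  - by exists 0; [apply: sm_0 | rewrite linear0 subr0; apply: sm_0].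
  - exists (x + x'); first exact: (@sm_D _ _ (cycles _)).
    by rewrite linearD opprD addrACA; apply: (@sm_D _ _ (boundaries _)).
  have [x Zx Bx] := fs _ (Zv i (ltn_ord i)); exists (c i *: ext_inj emb x).
    exact/(@sm_Z _ _ (cycles _))/ext_cycles.
  rewrite linearZ /= -scalerBr; apply: (@sm_Z _ _ (boundaries (ext_complex emb D))).
  rewrite [ext_map _ _ _]ext_map_inj -scaleN1r -(rmorphN1 emb) addrC -ext_inj_lin.
  by apply: ext_boundaries; rewrite scaleN1r addrC.
move=> [n [c [v [rho [rl xv Zv xE]]]]] [y fx].
rewrite xE; apply: (big_ind (boundaries (ext_complex emb C))) => [|a b|i _].
- exact: sm_0.
- exact: (@sm_D _ _ (boundaries _)).
apply/(@sm_Z _ _ (boundaries (ext_complex emb C)))/ext_boundaries/fi; first exact: Zv.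
exists (contract (emb := emb) (rho i) y).
by rewrite -(contract_d (rl i)) -fx (contract_map (rl i)) xv.
Qed.

Lemma ext_actE (P : modular_operad k) g l (sigma : 'S_l) (x : P g l) :
  mo_act (ext_operad emb P) g sigma (ext_inj emb x) = ext_inj emb (mo_act P g sigma x).
Proof. exact: ext_map_inj. Qed.

Lemma ext_compE (P : modular_operad k) g l h m f n (ef : f = (g + h)%N)
    (en : n.+2 = (l + m.+1)%N) (i : 'I_l) (x : P g l) (y : P h m.+1) :
  mo_comp (ext_operad emb P) ef en i (ext_inj emb x) (ext_inj emb y)
    = ext_inj emb (mo_comp P ef en i x y).
Proof. exact: ext_bimap_inj. Qed.

Lemma ext_contrE (P : modular_operad k) g l f n (ef : f = g.+1) (en : n.+2 = l) (i j : 'I_l)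
    (ne : i != j) (x : P g l) :
  mo_contr (ext_operad emb P) ef en ne (ext_inj emb x) = ext_inj emb (mo_contr P ef en ne x).
Proof. exact: ext_map_inj. Qed.

Definition ext_morphism (P Q : modular_operad k) (F : mo_morphism P Q) :
  mo_morphism (ext_operad emb P) (ext_operad emb Q).
Proof.
apply: (@MoMorphism K (ext_operad emb P) (ext_operad emb Q) (fun g l => ext_map emb (F g l))).
- move=> g l sigma; apply: ext_eq; [| |move=> x].
  + exact: (lin_cm _ (lin_cm _ (@lin_id _ _))).
  + exact: (lin_cm _ (lin_cm _ (@lin_id _ _))).
  by rewrite ext_actE (ext_map_inj emb (F g l)) (ext_map_inj emb (F g l)) mm_act ext_actE.
- move=> g l h m f n ef en i x y; move: x; apply: ext_eq; [| |move=> x].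
  + exact: (lin_cm _ (lin_bml _ _ (@lin_id _ _))).
  + exact: (lin_bml _ _ (lin_cm _ (@lin_id _ _))).
  move: y; apply: ext_eq; [| |move=> y].
  + exact: (lin_cm _ (lin_bmr _ _ (@lin_id _ _))).
  + exact: (lin_bmr _ _ (lin_cm _ (@lin_id _ _))).
  by rewrite ext_compE !(ext_map_inj emb (F _ _)) mm_comp ext_compE.
- move=> g l f n ef en i j ne; apply: ext_eq; [| |move=> x].
  + exact: (lin_cm _ (lin_cm _ (@lin_id _ _))).
  + exact: (lin_cm _ (lin_cm _ (@lin_id _ _))).
  by rewrite ext_contrE (ext_map_inj emb (F f n)) (ext_map_inj emb (F g l)) mm_contr ext_contrE.
Defined.

Lemma ext_weak_equivalence (P Q : modular_operad k) (F : mo_morphism P Q) :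
  weak_equivalence F -> weak_equivalence (ext_morphism F).
Proof.
move=> /weak_equivalenceP wF; apply/weak_equivalenceP => g l; exact: ext_quasi_iso.
Qed.

Lemma ext_zigzag (P Q : modular_operad k) :
  weq_zigzag P Q -> weq_zigzag (ext_operad emb P) (ext_operad emb Q).
Proof.
elim=> [|R R' F _ IH wF|R R' F _ IH wF]; first exact: zigzag_refl.
  exact: (zigzag_fwd (F := ext_morphism F) IH (ext_weak_equivalence wF)).
exact: (zigzag_bwd (F := ext_morphism F) IH (ext_weak_equivalence wF)).
Qed.

(** * Homology commutes with extension of scalars *)

Section HomologyComparison.
Variable C : complex k.
Let CK := ext_complex emb C.

Definition hom_ext_fun (u : homology C) : homology CK := hom_pi (ext_inj emb (sq_val u) : CK).

Lemma hom_ext_funE x : cycles C x ->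
  hom_ext_fun (hom_pi x) = hom_pi (ext_inj emb x : CK).
Proof.
move=> Zx; apply: hom_pi_eq; try by apply: ext_cycles => //; apply: sq_val_mem.
rewrite -scaleN1r -(rmorphN1 emb) addrC -ext_inj_lin scaleN1r addrC.
by apply: ext_boundaries; apply: sq_pi_val.
Qed.

Fact hom_ext_subproof a u v :
  hom_ext_fun (a *: u + v) = emb a *: hom_ext_fun u + hom_ext_fun v.
Proof.
elim/homology_ind: u => x Zx; elim/homology_ind: v => y Zy.
rewrite -[a *: _ + _]hom_pi_lin // !hom_ext_funE //; last exact: (@sm_lin _ _ (cycles C)).
by rewrite ext_inj_lin [LHS]hom_pi_lin //; apply: ext_cycles.
Qed.

Let hom_ext_lin : {linear ext_complex emb (homology C) -> homology CK} :=
  ext_lift hom_ext_subproof.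

Let hom_ext_linE x : cycles C x ->
  hom_ext_lin (ext_inj emb (hom_pi x)) = hom_pi (ext_inj emb x : CK).
Proof. by move=> Zx; rewrite [LHS]ext_lift_inj hom_ext_funE. Qed.

Fact hom_ext_pr p u :
  hom_ext_lin (cx_pr (ext_complex emb (homology C)) p u) = cx_pr _ p (hom_ext_lin u).
Proof.
move: u; apply: ext_eq => [a u v|a u v|]; do ?by rewrite 2!linearP.
elim/homology_ind=> x Zx.
have prE : cx_pr (homology C) p (hom_pi x) = hom_pi (cx_pr C p x) by apply: hom_pr_pi.
rewrite ext_complex_pr_inj (hom_ext_linE Zx) prE (hom_ext_linE (cycles_pr p Zx)).
by rewrite [RHS]hom_pr_pi; [rewrite ext_complex_pr_inj | apply: ext_cycles].
Qed.

Fact hom_ext_d u :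
  hom_ext_lin (cx_d (ext_complex emb (homology C)) u) = cx_d _ (hom_ext_lin u).
Proof.
elim/ext_complex_ind: u => [|c v u IH]; first by rewrite !linear0.
by rewrite !linearP IH ext_complex_d_inj ext_inj0 linear0 scaler0.
Qed.

Definition hom_ext : chain_map (ext_complex emb (homology C)) (homology CK) :=
  ChainMap hom_ext_pr hom_ext_d.

Lemma hom_extE x : cycles C x -> hom_ext (ext_inj emb (hom_pi x)) = hom_pi (ext_inj emb x : CK).
Proof. exact: hom_ext_linE. Qed.

Lemma hom_ext_sum n (c : nat -> K) (v : nat -> C) : (forall i, (i < n)%N -> cycles C (v i)) ->
  hom_ext (\sum_(i < n) c i *: ext_inj emb (hom_pi (v i)))
    = hom_pi (\sum_(i < n) c i *: ext_inj emb (v i) : CK)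
  /\ cycles CK (\sum_(i < n) c i *: ext_inj emb (v i)).
Proof.
elim: n => [|n IH] Zv.
  by rewrite !big_ord0 linear0 [hom_pi 0]sq_pi0; split=> //; apply: sm_0.
have [i|IHn Zn] := IH; first by move/ltnW; apply: Zv.
have Zvn := ext_cycles (Zv n (ltnSn n)).
have recr (U : lmodType K) (G : nat -> U) : \sum_(i < n.+1) G i = G n + \sum_(i < n) G i.
  by rewrite big_ord_recr addrC.
rewrite (recr _ (fun i => c i *: ext_inj emb (hom_pi (v i)))).
rewrite (recr _ (fun i => c i *: ext_inj emb (v i))); split; last exact: (@sm_lin _ _ (cycles CK)).
by rewrite [LHS]linearP IHn (hom_extE (Zv n (ltnSn n))); apply/esym/(hom_pi_lin _ Zvn Zn).
Qed.

(** A cycle of the extension is a combination of cycles v_i (x) 1, hence in the image. If such a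
    combination bounds, the dual functionals contract the bounding chain to one for each v_i. *)
Lemma hom_ext_quasi_iso : quasi_iso hom_ext.
Proof.
split=> [y _|x _ Bx].
  elim/homology_ind: y => z /ext_independent_cycle[n [c [v [rho [_ _ Zv ->]]]]].
  have [e _] := hom_ext_sum c Zv; exists (\sum_(i < n) c i *: ext_inj emb (hom_pi (v i))).
    suff d0 (u : ext_complex emb (homology C)) : cx_d _ u = 0 by apply: d0.
    elim/ext_complex_ind: u => [|a w u IH]; first exact: linear0.
    by rewrite linearP IH ext_complex_d_inj ext_inj0 scaler0 addr0.
  by rewrite e subrr; apply: sm_0.
have {Bx} x0 : hom_ext x = 0 by case: Bx => y ->.
have [n [c [u [rho [rl rc xE]]]]] := ext_independent x.
pose v i : C := sq_val (u i).
have Zv i : cycles C (v i) by apply: sq_val_mem.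
have vE i : hom_pi (v i) = u i by apply: sq_piK.
have [e Zs] := hom_ext_sum c (fun i (_ : (i < n)%N) => Zv i).
move: x0; rewrite xE; under eq_bigr do rewrite -vE.
rewrite e => /(hom_pi_eq0P Zs)[y sE].
rewrite big1 => [|i _]; first exact: sm_0.
suff -> : hom_pi (v i) = 0 :> homology C by rewrite ext_inj0 scaler0.
apply/hom_pi_eq0P => //; exists (contract (emb := emb) (rho i) y).
by rewrite -(contract_d (rl i)) -sE (dual_coef v rl rc).
Qed.

End HomologyComparison.

Definition hom_ext_morphism (P : modular_operad k) :
  mo_morphism (ext_operad emb (homology_operad P)) (homology_operad (ext_operad emb P)).
Proof.
apply: (@MoMorphism K (ext_operad emb (homology_operad P)) (homology_operad (ext_operad emb P))
  (fun g l => hom_ext (P g l))).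
- move=> g l sigma; apply: ext_eq; [| |elim/homology_ind=> x Zx].
  + exact: (lin_cm _ (lin_cm _ (@lin_id _ _))).
  + exact: (lin_cm _ (lin_cm _ (@lin_id _ _))).
  rewrite ext_actE (hom_extE Zx) [mo_act _ _ _ _ in LHS]homology_map_pi //.
  rewrite hom_extE; last exact: cm_cycles.
  rewrite [RHS]homology_map_pi; last exact: ext_cycles.
  by congr hom_pi; rewrite ext_actE.
- move=> g l h m f n ef en i x y; move: x; apply: ext_eq; [| |elim/homology_ind=> x Zx].
  + exact: (lin_cm _ (lin_bml _ _ (@lin_id _ _))).
  + exact: (lin_bml _ _ (lin_cm _ (@lin_id _ _))).
  move: y; apply: ext_eq; [| |elim/homology_ind=> y Zy].
  + exact: (lin_cm _ (lin_bmr _ _ (@lin_id _ _))).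
  + exact: (lin_bmr _ _ (lin_cm _ (@lin_id _ _))).
  rewrite ext_compE (hom_extE Zx) (hom_extE Zy) [mo_comp _ _ _ _ _ _ in LHS]homology_bimap_pi //.
  rewrite hom_extE; last exact: bm_cycles.
  rewrite [RHS]homology_bimap_pi; try exact: ext_cycles.
  by congr hom_pi; rewrite ext_compE.
- move=> g l f n ef en i j ne; apply: ext_eq; [| |elim/homology_ind=> x Zx].
  + exact: (lin_cm _ (lin_cm _ (@lin_id _ _))).
  + exact: (lin_cm _ (lin_cm _ (@lin_id _ _))).
  rewrite ext_contrE (hom_extE Zx) [mo_contr _ _ _ _ _ in LHS]homology_map_pi //.
  rewrite hom_extE; last exact: cm_cycles.
  rewrite [RHS]homology_map_pi; last exact: ext_cycles.
  by congr hom_pi; rewrite ext_contrE.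
Defined.

(** The extended zigzag ends at HP (x) K, and the comparison map prolongs it to H(P (x) K). *)
Lemma ext_formal (P : modular_operad k) : formal P -> formal (ext_operad emb P).
Proof.
move=> /ext_zigzag zP; apply: (zigzag_fwd (F := hom_ext_morphism P) zP).
apply/weak_equivalenceP => g l; exact: hom_ext_quasi_iso.
Qed.

(** The path objects live over K, hence the transfer of the characteristic. A functional with rho 1
    = 1 is the retraction that the descent requires. *)
Lemma formal_descent (P : modular_operad k) : [pchar k] =i pred0 ->
  formal (ext_operad emb P) -> formal P.
Proof.
move=> char_k; have char_K : [pchar K] =i pred0 by move=> p; rewrite (fmorph_pchar emb).
move=> /(zigzag_spanned char_K)[S [f [h [Lf Lh]]]].
have [rho rl r1] := functional_ex (oner_neq0 K).
have Hd g l (u : homology_operad (ext_operad emb P) g l) : cx_d _ u = 0 by [].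
have LD := descent_lifts_degree (f := f) Lh (Hd := Hd) rl r1.
exact: (formal_of_lifts_degree char_k (fibration_descent (Hd := Hd) Lf Lh) LD).
Qed.

End Flatness.

Theorem theorem8p8p3 (k K : fieldType) (emb : {rmorphism k -> K})
    (char_k : [pchar k]%R =i pred0) (P : modular_operad k)
    (ftP : homology_finite_type P) :
  formal P <-> formal (ext_operad emb P).
Proof. by split; [apply: ext_formal | apply: formal_descent]. Qed.
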